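(* Let $A:=(V,m_2,\omega)$ be a strictly graded commutative Frobenius algebra and let $m\in\mathcal{SC}_n(A)$ be an extendable symplectic $C_n$-structure. Then $HC^{n+1,|\omega|}_{\mathrm{Harr}}(A)$ acts freely and transitively on $\mathcal{SE}_n(m)$ by $$HC^{n+1,|\omega|}_{\mathrm{Harr}}(A)\times\mathcal{SE}_n(m)\to\mathcal{SE}_n(m),\qquad(\alpha,m_n)\mapsto m_n+\Upsilon_{\mathrm{Lie}}(\alpha).$$
   Context: Conventions. $\mathbb K$ is an evenly graded commutative ring containing $\mathbb Q$; modules are graded $\mathbb K$-modules, cohomologically graded, with the Koszul sign rule. $(\Sigma V)^i=V^{i+1}$, $(\Sigma^{-1}V)^i=V^{i-1}$; $\Sigma V^*$ means $\mathrm{Hom}_{\mathbb K}(\Sigma V,\mathbb K)$. Profinite modules are inverse limits of free modules of finite rank. For $W$ profinite, $\widehat TW=\prod_{i\ge0}W^{\hat\otimes i}$ and $\widehat LW\subset\widehat TW$ is the Lie subalgebra of convergent (possibly infinite) linear combinations of Lie monomials. Vector field = continuous derivation; diffeomorphism = invertible continuous homomorphism; $\mathrm{Der}(X)$, $\mathrm{Aut}(X)$ are the Lie algebra and group of these. Elements of $W^{\hat\otimes n}$ have order $n$; an endomorphism of $\widehat LW$ has order $n$ if it takes elements of order $i$ to elements of order $i+n-1$. $(n)$ denotes the module of continuous endomorphisms of $\widehat L\Sigma V^*$ of order $\ge n$. A diffeomorphism is pointed if it is of the form $\mathrm{id}+\phi_2+\phi_3+\cdots$ with $\phi_i$ an endomorphism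 of order $i$. Lie de Rham complex. For $g=\widehat LW$ with $\widehat{\mathcal U}(g)=\widehat TW$: $\Omega^1_{\mathrm{Lie}}(g)$ is the quotient of $\widehat{\mathcal U}(g)\hat\otimes g$ (elements written $x\otimes dy$) by $x\otimes d[y,z]=xy\otimes dz-(-1)^{|z||y|}xz\otimes dy$, with $g$ acting by left multiplication. $\Omega^\bullet_{\mathrm{Lie}}(g)=g\ltimes\widehat L(\Sigma^{-1}\Omega^1_{\mathrm{Lie}}(g))$ with the unique differential $d$ extending $y\mapsto dy=1\otimes dy$ to a differential graded Lie algebra structure. $DR^\bullet_{\mathrm{Lie}}(g)$ is the quotient of $\Omega^\bullet_{\mathrm{Lie}}(g)\hat\otimes\Omega^\bullet_{\mathrm{Lie}}(g)$ by $x\otimes y=(-1)^{|x||y|}y\otimes x$ and $x\otimes[y,z]=[x,y]\otimes z$, with $d(x\otimes y)=dx\otimes y+(-1)^{|x|}x\otimes dy$. $i$-forms $DR^i$ are the $i$-fold suspension of the part of form-degree $i$ (so the degree of $dx\otimes dy\in DR^2$ is $|x|+|y|$). The order of a form is its tensor degree in $W$ minus its form degree. For a vector field $\xi$, $L_\xi$ and $i_\xi$ are the derivations of $\Omega^\bullet_{\mathrm{Lie}}(g)$ with $L_\xi(x)=\xi(x)$, $L_\xi(dx)=(-1)^{|\xi|}d(\xi(x))$, $i_\xi(x)=0$, $i_\xi(dx)=\xi(x)$; they induce operators on $DR^\bullet_{\mathrm{Lie}}(g)$ by the Leibniz rule. A diffeomorphism $\phi$ induces $\phi^*$ on forms. A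 homogeneous 2-form $\omega$ is symplectic if $d\omega=0$ and $\Phi:\mathrm{Der}(g)\to DR^1_{\mathrm{Lie}}(g)$, $\Phi(\xi)=i_\xi(\omega)$, is bijective. $\xi$ is symplectic if $L_\xi\omega=0$; $\phi$ is a symplectomorphism if $\phi^*\omega=\omega$. Frobenius algebras and cyclic Harrison cohomology. A strictly graded commutative Frobenius algebra $A=(V,m_2,\omega)$ consists of a free graded module $V$ of finite rank, a symplectic form $\omega\in DR^2_{\mathrm{Lie}}(\widehat L\Sigma V^* )$ of order zero and a symplectic vector field $m_2$ on $\widehat L\Sigma V^*$ of order 2 and degree one with $m_2^2=0$. $CC^\bullet_{\mathrm{Harr}}(A)=\Sigma DR^0_{\mathrm{Lie}}(\widehat L\Sigma V^* )$ with differential $L_{m_2}$; a 0-form has bidegree $(i,j)$ if it has order $i$ and degree $j$ in $\Sigma DR^0_{\mathrm{Lie}}$ (i.e. degree $j+1$ as a 0-form); $HC^{ij}_{\mathrm{Harr}}(A)$ is the bigraded cohomology. $\Upsilon_{\mathrm{Lie}}(\alpha):=(-1)^{|\alpha|}\Phi^{-1}(d\alpha)$ is an isomorphism from $CC^\bullet_{\mathrm{Harr}}(A)$ (suitably shifted by $|\omega|-2$) onto the complex of symplectic vector fields (with differential $[m_2,-]$, inside $\Sigma^{-1}\mathrm{Der}(\widehat L\Sigma V^* )$). Minimal symplectic $C_n$-structures ($n\ge3$). With $V$ free of finite rank and $\omega$ symplectic of order zero, these are symplectic vector fields $m=m_2+\dots+m_{n-1}$ on $\widehat L\Sigma V^*$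 of degree one, $m_i$ of order $i$, with $m^2=0\mod(n+1)$. Two such $m,m'$ are equivalent if $\phi\circ m\circ\phi^{-1}=m'\mod(n)$ for a pointed symplectomorphism $\phi$ of degree zero. $\mathcal{SC}_n(A)$ is the set of minimal symplectic $C_n$-structures (with respect to $\omega$) with quadratic part the given $m_2$, modulo equivalence. $m$ is extendable if there is a symplectic vector field $m_n$ of order $n$ such that $m+m_n$ is a minimal symplectic $C_{n+1}$-structure; $m_n$ is called an extension of $m$. Two extensions $m_n,m_n'$ are equivalent if there is a symplectomorphism of degree zero $\phi=\mathrm{id}+\phi_{n-1}+\phi_n+\cdots$ ($\phi_i$ of order $i$) with $\phi\circ(m+m_n)\circ\phi^{-1}=m+m_n'\mod(n+1)$. $\mathcal{SE}_n(m)$ is the set of extensions modulo equivalence. *)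

(* Defs.v *)
From HB Require Import structures.
From mathcomp Require Import all_boot all_order all_algebra.
From mathcomp Require Import boolp classical_sets functions ring zify.

Set Implicit Arguments.
Unset Strict Implicit.
Unset Printing Implicit Defensive.

Import GRing.Theory.
Local Open Scope ring_scope.

(* The ring is [K : comAlgType rat]; [gr G i] is its component of degree [i].
   Since [K] is concentrated in even degrees, it is commutative in the ordinary
   sense, and scalars never contribute to a Koszul sign. *)
Record even_grading (K : comAlgType rat) := EvenGrading {
  gr : int -> set K;
  gr_zero : forall i, gr i 0;
  gr_sub : forall i k l, gr i k -> gr i l -> gr i (k - l);
  gr_one : gr 0 1;
  gr_mul : forall i j k l, gr i k -> gr j l -> gr (i + j) (k * l);
  gr_even : forall i k, odd `|i|%N -> gr i k -> k = 0;
  gr_sum : forall k : K, exists (s : seq int) (c : int -> K),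
    (forall i, gr i (c i)) /\ k = \sum_(i <- s) c i;
  gr_direct : forall (s : seq int) (c : int -> K), uniq s ->
    (forall i, gr i (c i)) -> \sum_(i <- s) c i = 0 ->
    forall i, i \in s -> c i = 0 }.

(* [(-1)^j] for an integer [j] *)
Definition sg (K : comAlgType rat) (j : int) : K := (-1) ^+ `|j|%N.

(** * The completed tensor algebra and the completed free Lie algebra *)

(* For [W] free on [r] letters, [T^W] is the product over all words [w] of the
   lines [K w]; [x : series K r] is the element [\sum_w (x w) w]. *)
Definition series (K : comAlgType rat) (r : nat) := seq 'I_r -> K.
HB.instance Definition _ (K : comAlgType rat) (r : nat) :=
  GRing.Lmodule.copy (series K r) (seq 'I_r -> K^o).

(* Here [V] is free with a homogeneous basis [e_1, ..., e_r], [e_i] in degree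
   [v i].  The dual basis of [W = Sigma V^*] lies in degrees [1 - v i], because
   [(Sigma V)^i = V^{i+1}]. *)
Definition wdeg (r : nat) (v : 'I_r -> int) (w : seq 'I_r) : int :=
  \sum_(i <- w) (1 - v i).

Definition ser_one (K : comAlgType rat) (r : nat) : series K r :=
  fun w => (w == [::])%:R.
Definition letter (K : comAlgType rat) (r : nat) (i : 'I_r) : series K r :=
  fun w => (w == [:: i])%:R.

Section Series.
Variables (K : comAlgType rat) (r : nat) (v : 'I_r -> int).
Implicit Types (x y z : series K r) (w : seq 'I_r) (k : K).

Definition smul x y : series K r := fun w =>
  \sum_(i < (size w).+1) x (take i w) * y (drop i w).

(* the graded commutator [xy - (-1)^{|x||y|} yx], extended from words *)
Definition sbr x y : series K r := fun w =>
  \sum_(i < (size w).+1)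
    (x (take i w) * y (drop i w)
     - sg K (wdeg v (take i w) * wdeg v (drop i w))
       * (y (take i w) * x (drop i w))).

(* the parity automorphism [x |-> (-1)^{|x|} x] *)
Definition spar x : series K r := fun w => sg K (wdeg v w) * x w.

(* the component of order [n] *)
Definition spart (n : nat) x : series K r := fun w =>
  if size w == n then x w else 0.

Inductive lie_monomial : series K r -> Prop :=
| lie_letter i : lie_monomial (letter K i)
| lie_bracket x y : lie_monomial x -> lie_monomial y -> lie_monomial (sbr x y).

Inductive lie_poly : series K r -> Prop :=
| lie_poly0 : lie_poly 0
| lie_polyD k x y : lie_monomial x -> lie_poly y -> lie_poly (k *: x + y).

(* A convergent linear combination of Lie monomials has finitely many terms in
   each order. *)
Definition lie_series : {pred series K r} :=
  fun x => `[< forall n, lie_poly (spart n x) >].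

Lemma serD x y w : (x + y) w = x w + y w. Proof. by []. Qed.
Lemma serZ k x w : (k *: x) w = k * x w. Proof. by []. Qed.
Lemma ser0 w : (0 : series K r) w = 0. Proof. by []. Qed.

Lemma lie_polyZD k x y : lie_poly x -> lie_poly y -> lie_poly (k *: x + y).
Proof.
elim=> [|l a b la _ IH] ly; first by rewrite scaler0 add0r.
by rewrite scalerDr scalerA -addrA; apply: lie_polyD => //; apply: IH.
Qed.

Lemma lie_poly_sum n (F : 'I_n -> series K r) :
  (forall i, lie_poly (F i)) -> lie_poly (\sum_(i < n) F i).
Proof.
move=> h; elim/big_rec: _ => [|i x _ lx]; first exact: lie_poly0.
by rewrite -[F i]scale1r; apply: lie_polyZD.
Qed.

Lemma spart_linear n k x y : spart n (k *: x + y) = k *: spart n x + spart n y.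
Proof.
apply/funext => w; rewrite serD serZ /spart serD serZ.
by case: ifP => // _; rewrite mulr0 addr0.
Qed.

Lemma lie_series_submod : submod_closed lie_series.
Proof.
split=> [|k x y /asboolP lx /asboolP ly]; apply/asboolP => n.
- have -> : spart n 0 = 0; last exact: lie_poly0.
  by apply/funext => w; rewrite /spart; case: ifP.
- by rewrite spart_linear; apply: lie_polyZD.
Qed.
HB.instance Definition _ :=
  GRing.isSubmodClosed.Build K (series K r) lie_series lie_series_submod.

Lemma sbr_linearl k a b y : sbr (k *: a + b) y = k *: sbr a y + sbr b y.
Proof.
apply/funext => w; rewrite serD serZ /sbr mulr_sumr -big_split.
by apply: eq_bigr => i _; rewrite /= !serD !serZ; ring.
Qed.

Lemma sbr_linearr k a b y : sbr y (k *: a + b) = k *: sbr y a + sbr y b.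
Proof.
apply/funext => w; rewrite serD serZ /sbr mulr_sumr -big_split.
by apply: eq_bigr => i _; rewrite /= !serD !serZ; ring.
Qed.

Lemma sbr0l y : sbr 0 y = 0.
Proof.
by apply/funext => w; apply: big1 => i _; rewrite !ser0 mul0r !mulr0 subr0.
Qed.

Lemma sbr0r y : sbr y 0 = 0.
Proof.
by apply/funext => w; apply: big1 => i _; rewrite !ser0 mul0r !mulr0 subr0.
Qed.

Lemma lie_poly_monomial x : lie_monomial x -> lie_poly x.
Proof.
by move=> lx; rewrite -[x]scale1r -[1 *: x]addr0; apply: lie_polyD lie_poly0.
Qed.

Lemma lie_poly_sbr x y : lie_poly x -> lie_poly y -> lie_poly (sbr x y).
Proof.
elim=> [|k a b la _ IH] ly; first by rewrite sbr0l; exact: lie_poly0.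
rewrite sbr_linearl; apply: lie_polyZD; last exact: IH.
elim: ly => [|l c d lc _ IH']; first by rewrite sbr0r; exact: lie_poly0.
rewrite sbr_linearr; apply: lie_polyZD => //.
by apply: lie_poly_monomial; apply: lie_bracket.
Qed.

Lemma spart_sum n m x y (u t : seq 'I_r) : (size u + size t)%N = m ->
  \sum_(i < n.+1) spart i x u * spart (n - i) y t =
  if m == n then x u * y t else 0.
Proof.
move=> <-{m}; rewrite /spart; case: eqP => [<-|ne].
- have lt : (size u < (size u + size t).+1)%N by rewrite ltnS leq_addr.
  rewrite (bigD1 (Ordinal lt)) //= eqxx addKn eqxx big1 ?addr0 // => i.
  by rewrite -val_eqE /= eq_sym => /negPf ->; rewrite mul0r.
- apply: big1 => i _; case: eqP => [eu|_]; last by rewrite mul0r.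
  case: eqP => [et|_]; last by rewrite mulr0.
  by case: ne; rewrite eu et subnKC // -ltnS.
Qed.

Lemma spart_sbr n x y :
  spart n (sbr x y) = \sum_(i < n.+1) sbr (spart i x) (spart (n - i) y).
Proof.
apply/funext => w; rewrite fct_sumE exchange_big /= /spart.
transitivity (\sum_(i < (size w).+1) if size w == n then
    x (take i w) * y (drop i w)
     - sg K (wdeg v (take i w) * wdeg v (drop i w))
       * (y (take i w) * x (drop i w)) else 0).
  by case: eqP => // _; rewrite big1.
have sw i : (size (take i w) + size (drop i w))%N = size w.
  by rewrite -size_cat cat_take_drop.
apply: eq_bigr => i _; rewrite sumrB -mulr_sumr (spart_sum _ _ _ (sw i)).
have -> : \sum_(j < n.+1) spart (n - j) y (take i w) * spart j x (drop i w) =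
          \sum_(j < n.+1) spart j x (drop i w) * spart (n - j) y (take i w).
  by apply: eq_bigr => j _; exact: mulrC.
rewrite (spart_sum _ _ _ (etrans (addnC _ _) (sw i))) (mulrC (x (drop i w))).
by case: ifP => // _; rewrite mulr0 subr0.
Qed.

Lemma lie_series_sbr x y :
  x \in lie_series -> y \in lie_series -> sbr x y \in lie_series.
Proof.
move=> /asboolP lx /asboolP ly; apply/asboolP => n; rewrite spart_sbr.
by apply: lie_poly_sum => i; apply: lie_poly_sbr.
Qed.

Lemma lie_series_letter i : letter K i \in lie_series.
Proof.
apply/asboolP => n; case: (eqVneq n 1%N) => [->|ne].
- have -> : spart 1 (letter K i) = letter K i; last first.
    exact/lie_poly_monomial/lie_letter.
  by apply/funext => w; rewrite /spart /letter; case: eqP => // ne;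
     case: eqP => // e; case: ne; rewrite e.
- have -> : spart n (letter K i) = 0; last exact: lie_poly0.
  apply/funext => w; rewrite /spart /letter; case: eqP => // e.
  by case: eqP => // ew; case/eqP: ne; rewrite -e ew.
Qed.

Lemma sgD (i j : int) : sg K (i + j) = sg K i * sg K j.
Proof.
rewrite /sg -signr_odd -(signr_odd _ `|i|) -(signr_odd _ `|j|) -signr_addb.
congr (_ ^+ _); congr nat_of_bool.
by case: i => i; case: j => j /=; lia.
Qed.

Lemma wdeg_cat (u w : seq 'I_r) : wdeg v (u ++ w) = wdeg v u + wdeg v w.
Proof. exact: big_cat. Qed.

Lemma spar_sbr x y : spar (sbr x y) = sbr (spar x) (spar y).
Proof.
apply/funext => w; rewrite /spar /sbr mulr_sumr; apply: eq_bigr => i _.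
by rewrite -{1}(cat_take_drop i w) wdeg_cat sgD; ring.
Qed.

Lemma spar_linear k x y : spar (k *: x + y) = k *: spar x + spar y.
Proof. by apply/funext => w; rewrite serD serZ /spar serD serZ; ring. Qed.

Lemma lie_series_spar x : x \in lie_series -> spar x \in lie_series.
Proof.
move=> /asboolP lx; apply/asboolP => n.
have -> : spart n (spar x) = spar (spart n x).
  by apply/funext => w; rewrite /spart /spar; case: ifP; rewrite ?mulr0.
elim: (lx n) => [|k a b la _ IH].
- have -> : spar 0 = 0; last exact: lie_poly0.
  by apply/funext => w; rewrite /spar ser0 mulr0.
- rewrite spar_linear; apply: lie_polyZD => // {IH lx}.
  elim: la => [i|c d _ lc _ ld]; last first.
    by rewrite spar_sbr; apply: lie_poly_sbr.
  have -> : spar (letter K i) = sg K (1 - v i) *: letter K i; last first.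
    rewrite -[_ *: _]addr0; apply: lie_polyD lie_poly0; exact: lie_letter.
  apply/funext => w; rewrite serZ /spar /letter; case: eqP => [->|]; last first.
    by rewrite !mulr0.
  by rewrite /wdeg big_seq1.
Qed.
End Series.

(* [L^ W] for [W = Sigma V^*] *)
Definition free_lie (K : comAlgType rat) (r : nat) (v : 'I_r -> int) :=
  {x : series K r | x \in lie_series v}.
HB.instance Definition _ (K : comAlgType rat) (r : nat) (v : 'I_r -> int) :=
  [isSub of free_lie K v for @sval _ _].
HB.instance Definition _ (K : comAlgType rat) (r : nat) (v : 'I_r -> int) :=
  [Choice of free_lie K v by <:].
HB.instance Definition _ (K : comAlgType rat) (r : nat) (v : 'I_r -> int) :=
  [SubChoice_isSubLmodule of free_lie K v by <:].

Section LieDeRham.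
Variables (K : comAlgType rat) (G : even_grading K).
Variables (r : nat) (v : 'I_r -> int).
Local Notation g := (free_lie K v).
Implicit Types (x : series K r) (y z : g) (w : seq 'I_r) (k : K) (i j : int).

Definition flie_br y z : g :=
  exist _ (sbr v (val y) (val z)) (lie_series_sbr (valP y) (valP z)).
Definition flie_par y : g :=
  exist _ (spar v (val y)) (lie_series_spar (valP y)).
Definition flie_letter (a : 'I_r) : g :=
  exist _ (letter K a) (lie_series_letter K v a).

Definition has_degree j x : Prop := forall w, gr G (j - wdeg v w) (x w).
Definition order_ge (n : nat) x : Prop := forall w, (size w < n)%N -> x w = 0.
Definition order_eq (n : nat) x : Prop := forall w, size w != n -> x w = 0.

(** * Vector fields and diffeomorphisms *)

Definition continuous_endo (f : g -> g) : Prop :=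
  forall n, exists m, forall y, order_ge m (val y) -> order_ge n (val (f y)).

Definition vector_field j (xi : g -> g) : Prop :=
  [/\ linear xi,
      continuous_endo xi,
      forall i y, has_degree i (val y) -> has_degree (i + j) (val (xi y)) &
      forall i y z, has_degree i (val y) ->
        xi (flie_br y z) =
        flie_br (xi y) z + sg K (j * i) *: flie_br y (xi z)].

Definition lie_endo (phi : g -> g) : Prop :=
  [/\ linear phi,
      continuous_endo phi,
      forall i y, has_degree i (val y) -> has_degree i (val (phi y)) &
      forall y z, phi (flie_br y z) = flie_br (phi y) (phi z)].

Definition diffeo (phi psi : g -> g) : Prop :=
  [/\ lie_endo phi, lie_endo psi, cancel phi psi & cancel psi phi].

(* [f] has order [n]: order [a] goes to order [a + n - 1] *)
Definition endo_order (n : nat) (f : g -> g) : Prop :=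
  forall a y, order_eq a (val y) -> order_eq (a + n).-1 (val (f y)).

(* [f] belongs to [(n)] *)
Definition endo_order_ge (n : nat) (f : g -> g) : Prop :=
  forall a y, order_ge a (val y) -> order_ge (a + n).-1 (val (f y)).

(** * The complex [Omega_Lie(g) = g |>< L^(Sigma^{-1} Omega^1_Lie(g))] *)

(* Expressions for the elements of [Omega_Lie(g)], before completion.  As
   [T^W] is the product of the lines [K w], the completed tensor product
   [T^W (x) g] is topologically generated by the [w (x) dy], [w] a word. *)
Inductive omega : Type :=
| OElt of g
| ODiff of seq 'I_r & g
| OBr of omega & omega
| OAdd of omega & omega
| OScale of K & omega
| OZero.

(* Degrees in [Omega_Lie(g)]: [Sigma^{-1}] raises the degree of [x (x) dy] by
   one, so that [d] has degree one. *)
Fixpoint omega_degree (s : omega) (j : int) : Prop :=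
  match s with
  | OElt y => has_degree j (val y)
  | ODiff w y => has_degree (j - 1 - wdeg v w) (val y)
  | OBr a b => exists i, omega_degree a i /\ omega_degree b (j - i)
  | OAdd a b => omega_degree a j /\ omega_degree b j
  | OScale k a => exists i, gr G i k /\ omega_degree a (j - i)
  | OZero => True
  end.

Fixpoint omega_form (s : omega) (p : nat) : Prop :=
  match s with
  | OElt y => p = 0%N
  | ODiff w y => p = 1%N
  | OBr a b => exists m n,
      [/\ p = (m + n)%N, omega_form a m & omega_form b n]
  | OAdd a b => omega_form a p /\ omega_form b p
  | OScale k a => omega_form a p
  | OZero => True
  end.

(* tensor degree in [W] *)
Fixpoint omega_weight (s : omega) (n : nat) : Prop :=
  match s with
  | OElt y => order_eq n (val y)
  | ODiff w y => exists m, n = (size w + m)%N /\ order_eq m (val y)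
  | OBr a b => exists m m',
      [/\ n = (m + m')%N, omega_weight a m & omega_weight b m']
  | OAdd a b => omega_weight a n /\ omega_weight b n
  | OScale k a => omega_weight a n
  | OZero => True
  end.

Fixpoint omega_weight_ge (s : omega) (n : nat) : Prop :=
  match s with
  | OElt y => order_ge n (val y)
  | ODiff w y => order_ge (n - size w) (val y)
  | OBr a b => exists m m',
      [/\ (n <= m + m')%N, omega_weight_ge a m & omega_weight_ge b m']
  | OAdd a b => omega_weight_ge a n /\ omega_weight_ge b n
  | OScale k a => omega_weight_ge a n
  | OZero => True
  end.

(* [x (x) dy] for a series [x], modulo tensor degree [>= N] *)
Definition otens (N : nat) x y : omega :=
  \big[OAdd/OZero]_(n < N) \big[OAdd/OZero]_(w : n.-tuple 'I_r)
    OScale (x w) (ODiff w y).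

(* Equality in [Omega_Lie(g)] modulo tensor degree [>= N].  The completed
   [Omega_Lie(g)] is the inverse limit over [N]. *)
Inductive omega_eq (N : nat) : omega -> omega -> Prop :=
| oe_refl a : omega_eq N a a
| oe_sym a b : omega_eq N a b -> omega_eq N b a
| oe_trans a b c : omega_eq N a b -> omega_eq N b c -> omega_eq N a c
| oe_br a a' b b' : omega_eq N a a' -> omega_eq N b b' ->
    omega_eq N (OBr a b) (OBr a' b')
| oe_add a a' b b' : omega_eq N a a' -> omega_eq N b b' ->
    omega_eq N (OAdd a b) (OAdd a' b')
| oe_scale k a a' : omega_eq N a a' -> omega_eq N (OScale k a) (OScale k a')
| oe_trunc a : omega_weight_ge a N -> omega_eq N a OZero
(* [K]-module *)
| oe_addA a b c : omega_eq N (OAdd a (OAdd b c)) (OAdd (OAdd a b) c)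
| oe_addC a b : omega_eq N (OAdd a b) (OAdd b a)
| oe_add0 a : omega_eq N (OAdd a OZero) a
| oe_scaleA k l a : omega_eq N (OScale k (OScale l a)) (OScale (k * l) a)
| oe_scale1 a : omega_eq N (OScale 1 a) a
| oe_scale0 a : omega_eq N (OScale 0 a) OZero
| oe_scaleDl k l a :
    omega_eq N (OScale (k + l) a) (OAdd (OScale k a) (OScale l a))
| oe_scaleDr k a b :
    omega_eq N (OScale k (OAdd a b)) (OAdd (OScale k a) (OScale k b))
(* graded Lie algebra *)
| oe_brDl a b c : omega_eq N (OBr (OAdd a b) c) (OAdd (OBr a c) (OBr b c))
| oe_brDr a b c : omega_eq N (OBr a (OAdd b c)) (OAdd (OBr a b) (OBr a c))
| oe_brZl k a b : omega_eq N (OBr (OScale k a) b) (OScale k (OBr a b))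
| oe_brZr k a b : omega_eq N (OBr a (OScale k b)) (OScale k (OBr a b))
| oe_anti i j a b : omega_degree a i -> omega_degree b j ->
    omega_eq N (OBr a b) (OScale (- sg K (i * j)) (OBr b a))
| oe_jacobi i j a b c : omega_degree a i -> omega_degree b j ->
    omega_eq N (OBr a (OBr b c))
      (OAdd (OBr (OBr a b) c) (OScale (sg K (i * j)) (OBr b (OBr a c))))
(* [g] is a Lie subalgebra *)
| oe_eltD y z : omega_eq N (OElt (y + z)) (OAdd (OElt y) (OElt z))
| oe_eltZ k y : omega_eq N (OElt (k *: y)) (OScale k (OElt y))
| oe_elt_br y z : omega_eq N (OElt (flie_br y z)) (OBr (OElt y) (OElt z))
(* [Omega^1_Lie(g)] as a quotient of [U(g) (x) g] *)
| oe_diffD w y z :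
    omega_eq N (ODiff w (y + z)) (OAdd (ODiff w y) (ODiff w z))
| oe_diffZ w k y : omega_eq N (ODiff w (k *: y)) (OScale k (ODiff w y))
| oe_diff_br i j x y z : has_degree i (val y) -> has_degree j (val z) ->
    omega_eq N (otens N x (flie_br y z))
      (OAdd (otens N (smul x (val y)) z)
            (OScale (- sg K (i * j)) (otens N (smul x (val z)) y)))
(* [g] acts by left multiplication on [Omega^1_Lie(g)]; the sign is that of
   moving [y] across the desuspension. *)
| oe_act i x y z : has_degree i (val y) ->
    omega_eq N (OBr (OElt y) (otens N x z))
      (OScale (sg K i) (otens N (smul (val y) x) z)).

Fixpoint omega_par (s : omega) : omega :=
  match s with
  | OElt y => OElt (flie_par y)
  | ODiff w y => OScale (- sg K (wdeg v w)) (ODiff w (flie_par y))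
  | OBr a b => OBr (omega_par a) (omega_par b)
  | OAdd a b => OAdd (omega_par a) (omega_par b)
  | OScale k a => OScale k (omega_par a)
  | OZero => OZero
  end.

(* [a |-> (-1)^{e |a|} a] *)
Definition omega_sign (e : int) (s : omega) : omega :=
  if odd `|e|%N then omega_par s else s.

(* The derivation [D] of degree [e] with [D y = f y] and [D (dy) = h y] for [y]
   in [g].  On [w (x) dy] it is computed from
   [(a w) (x) dy = (-1)^{|a|} [a, w (x) dy]] for a letter [a]. *)
Section Derivation.
Variables (e : int) (f h : g -> omega).

Fixpoint oder_diff w y : omega :=
  match w with
  | [::] => h y
  | a :: u => OScale (sg K (wdeg v [:: a]))
      (OAdd (OBr (f (flie_letter a)) (ODiff u y))
            (OScale (sg K (e * wdeg v [:: a]))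
               (OBr (OElt (flie_letter a)) (oder_diff u y))))
  end.

Fixpoint oder (s : omega) : omega :=
  match s with
  | OElt y => f y
  | ODiff w y => oder_diff w y
  | OBr a b => OAdd (OBr (oder a) b) (OBr (omega_sign e a) (oder b))
  | OAdd a b => OAdd (oder a) (oder b)
  | OScale k a => OScale k (oder a)
  | OZero => OZero
  end.
End Derivation.

Definition omega_d : omega -> omega :=
  oder 1 (ODiff [::]) (fun=> OZero).

Definition omega_L j (xi : g -> g) : omega -> omega :=
  oder j (OElt \o xi) (fun y => OScale (sg K j) (ODiff [::] (xi y))).

Definition omega_i j (xi : g -> g) : omega -> omega :=
  oder (j - 1) (fun=> OZero) (OElt \o xi).

Section Pullback.
Variable phi : g -> g.

Fixpoint omega_pull_diff w y : omega :=
  match w with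
  | [::] => ODiff [::] (phi y)
  | a :: u => OScale (sg K (wdeg v [:: a]))
      (OBr (OElt (phi (flie_letter a))) (omega_pull_diff u y))
  end.

Fixpoint omega_pull (s : omega) : omega :=
  match s with
  | OElt y => OElt (phi y)
  | ODiff w y => omega_pull_diff w y
  | OBr a b => OBr (omega_pull a) (omega_pull b)
  | OAdd a b => OAdd (omega_pull a) (omega_pull b)
  | OScale k a => OScale k (omega_pull a)
  | OZero => OZero
  end.
End Pullback.

(** * The Lie de Rham complex [DR_Lie(g)] *)

Inductive dr : Type :=
| DTens of omega & omega
| DAdd of dr & dr
| DScale of K & dr
| DZero.

(* degree in [Omega_Lie(g) (x) Omega_Lie(g)], without the [p]-fold suspension
   of the [p]-forms *)
Fixpoint dr_degree (s : dr) (j : int) : Prop :=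
  match s with
  | DTens a b => exists i, omega_degree a i /\ omega_degree b (j - i)
  | DAdd a b => dr_degree a j /\ dr_degree b j
  | DScale k a => exists i, gr G i k /\ dr_degree a (j - i)
  | DZero => True
  end.

Fixpoint dr_form (s : dr) (p : nat) : Prop :=
  match s with
  | DTens a b => exists m n,
      [/\ p = (m + n)%N, omega_form a m & omega_form b n]
  | DAdd a b => dr_form a p /\ dr_form b p
  | DScale k a => dr_form a p
  | DZero => True
  end.

Fixpoint dr_weight (s : dr) (n : nat) : Prop :=
  match s with
  | DTens a b => exists m m',
      [/\ n = (m + m')%N, omega_weight a m & omega_weight b m']
  | DAdd a b => dr_weight a n /\ dr_weight b n
  | DScale k a => dr_weight a n
  | DZero => True
  end.

Fixpoint dr_weight_ge (s : dr) (n : nat) : Prop :=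
  match s with
  | DTens a b => exists m m',
      [/\ (n <= m + m')%N, omega_weight_ge a m & omega_weight_ge b m']
  | DAdd a b => dr_weight_ge a n /\ dr_weight_ge b n
  | DScale k a => dr_weight_ge a n
  | DZero => True
  end.

(* Equality in [DR_Lie(g)] modulo tensor degree [>= N] *)
Inductive dr_eq (N : nat) : dr -> dr -> Prop :=
| de_refl a : dr_eq N a a
| de_sym a b : dr_eq N a b -> dr_eq N b a
| de_trans a b c : dr_eq N a b -> dr_eq N b c -> dr_eq N a c
| de_tens a a' b b' : omega_eq N a a' -> omega_eq N b b' ->
    dr_eq N (DTens a b) (DTens a' b')
| de_add a a' b b' : dr_eq N a a' -> dr_eq N b b' ->
    dr_eq N (DAdd a b) (DAdd a' b')
| de_scale k a a' : dr_eq N a a' -> dr_eq N (DScale k a) (DScale k a')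
| de_trunc a : dr_weight_ge a N -> dr_eq N a DZero
(* [K]-module *)
| de_addA a b c : dr_eq N (DAdd a (DAdd b c)) (DAdd (DAdd a b) c)
| de_addC a b : dr_eq N (DAdd a b) (DAdd b a)
| de_add0 a : dr_eq N (DAdd a DZero) a
| de_scaleA k l a : dr_eq N (DScale k (DScale l a)) (DScale (k * l) a)
| de_scale1 a : dr_eq N (DScale 1 a) a
| de_scale0 a : dr_eq N (DScale 0 a) DZero
| de_scaleDl k l a :
    dr_eq N (DScale (k + l) a) (DAdd (DScale k a) (DScale l a))
| de_scaleDr k a b :
    dr_eq N (DScale k (DAdd a b)) (DAdd (DScale k a) (DScale k b))
(* tensor product over [K] *)
| de_tensDl a b c :
    dr_eq N (DTens (OAdd a b) c) (DAdd (DTens a c) (DTens b c))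
| de_tensDr a b c :
    dr_eq N (DTens a (OAdd b c)) (DAdd (DTens a b) (DTens a c))
| de_tensZl k a b : dr_eq N (DTens (OScale k a) b) (DScale k (DTens a b))
| de_tensZr k a b : dr_eq N (DTens a (OScale k b)) (DScale k (DTens a b))
(* the relations of [DR_Lie(g)] *)
| de_comm i j a b : omega_degree a i -> omega_degree b j ->
    dr_eq N (DTens a b) (DScale (sg K (i * j)) (DTens b a))
| de_inv a b c : dr_eq N (DTens a (OBr b c)) (DTens (OBr a b) c).

(* the operator of degree [e] on [DR_Lie(g)] induced by [D] via Leibniz *)
Fixpoint dr_leibniz (e : int) (D : omega -> omega) (s : dr) : dr :=
  match s with
  | DTens a b => DAdd (DTens (D a) b) (DTens (omega_sign e a) (D b))
  | DAdd a b => DAdd (dr_leibniz e D a) (dr_leibniz e D b)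
  | DScale k a => DScale k (dr_leibniz e D a)
  | DZero => DZero
  end.

Fixpoint dr_map (F : omega -> omega) (s : dr) : dr :=
  match s with
  | DTens a b => DTens (F a) (F b)
  | DAdd a b => DAdd (dr_map F a) (dr_map F b)
  | DScale k a => DScale k (dr_map F a)
  | DZero => DZero
  end.

(* A form [al] is given by its truncations: [al N] represents it modulo tensor
   degree [>= N].  Equality of forms is [form_eq]. *)
Definition form := nat -> dr.

Definition form_eq (al be : form) : Prop := forall N, dr_eq N (al N) (be N).

(* [p]-forms of degree [j], the degree being shifted by the [p]-fold
   suspension *)
Definition is_form (p : nat) (j : int) (al : form) : Prop :=
  forall N, [/\ dr_form (al N) p, dr_degree (al N) (j + p%:Z) &
                dr_eq N (al N.+1) (al N)].

(* A [p]-form of order [n] has tensor degree [n + p]. *)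
Definition form_order (p n : nat) (al : form) : Prop :=
  forall N, exists s, dr_weight s (n + p) /\ dr_eq N (al N) s.

Definition form_zero : form := fun=> DZero.
Definition form_add (al be : form) : form := fun N => DAdd (al N) (be N).
Definition form_scale k (al : form) : form := fun N => DScale k (al N).

Definition form_d (al : form) : form :=
  fun N => dr_leibniz 1 omega_d (al N).
Definition form_L j xi (al : form) : form :=
  fun N => dr_leibniz j (omega_L j xi) (al N).
Definition form_i j xi (al : form) : form :=
  fun N => dr_leibniz (j - 1) (omega_i j xi) (al N).
Definition form_pull phi (al : form) : form :=
  fun N => dr_map (omega_pull phi) (al N).

(** * Symplectic geometry *)

(* [Phi = (xi |-> i_xi om)] has degree [e]; its bijectivity is asked in each
   degree [j], as usual for graded modules. *)
Definition symplectic_form (e : int) (om : form) : Prop :=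
  [/\ is_form 2 e om,
      form_eq (form_d om) form_zero,
      forall j xi xi', vector_field j xi -> vector_field j xi' ->
        form_eq (form_i j xi om) (form_i j xi' om) -> xi = xi' &
      forall j eta, is_form 1 (j + e) eta ->
        exists2 xi, vector_field j xi & form_eq (form_i j xi om) eta].

Definition symplectic_field (om : form) j (xi : g -> g) : Prop :=
  vector_field j xi /\ form_eq (form_L j xi om) form_zero.

Definition symplectomorphism (om : form) (phi psi : g -> g) : Prop :=
  diffeo phi psi /\ form_eq (form_pull phi om) om.

(* [Phi^{-1}] on 1-forms of degree [j + e], where [e = |om|] *)
Definition Phi_inv (om : form) j (eta : form) : g -> g :=
  xget (fun=> 0) [set xi | vector_field j xi /\ form_eq (form_i j xi om) eta].

(* [Upsilon al = (-1)^{|al|} Phi^{-1}(d al)] for a 0-form [al] of degree [j]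
   and [e = |om|]; note that [d al] has degree [j] as a 1-form. *)
Definition Upsilon (om : form) (e j : int) (al : form) : g -> g :=
  fun y => sg K j *: Phi_inv om (j - e) (form_d al) y.

End LieDeRham.

(** * Frobenius algebras and cyclic Harrison cohomology *)

Record frobenius (K : comAlgType rat) (G : even_grading K) := Frobenius {
  frank : nat;
  fdeg : 'I_frank -> int;       (* degrees of a homogeneous basis of [V] *)
  fom : form K fdeg;
  fom_deg : int;
  fm2 : free_lie K fdeg -> free_lie K fdeg;
  fom_symplectic : symplectic_form G fom_deg fom;
  fom_order : form_order G 2 0 fom;
  fm2_symplectic : symplectic_field G fom 1 fm2;
  fm2_order : endo_order 2 fm2;
  fm2_square : forall y, fm2 (fm2 y) = 0 }.

(* The set of classes of a relation; it is the quotient of [T] by [R] when [R]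
   is an equivalence relation. *)
Definition classes (T : Type) (R : T -> T -> Prop) : Type :=
  {c : set T | exists t, c = R t}.
Definition class_of (T : Type) (R : T -> T -> Prop) (t : T) : classes R :=
  exist _ (R t : set T) (ex_intro _ t erefl).

Section ClassesGroup.
Variables (T : Type) (R : T -> T -> Prop).
Variables (zero : T) (opp : T -> T) (add : T -> T -> T).
Hypothesis Rrefl : forall a, R a a.
Hypothesis Rsym : forall a b, R a b -> R b a.
Hypothesis Rtrans : forall a b c, R a b -> R b c -> R a c.
Hypothesis Radd : forall a a' b b', R a a' -> R b b' -> R (add a b) (add a' b').
Hypothesis Ropp : forall a a', R a a' -> R (opp a) (opp a').
Hypothesis RaddA : forall a b c, R (add a (add b c)) (add (add a b) c).
Hypothesis RaddC : forall a b, R (add a b) (add b a).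
Hypothesis Radd0 : forall a, R (add zero a) a.
Hypothesis RaddN : forall a, R (add (opp a) a) zero.

Definition class_repr (c : classes R) : T := sval (cid (proj2_sig c)).

Lemma class_reprK c : class_of R (class_repr c) = c.
Proof.
rewrite /class_repr; case: cid => t /= e; case: c e => c h /= e.
by apply: eq_exist; rewrite e.
Qed.

Lemma eq_class a b : R a b -> class_of R a = class_of R b.
Proof.
move=> ab; apply: eq_exist; apply/funext => c; apply/propext; split => h.
- exact: Rtrans (Rsym ab) h.
- exact: Rtrans ab h.
Qed.

Lemma class_repr_of a : R a (class_repr (class_of R a)).
Proof.
have := f_equal (@sval _ _) (class_reprK (class_of R a)).
move=> /(congr1 (fun c : set T => c a)) /= e.
by apply: Rsym; rewrite e; apply: Rrefl.
Qed.

Definition class_add c d := class_of R (add (class_repr c) (class_repr d)).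
Definition class_opp c := class_of R (opp (class_repr c)).

Lemma class_addE a b :
  class_add (class_of R a) (class_of R b) = class_of R (add a b).
Proof. by apply: eq_class; apply: Radd; apply: Rsym; apply: class_repr_of. Qed.

Lemma class_oppE a : class_opp (class_of R a) = class_of R (opp a).
Proof. by apply: eq_class; apply: Ropp; apply: Rsym; apply: class_repr_of. Qed.

Lemma class_addA : associative class_add.
Proof.
move=> a b c; rewrite -(class_reprK a) -(class_reprK b) -(class_reprK c).
by rewrite !class_addE; apply: eq_class.
Qed.

Lemma class_addC : commutative class_add.
Proof.
move=> a b; rewrite -(class_reprK a) -(class_reprK b).
by rewrite !class_addE; apply: eq_class.
Qed.

Lemma class_add0 : left_id (class_of R zero) class_add.
Proof.
by move=> a; rewrite -(class_reprK a) class_addE; apply: eq_class.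
Qed.

Lemma class_addN : left_inverse (class_of R zero) class_opp class_add.
Proof.
move=> a; rewrite -(class_reprK a) class_oppE class_addE.
exact: eq_class.
Qed.
End ClassesGroup.

Section Forms.
Variables (K : comAlgType rat) (G : even_grading K).
Variables (r : nat) (v : 'I_r -> int).
Implicit Types (al be : form K v) (k : K).

Lemma gr_opp i k : gr G i k -> gr G i (- k).
Proof. by rewrite -sub0r; apply: gr_sub; apply: gr_zero. Qed.

Lemma form_eq_refl al : form_eq G al al.
Proof. by move=> N; apply: de_refl. Qed.

Lemma form_eq_sym al be : form_eq G al be -> form_eq G be al.
Proof. by move=> h N; apply: de_sym. Qed.

Lemma form_eq_trans al be ga :
  form_eq G al be -> form_eq G be ga -> form_eq G al ga.
Proof. by move=> h1 h2 N; apply: de_trans (h1 N) (h2 N). Qed.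

Lemma form_eq_add al al' be be' : form_eq G al al' -> form_eq G be be' ->
  form_eq G (form_add al be) (form_add al' be').
Proof. by move=> h1 h2 N; apply: de_add. Qed.

Lemma form_eq_scale k al al' : form_eq G al al' ->
  form_eq G (form_scale k al) (form_scale k al').
Proof. by move=> h N; apply: de_scale. Qed.

Lemma form_addA al be ga : form_eq G (form_add al (form_add be ga))
  (form_add (form_add al be) ga).
Proof. by move=> N; apply: de_addA. Qed.

Lemma form_addC al be : form_eq G (form_add al be) (form_add be al).
Proof. by move=> N; apply: de_addC. Qed.

Lemma form_add0 al : form_eq G (form_add (form_zero K v) al) al.
Proof. by move=> N; apply: de_trans (de_addC _ _ _ _) (de_add0 _ _ _). Qed.

Lemma form_addN al : form_eq G (form_add (form_scale (-1) al) al) (form_zero K v).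
Proof.
move=> N; apply: de_trans (de_scale0 G N (al N)); rewrite -(addNr 1).
apply: de_sym; apply: de_trans (de_scaleDl G N _ _ _) _.
by apply: de_add; [apply: de_refl | apply: de_scale1].
Qed.

Lemma form_scaleD k al be : form_eq G (form_scale k (form_add al be))
  (form_add (form_scale k al) (form_scale k be)).
Proof. by move=> N; apply: de_scaleDr. Qed.

Lemma form_scale_zero k : form_eq G (form_scale k (form_zero K v)) (form_zero K v).
Proof. by move=> N; apply: de_trunc. Qed.

Lemma is_form_zero p j : is_form G p j (form_zero K v).
Proof. by move=> N; split=> //; apply: de_refl. Qed.

Lemma is_form_add p j al be :
  is_form G p j al -> is_form G p j be -> is_form G p j (form_add al be).
Proof.
move=> h1 h2 N; case: (h1 N) => a b c; case: (h2 N) => a' b' c'.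
by split=> //; apply: de_add.
Qed.

Lemma is_form_opp p j al : is_form G p j al -> is_form G p j (form_scale (-1) al).
Proof.
move=> h N; case: (h N) => a b c; split=> //; last exact: de_scale.
by exists 0; rewrite subr0; split=> //; apply/gr_opp/gr_one.
Qed.

Lemma form_order_zero p n : form_order G p n (form_zero K v).
Proof. by move=> N; exists (DZero K v); split=> //; apply: de_refl. Qed.

Lemma form_order_add p n al be :
  form_order G p n al -> form_order G p n be -> form_order G p n (form_add al be).
Proof.
move=> h1 h2 N; case: (h1 N) => a [wa ea]; case: (h2 N) => b [wb eb].
by exists (DAdd a b); split=> //; apply: de_add.
Qed.

Lemma form_order_scale p n k al :
  form_order G p n al -> form_order G p n (form_scale k al).
Proof.
move=> h N; case: (h N) => a [wa ea].
by exists (DScale k a); split=> //; apply: de_scale.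
Qed.
End Forms.

Section CyclicHarrison.
Variables (K : comAlgType rat) (G : even_grading K) (A : frobenius G).
Local Notation g := (free_lie K (@fdeg _ _ A)).
Local Notation cochain := (form K (@fdeg _ _ A)).
Implicit Types (al be : cochain) (i : nat) (j : int).

(* bidegree [(i, j)] in [Sigma DR^0_Lie] *)
Definition CC_bidegree i j al : Prop :=
  is_form G 0 (j + 1) al /\ form_order G 0 i al.

Definition CC_d al : cochain := form_L 1 (@fm2 _ _ A) al.

Record cocycle i j := Cocycle {
  cocycle_val :> cochain;
  cocycle_bidegree : CC_bidegree i j cocycle_val;
  cocycle_closed : form_eq G (CC_d cocycle_val) (form_zero _ _) }.

(* For [i = 0] there is no cochain of order [-1]; the convention [0.-1 = 0] is
   harmless because all 0-forms have order at least two. *)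
Definition cohomologous i j (al al' : cocycle i j) : Prop :=
  exists2 be, CC_bidegree i.-1 (j - 1) be &
    form_eq G al (form_add al' (CC_d be)).

Section Group.
Variables (i : nat) (j : int).
Implicit Types (a b c : cocycle i j).

Lemma bidegree_zero i' j' : CC_bidegree i' j' (form_zero _ _).
Proof. by split; [apply: is_form_zero | apply: form_order_zero]. Qed.

Lemma bidegree_add i' j' al be : CC_bidegree i' j' al -> CC_bidegree i' j' be ->
  CC_bidegree i' j' (form_add al be).
Proof.
by move=> [? ?] [? ?]; split; [apply: is_form_add | apply: form_order_add].
Qed.

Lemma bidegree_opp i' j' al : CC_bidegree i' j' al ->
  CC_bidegree i' j' (form_scale (-1) al).
Proof.
by move=> [? ?]; split; [apply: is_form_opp | apply: form_order_scale].
Qed.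

Lemma closed_zero : form_eq G (CC_d (form_zero _ _)) (form_zero _ _).
Proof. exact: form_eq_refl. Qed.

Lemma closed_add al be : form_eq G (CC_d al) (form_zero _ _) ->
  form_eq G (CC_d be) (form_zero _ _) ->
  form_eq G (CC_d (form_add al be)) (form_zero _ _).
Proof.
move=> h1 h2.
exact: form_eq_trans (form_eq_add h1 h2) (form_add0 _ _).
Qed.

Lemma closed_opp al : form_eq G (CC_d al) (form_zero _ _) ->
  form_eq G (CC_d (form_scale (-1) al)) (form_zero _ _).
Proof.
move=> h.
exact: form_eq_trans (form_eq_scale _ h) (form_scale_zero _ _ _).
Qed.

Definition cocycle_zero : cocycle i j :=
  Cocycle (bidegree_zero i j) closed_zero.
Definition cocycle_add a b : cocycle i j :=
  Cocycle (bidegree_add (cocycle_bidegree a) (cocycle_bidegree b))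
    (closed_add (cocycle_closed a) (cocycle_closed b)).
Definition cocycle_opp a : cocycle i j :=
  Cocycle (bidegree_opp (cocycle_bidegree a)) (closed_opp (cocycle_closed a)).

Lemma cohomologous_eq a b : form_eq G a b -> cohomologous a b.
Proof.
move=> h; exists (form_zero _ _); first exact: bidegree_zero.
apply: form_eq_trans h _; apply: form_eq_sym.
exact: form_eq_trans (form_addC _ _ _) (form_add0 _ _).
Qed.

Lemma cohomologous_refl a : cohomologous a a.
Proof. exact/cohomologous_eq/form_eq_refl. Qed.

Lemma form_move al be ga : form_eq G al (form_add be ga) ->
  form_eq G be (form_add al (form_scale (-1) ga)).
Proof.
move=> h; apply: form_eq_sym.
apply: form_eq_trans (form_eq_add h (form_eq_refl _ _)) _.
apply: form_eq_trans (form_eq_sym (form_addA _ _ _ _)) _.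
apply: form_eq_trans (form_addC _ _ _) _.
apply: form_eq_trans (form_add0 G be); apply: form_eq_add (form_eq_refl _ _).
exact: form_eq_trans (form_addC _ _ _) (form_addN _ _).
Qed.

Lemma cohomologous_sym a b : cohomologous a b -> cohomologous b a.
Proof.
move=> [be hb e]; exists (form_scale (-1) be); first exact: bidegree_opp.
exact: form_move.
Qed.

Lemma cohomologous_trans a b c :
  cohomologous a b -> cohomologous b c -> cohomologous a c.
Proof.
move=> [be hb e] [ga hg e']; exists (form_add ga be); first exact: bidegree_add.
apply: form_eq_trans e _.
apply: form_eq_trans (form_eq_add e' (form_eq_refl _ _)) _.
exact: form_eq_sym (form_addA _ _ _ _).
Qed.

Lemma cohomologous_add a a' b b' : cohomologous a a' -> cohomologous b b' ->
  cohomologous (cocycle_add a b) (cocycle_add a' b').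
Proof.
move=> [be hb e] [ga hg e']; exists (form_add be ga); first exact: bidegree_add.
apply: form_eq_trans (form_eq_add e e') _.
apply: form_eq_trans (form_addA _ _ _ _) _.
apply: form_eq_trans (form_eq_sym (form_addA _ _ _ _)) _.
apply: form_eq_trans (form_eq_sym (form_addA _ _ _ _)) _.
apply: form_eq_sym; apply: form_eq_trans (form_eq_sym (form_addA _ _ _ _)) _.
apply: form_eq_add (form_eq_refl _ _) _.
apply: form_eq_trans (form_addA _ _ _ _) _.
apply: form_eq_trans (form_eq_add (form_addC _ _ _) (form_eq_refl _ _)) _.
exact: form_eq_sym (form_addA _ _ _ _).
Qed.

Lemma cohomologous_opp a a' : cohomologous a a' ->
  cohomologous (cocycle_opp a) (cocycle_opp a').
Proof.
move=> [be hb e]; exists (form_scale (-1) be); first exact: bidegree_opp.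
exact: form_eq_trans (form_eq_scale _ e) (form_scaleD _ _ _ _).
Qed.

Lemma cohomologous_addA a b c : cohomologous
  (cocycle_add a (cocycle_add b c)) (cocycle_add (cocycle_add a b) c).
Proof. exact/cohomologous_eq/form_addA. Qed.

Lemma cohomologous_addC a b : cohomologous (cocycle_add a b) (cocycle_add b a).
Proof. exact/cohomologous_eq/form_addC. Qed.

Lemma cohomologous_add0 a : cohomologous (cocycle_add cocycle_zero a) a.
Proof. exact/cohomologous_eq/form_add0. Qed.

Lemma cohomologous_addN a :
  cohomologous (cocycle_add (cocycle_opp a) a) cocycle_zero.
Proof. exact/cohomologous_eq/form_addN. Qed.
End Group.

Definition HC i j : Type := classes (@cohomologous i j).

End CyclicHarrison.

HB.instance Definition _ (K : comAlgType rat) (G : even_grading K)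
    (A : frobenius G) i j := gen_eqMixin (HC A i j).
HB.instance Definition _ (K : comAlgType rat) (G : even_grading K)
    (A : frobenius G) i j := gen_choiceMixin (HC A i j).
HB.instance Definition _ (K : comAlgType rat) (G : even_grading K)
    (A : frobenius G) (i : nat) (j : int) :=
  let refl := @cohomologous_refl _ _ A i j in
  let sym := @cohomologous_sym _ _ A i j in
  let trans := @cohomologous_trans _ _ A i j in
  let addR := @cohomologous_add _ _ A i j in
  GRing.isZmodule.Build (HC A i j)
    (class_addA refl sym trans addR (@cohomologous_addA _ _ A i j))
    (class_addC refl sym trans addR (@cohomologous_addC _ _ A i j))
    (class_add0 refl sym trans addR (@cohomologous_add0 _ _ A i j))
    (class_addN refl sym trans addR (@cohomologous_opp _ _ A i j)
       (@cohomologous_addN _ _ A i j)).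

(** * Minimal symplectic [C_n]-structures and their extensions *)

Section Structures.
Variables (K : comAlgType rat) (G : even_grading K) (A : frobenius G).
Local Notation g := (free_lie K (@fdeg _ _ A)).
Local Notation om := (@fom _ _ A).
Implicit Types (m mn phi psi : g -> g) (n : nat).

(* [m = m_2 + ... + m_{n-1}] with quadratic part [m_2] that of [A] *)
Definition SC_structure n m : Prop :=
  [/\ symplectic_field G om 1 m,
      exists mi : nat -> g -> g,
        [/\ forall i, endo_order i (mi i), mi 2 = @fm2 _ _ A &
            forall y, m y = \sum_(2 <= i < n) mi i y] &
      endo_order_ge n.+1 (m \o m)].

Definition is_extension n m mn : Prop :=
  [/\ symplectic_field G om 1 mn, endo_order n mn &
      SC_structure n.+1 (fun y => m y + mn y)].

Definition extendable n m : Prop := exists mn, is_extension n m mn.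

Definition extension n m : Type := {mn : g -> g | is_extension n m mn}.

Definition ext_equiv n m (mn mn' : extension n m) : Prop :=
  exists phi psi,
    [/\ symplectomorphism G om phi psi,
        endo_order_ge n.-1 (fun y => phi y - y) &
        endo_order_ge n.+1 (fun y =>
          phi (m (psi y) + sval mn (psi y)) - (m y + sval mn' y))].

Definition SE n m : Type := classes (@ext_equiv n m).

(* [Upsilon] on cochains; [j] is the degree in [CC = Sigma DR^0], so that the
   degree as a 0-form is [j + 1]. *)
Definition CC_Upsilon (i : nat) (j : int) (al : cocycle A i j) : g -> g :=
  Upsilon G om (@fom_deg _ _ A) (j + 1) al.

End Structures.

(** * Free and transitive actions of an abelian group *)

Definition is_add_action (H : zmodType) (X : Type) (act : H -> X -> X) : Prop :=
  (forall x, act 0 x = x) /\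
  (forall a b x, act (a + b) x = act a (act b x)).

Definition free_action (H : zmodType) (X : Type) (act : H -> X -> X) : Prop :=
  forall a x, act a x = x -> a = 0.

Definition transitive_action (H : zmodType) (X : Type)
  (act : H -> X -> X) : Prop := forall x y, exists a, act a x = y.

(* Main.v *)
(* On the quotients of the Lie de Rham complex by tensor degree [>= N], the operators
   [d], [L_xi] and [i_xi] are determined by their values on [y] and [dy]; this gives
   the Cartan identities.  The Euler field [E], with [E y = n y] on elements of order
   [n], acts on forms of tensor degree [n] by [n], so [L_E = [d, i_E]] is a Poincare
   lemma.  Hence [Upsilon] maps 0-forms of order [c + 2] onto symplectic fields of
   order [c + 1] and turns [L_m2] into [[m2, -]].  Two extensions of [m] differ by a
   symplectic field [eta] of order [n] with [[m2, eta] = 0].  They are equivalent iff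
   [eta = [xi, m2]] for a symplectic field [xi] of degree 0 and order [n - 1]: given
   an equivalence [phi], take for [xi] the leading term of [phi - id]; given [xi],
   take [phi = exp xi].  *)
Require Import Defs.
From HB Require Import structures.
From mathcomp Require Import all_boot all_order all_algebra.
From mathcomp Require Import boolp classical_sets functions ring zify.

Set Implicit Arguments.
Unset Strict Implicit.
Unset Printing Implicit Defensive.

Import GRing.Theory.
Local Open Scope ring_scope.


(** * Linear identities in modules, and signs *)

(** Forms are syntax trees modulo inductively generated congruences, one for each truncation, and no
    normal form for them is at hand. Two devices replace it. Operators descend to classes by a
    universal property: a morphism out of the truncated [Omega_Lie(g)] is fixed by the images of [y]
    and [dy], and the relations are checked once, in an abstract target. A derivation enters this
    scheme as a morphism into dual numbers. Tensor degrees cannot be read off a class either; they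
    are detected as eigenvalues of the Euler field, which separates tensor degree exactly [n] from
    tensor degree [> n] because nonzero integers are invertible in [K]. The rest is a count of
    orders. With [n = c + 2], the symplectomorphisms in question differ from the identity by terms
    raising order by [c], and quadratic errors raise it by [2 c]. Since [n >= 3] gives [c >= 1],
    these errors fall beyond the leading order, so that only the linear terms [[m2, eta]] and
    [[xi, m2]] survive. *)

Inductive mexp (K : Type) :=
  MAtom of nat | MAdd of mexp K & mexp K | MOpp of mexp K
| MScale of K & mexp K | MZero.
Arguments MAtom {K}.
Arguments MZero {K}.

Section ModuleReflection.
Variables (K : comNzRingType) (M : lmodType K).

Fixpoint meval (l : seq M) (e : mexp K) : M :=
  match e with
  | MAtom i => nth 0 l i
  | MAdd a b => meval l a + meval l b
  | MOpp a => - meval l a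
  | MScale k a => k *: meval l a
  | MZero => 0
  end.

Fixpoint mcoef (i : nat) (e : mexp K) : K :=
  match e with
  | MAtom j => if eqn i j then 1 else 0
  | MAdd a b => mcoef i a + mcoef i b
  | MOpp a => - mcoef i a
  | MScale k a => k * mcoef i a
  | MZero => 0
  end.

Fixpoint same_coefs (n : nat) (e1 e2 : mexp K) : Prop :=
  if n is n'.+1 then mcoef n' e1 = mcoef n' e2 /\ same_coefs n' e1 e2 else True.

Lemma mevalE l e : meval l e = \sum_(i < size l) mcoef i e *: nth 0 l i.
Proof.
elim: e => [j|a IHa b IHb|a IHa|k a IHa|] /=.
- have [lt|ge] := ltnP j (size l).
    rewrite (bigD1 (Ordinal lt)) //=; case: eqnP => // _.
    rewrite scale1r big1 ?addr0 // => i; rewrite -val_eqE /= => ne.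
    by case: eqnP => [e|_]; [rewrite e eqxx in ne | exact: scale0r].
  rewrite nth_default // big1 // => i _.
  case: eqnP => [e|_]; last exact: scale0r.
  by have := ltn_ord i; rewrite e ltnNge ge.
- by rewrite IHa IHb -big_split; apply: eq_bigr => i _; rewrite scalerDl.
- by rewrite IHa -sumrN; apply: eq_bigr => i _; rewrite scaleNr.
- by rewrite IHa scaler_sumr; apply: eq_bigr => i _; rewrite scalerA.
- by rewrite big1 // => i _; rewrite scale0r.
Qed.

(** The identities in [K] that remain are within reach of [ring], which does not apply to elements
    of a module. *)
Lemma meval_eq l e1 e2 : same_coefs (size l) e1 e2 -> meval l e1 = meval l e2.
Proof.
rewrite !mevalE => h; apply: eq_bigr => -[i /= lt] _; congr (_ *: _).
elim: (size l) lt h => // n IH; rewrite ltnS leq_eqVlt => /orP[/eqP ->|lt] /= [h1 h2] //.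
exact: IH.
Qed.
End ModuleReflection.

Ltac m_mem a l :=
  match l with
  | nil => constr:(false)
  | cons a _ => constr:(true)
  | cons _ ?t => m_mem a t
  end.
Ltac m_atoms t l :=
  match t with
  | @GRing.zero _ => l
  | @GRing.add _ ?a ?b => let l1 := m_atoms a l in m_atoms b l1
  | @GRing.opp _ ?a => m_atoms a l
  | @GRing.scale _ _ ?k ?a => m_atoms a l
  | _ => match m_mem t l with
         | true => l
         | false => constr:(cons t l)
         end
  end.
Ltac m_index a l :=
  match l with
  | cons a _ => constr:(O)
  | cons _ ?t => let n := m_index a t in constr:(S n)
  end.
Ltac m_reify K t l :=
  match t with
  | @GRing.zero _ => constr:(@MZero K)
  | @GRing.add _ ?a ?b =>
      let x := m_reify K a l in let y := m_reify K b l in constr:(@MAdd K x y)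
  | @GRing.opp _ ?a => let x := m_reify K a l in constr:(@MOpp K x)
  | @GRing.scale _ _ ?k ?a => let x := m_reify K a l in constr:(@MScale K k x)
  | _ => let n := m_index t l in constr:(@MAtom K n)
  end.

(* Reduces an equality of linear combinations in a [K]-module [M] to the
   equality of the coefficients of each atom. *)
Ltac module_coefs K :=
  match goal with
  | |- @eq ?M ?a ?b =>
    let l0 := m_atoms a (@nil M) in
    let l := m_atoms b l0 in
    let x := m_reify (GRing.ComNzRing.sort K) a l in
    let y := m_reify (GRing.ComNzRing.sort K) b l in
    refine (@meval_eq K _ l x y _);
    cbv [size same_coefs mcoef eqn];
    repeat match goal with
      | |- _ /\ _ => split
      | |- True => exact I
      end
  end.

Section Signs.
Variable K : comAlgType rat.
Definition oddz (i : int) : bool := odd `|i|%N.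
Lemma sgE i : sg K i = if oddz i then -1 else 1.
Proof. by rewrite /sg /oddz -signr_odd; case: odd. Qed.
Lemma oddzD i j : oddz (i + j) = oddz i (+) oddz j.
Proof. by rewrite /oddz; case: i => i; case: j => j /=; lia. Qed.
Lemma oddzN i : oddz (- i) = oddz i.
Proof. by rewrite /oddz abszN. Qed.
Lemma oddzM i j : oddz (i * j) = oddz i && oddz j.
Proof. by rewrite /oddz abszM oddM. Qed.
Lemma oddz1 : oddz 1 = true. Proof. by []. Qed.
Lemma oddz0 : oddz 0 = false. Proof. by []. Qed.
End Signs.

(** A sign depends only on the parity of its exponent, and parity turns sums and products of degrees
    into Boolean expressions. Splitting on the parities of the atomic degrees leaves identities with
    coefficients [1] and [-1]. *)
Ltac sg_cases :=
  rewrite ?sgE ?(oddzD, oddzN, oddzM, oddz1, oddz0);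
  repeat match goal with |- context [oddz ?x] => case: (oddz x) end;
  cbv [andb addb negb].
Ltac sg_ring := sg_cases; ring.

(** * Series and the free Lie algebra *)

Section Grading.
Variables (K : comAlgType rat) (G : even_grading K).

Lemma gr_add i (k l : K) : gr G i k -> gr G i l -> gr G i (k + l).
Proof. by move=> hk hl; rewrite -[l]opprK; apply: gr_sub => //; apply: gr_opp. Qed.

Lemma gr_bigsum i (I : Type) (s : seq I) (P : pred I) (F : I -> K) :
  (forall a, P a -> gr G i (F a)) -> gr G i (\sum_(a <- s | P a) F a).
Proof.
move=> h; elim/big_rec: _ => [|a x Pa hx]; first exact: gr_zero.
by apply: gr_add => //; apply: h.
Qed.

Lemma gr_sg i : gr G 0 (sg K i).
Proof. by rewrite sgE; case: ifP => _; [apply/gr_opp|]; apply: gr_one. Qed.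

Lemma gr_nat n : gr G 0 (n%:R : K).
Proof.
elim: n => [|n IH]; first exact: gr_zero.
by rewrite -addn1 natrD; apply: gr_add => //; apply: gr_one.
Qed.

Lemma nat_inv n : exists c : K, c * n.+1%:R = 1.
Proof.
exists ((n.+1%:R^-1 : rat)%:A).
have -> : n.+1%:R = (n.+1%:R : rat) *: (1 : K) by rewrite scaler_nat.
rewrite mulr_algl scalerA mulVf ?scale1r //.
by rewrite Num.Theory.pnatr_eq0.
Qed.

(* The inverse supplied by the structure of [rat]-algebra is homogeneous:
   compare the components of degree [0] in [c * n.+1%:R = 1]. *)
Lemma gr_nat_inv n : exists2 c : K, gr G 0 c & c * n.+1%:R = 1.
Proof.
have [c ec] := nat_inv n; have [s [b [hb eb]]] := gr_sum G c.
(* The list [s] may repeat a degree and may miss [0]. Prepending [0] puts that degree in the list at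
   the price of one more copy of [b 0], which [e] compensates. Then [a i] is the component of degree
   [i] of [n.+1%:R * c - 1], with multiplicities in place of repetitions. *)
pose s' : seq int := 0 :: s; pose e (i : int) := if i == 0 then n.+1%:R * b 0 + 1 else 0 : K.
pose a (i : int) := n.+1%:R * (b i *+ count_mem i s') - e i.
have hbn i m : gr G i (b i *+ m).
  by elim: m => [|m IH]; [apply: gr_zero | rewrite mulrS; apply: gr_add].
have hk i x : gr G i x -> gr G i (n.+1%:R * x).
  by move=> h; rewrite -[i]add0r; apply: gr_mul h; apply: gr_nat.
have ha i : gr G i (a i).
  apply: gr_sub; first exact: hk.
  rewrite /e; case: eqP => [->|_]; last exact: gr_zero.
  by apply: gr_add; [apply: hk | apply: gr_one].
have s0 : 0 \in undup s' by rewrite mem_undup inE eqxx.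
have sum_a : \sum_(i <- undup s') a i = 0.
  rewrite sumrB -mulr_sumr.
  have -> : \sum_(i <- undup s') b i *+ count_mem i s' = \sum_(i <- s') b i.
    exact: (big_undup_iterop_count _ s' xpredT b).
  rewrite big_cons -eb (bigD1_seq 0) ?undup_uniq //= {1}/e eqxx big1_seq; last first.
    by move=> i /andP[/negPf ni _]; rewrite /e ni.
  by rewrite mulrDr [_ * c]mulrC ec addr0 subrr.
have := gr_direct (undup_uniq s') ha sum_a s0; rewrite /a /e eqxx => a0.
exists (b 0 *+ count_mem 0 s' - b 0); first exact: gr_sub.
by apply/eqP; rewrite -subr_eq0 -a0; apply/eqP; ring.
Qed.

Lemma natr_scale_eq0 n (M : lmodType K) (x : M) : n.+1%:R *: x = 0 -> x = 0.
Proof. by have [c ec] := nat_inv n; move/(congr1 ( *:%R c)); rewrite scalerA ec scale1r scaler0. Qed.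

Lemma gr_parity i (k : K) : gr G i k -> sg K i * k = k.
Proof.
rewrite sgE; case: ifP => [o h|_ _]; last by rewrite mul1r.
by rewrite (gr_even o h) mulr0.
Qed.
End Grading.

Section SeriesAlgebra.
Variables (K : comAlgType rat) (G : even_grading K) (r : nat) (v : 'I_r -> int).
Implicit Types (x y z : series K r) (w : seq 'I_r) (k : K) (i j : int).

Definition word w : series K r := fun u => (u == w)%:R.
Definition shift (a : 'I_r) x : series K r := fun w => x (a :: w).

Lemma smul_nil x y : smul x y [::] = x [::] * y [::].
Proof. by rewrite /smul big_ord1. Qed.

Lemma smul_cons x y a w :
  smul x y (a :: w) = x [::] * y (a :: w) + smul (shift a x) y w.
Proof. by rewrite /smul big_ord_recl. Qed.

Lemma smul_linearl k x y z : smul (k *: x + y) z = k *: smul x z + smul y z.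
Proof.
apply/funext => w; rewrite serD serZ /smul mulr_sumr -big_split.
by apply: eq_bigr => i _; rewrite /= serD serZ; ring.
Qed.

Lemma smul_linearr k x y z : smul z (k *: x + y) = k *: smul z x + smul z y.
Proof.
apply/funext => w; rewrite serD serZ /smul mulr_sumr -big_split.
by apply: eq_bigr => i _; rewrite /= serD serZ; ring.
Qed.

Lemma smulA x y z : smul x (smul y z) = smul (smul x y) z.
Proof.
apply/funext => w; elim: w x y => [|a w IH] x y.
  by rewrite !smul_nil mulrA.
rewrite !smul_cons smul_nil IH.
have -> : shift a (smul x y) = x [::] *: shift a y + smul (shift a x) y.
  by apply/funext => u; rewrite /shift smul_cons serD serZ.
by rewrite smul_linearl serD serZ; ring.
Qed.

Lemma smul_one x : smul (word [::]) x = x.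
Proof.
apply/funext => -[|c w]; first by rewrite smul_nil mul1r.
rewrite smul_cons mul1r /smul big1 ?addr0 // => i _.
by rewrite /shift /word /= mul0r.
Qed.

Lemma smul_oner x : smul x (word [::]) = x.
Proof.
apply/funext => w; rewrite /smul (bigD1 ord_max) //= take_size drop_size mulr1.
rewrite big1 ?addr0 // => i; rewrite -val_eqE /= /word => ne.
case: eqP => [e|_]; last by rewrite mulr0.
have := congr1 size e; rewrite size_drop /=; have := ltn_ord i; lia.
Qed.

Lemma smul_letter_cons a x b w :
  smul (letter K a) x (b :: w) = (b == a)%:R * x w.
Proof.
rewrite smul_cons {1}/letter /= mul0r add0r.
have -> : shift b (letter K a) = (b == a)%:R *: word [::].
  by apply/funext => u; rewrite serZ /shift /letter /word eqseq_cons -mulnb natrM.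
rewrite -[_ *: _]addr0 smul_linearl serD serZ smul_one.
by rewrite [smul 0 x w]big1 ?addr0 // => i _; rewrite ser0 mul0r.
Qed.

Lemma smul_letter_word a w : smul (letter K a) (word w) = word (a :: w).
Proof.
apply/funext => -[|b u]; first by rewrite smul_nil mul0r.
by rewrite smul_letter_cons /word eqseq_cons -mulnb natrM.
Qed.

Lemma order_geD n k x y : order_ge n x -> order_ge n y -> order_ge n (k *: x + y).
Proof. by move=> hx hy w lt; rewrite serD serZ hx // hy // mulr0 addr0. Qed.

Lemma order_geW m n x : (m <= n)%N -> order_ge n x -> order_ge m x.
Proof. by move=> le h w lt; apply: h; apply: leq_trans lt le. Qed.

Lemma order_eq_ge n x : order_eq n x -> order_ge n x.
Proof. by move=> h w lt; apply: h; rewrite ltn_eqF. Qed.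

Lemma order_ge_smul m n x y :
  order_ge m x -> order_ge n y -> order_ge (m + n) (smul x y).
Proof.
move=> hx hy w lt; apply: big1 => i _.
have [l|l] := ltnP (size (take i w)) m; first by rewrite hx // mul0r.
rewrite (hy (drop i w)) ?mulr0 //.
by rewrite -(ltn_add2l m); apply: leq_ltn_trans lt;
  rewrite -[in leqRHS](cat_take_drop i w) size_cat leq_add2r.
Qed.

Lemma order_ge_sbr m n x y :
  order_ge m x -> order_ge n y -> order_ge (m + n) (sbr v x y).
Proof.
move=> hx hy w lt; apply: big1 => i _.
have sw : (size (take i w) + size (drop i w))%N = size w by rewrite -size_cat cat_take_drop.
have -> : x (take i w) * y (drop i w) = 0.
  have [l|l] := ltnP (size (take i w)) m; first by rewrite hx // mul0r.
  by rewrite (hy (drop i w)) ?mulr0 //; lia.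
have -> : y (take i w) * x (drop i w) = 0.
  have [l|l] := ltnP (size (take i w)) n; first by rewrite hy // mul0r.
  by rewrite (hx (drop i w)) ?mulr0 //; lia.
by rewrite mulr0 subr0.
Qed.

Lemma order_eq_sbr m n x y :
  order_eq m x -> order_eq n y -> order_eq (m + n) (sbr v x y).
Proof.
move=> hx hy w ne; apply: big1 => i _.
have sw : (size (take i w) + size (drop i w))%N = size w by rewrite -size_cat cat_take_drop.
have -> : x (take i w) * y (drop i w) = 0.
  have [l|l] := eqVneq (size (take i w)) m; last by rewrite hx // mul0r.
  by rewrite (hy (drop i w)) ?mulr0 //; lia.
have -> : y (take i w) * x (drop i w) = 0.
  have [l|l] := eqVneq (size (take i w)) n; last by rewrite hy // mul0r.
  by rewrite (hx (drop i w)) ?mulr0 //; lia.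
by rewrite mulr0 subr0.
Qed.

Lemma has_degree0 i : has_degree G v i (0 : series K r).
Proof. by move=> w; apply: gr_zero. Qed.

Lemma has_degreeD i x y :
  has_degree G v i x -> has_degree G v i y -> has_degree G v i (x + y).
Proof. by move=> hx hy w; rewrite serD; apply: gr_add. Qed.

Lemma has_degreeZ i j k x :
  gr G i k -> has_degree G v j x -> has_degree G v (i + j) (k *: x).
Proof. by move=> hk hx w; rewrite serZ -addrA; apply: gr_mul. Qed.

Lemma has_degreeZ0 j k x :
  gr G 0 k -> has_degree G v j x -> has_degree G v j (k *: x).
Proof. by move=> hk hx; rewrite -[j]add0r; apply: has_degreeZ. Qed.

Lemma has_degree_sbr i j x y :
  has_degree G v i x -> has_degree G v j y -> has_degree G v (i + j) (sbr v x y).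
Proof.
move=> hx hy w; apply: gr_bigsum => a _.
have wE : wdeg v w = wdeg v (take a w) + wdeg v (drop a w) by rewrite -wdeg_cat cat_take_drop.
apply: gr_sub.
  have -> : i + j - wdeg v w = (i - wdeg v (take a w)) + (j - wdeg v (drop a w)).
    by rewrite wE; ring.
  exact: gr_mul.
have -> : i + j - wdeg v w = 0 + ((j - wdeg v (take a w)) + (i - wdeg v (drop a w))).
  by rewrite wE; ring.
by apply: gr_mul; [apply: gr_sg | apply: gr_mul].
Qed.

Lemma has_degree_letter a : has_degree G v (1 - v a) (letter K a).
Proof.
move=> w; rewrite /letter; case: eqP => [->|_]; last exact: gr_zero.
by rewrite /wdeg big_seq1 subrr; apply: gr_one.
Qed.

(** Scalars of odd degree vanish, so a homogeneous series of degree [i] lives on words whose degree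
    has the parity of [i]. This lets the Koszul signs, defined word by word, be computed from the
    degrees of the series. *)
Lemma homog_cases i x w :
  has_degree G v i x -> x w = 0 \/ oddz (wdeg v w) = oddz i.
Proof.
move=> h; case o: (oddz (i - wdeg v w)); first by left; apply: gr_even o (h w).
by right; move: o; rewrite oddzD oddzN; do 2!case: oddz.
Qed.

Lemma has_degree_sg i x w : has_degree G v i x -> sg K (wdeg v w) * x w = sg K i * x w.
Proof.
by move=> /(homog_cases w)[->|e]; rewrite ?mulr0 // !sgE e.
Qed.

Lemma spar_homog i x : has_degree G v i x -> spar v x = sg K i *: x.
Proof. by move=> h; apply/funext => w; rewrite serZ -(has_degree_sg w h). Qed.

Lemma sbr_homog i j x y : has_degree G v i x -> has_degree G v j y ->
  sbr v x y = smul x y - sg K (i * j) *: smul y x.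
Proof.
move=> hx hy; apply/funext => w; rewrite [LHS]/sbr sumrB; congr (_ - _).
rewrite serZ [smul y x w]/smul mulr_sumr; apply: eq_bigr => a _.
have [->|et] := homog_cases (take a w) hy; first by rewrite !(mul0r, mulr0).
have [->|ed] := homog_cases (drop a w) hx; first by rewrite !(mul0r, mulr0).
by congr (_ * _); rewrite !sgE !oddzM et ed andbC.
Qed.
End SeriesAlgebra.

(** * Homogeneous parts, density of Lie monomials and the order filtration *)

Section FreeLie.
Variables (K : comAlgType rat) (G : even_grading K) (r : nat) (v : 'I_r -> int).
Local Notation g := (free_lie K v).
Implicit Types (y z : g) (k : K) (i j : int) (m n : nat).

Lemma valD y z w : val (y + z) w = val y w + val z w. Proof. by []. Qed.
Lemma valZ k y w : val (k *: y) w = k * val y w. Proof. by []. Qed.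
Lemma valN y w : val (- y) w = - val y w. Proof. by []. Qed.
Lemma valB y z w : val (y - z) w = val y w - val z w. Proof. by []. Qed.
Lemma val0 w : val (0 : g) w = 0. Proof. by []. Qed.
Lemma val_sum (I : Type) (s : seq I) (P : pred I) (F : I -> g) w :
  val (\sum_(i <- s | P i) F i) w = \sum_(i <- s | P i) val (F i) w.
Proof. by elim/big_rec2: _ => // i x y _ <-. Qed.

(** Monomials as elements of [g], indexed by order and degree: the derivation rule is stated for
    homogeneous arguments only, so an induction on monomials has to carry the degree. *)
Inductive lie_mono : nat -> int -> g -> Prop :=
| lm_letter a : lie_mono 1 (1 - v a) (flie_letter K v a)
| lm_br m n i j y z :
    lie_mono m i y -> lie_mono n j z -> lie_mono (m + n)%N (i + j) (flie_br y z).

Lemma lie_mono_gt0 n i y : lie_mono n i y -> (0 < n)%N.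
Proof. by elim=> // *; lia. Qed.

Lemma lie_mono_order n i y : lie_mono n i y -> order_eq n (val y).
Proof.
elim=> [a w ne|m p j l y1 y2 _ h1 _ h2]; last exact: order_eq_sbr.
by rewrite /= /letter; case: eqP => // e; rewrite e in ne.
Qed.

Lemma lie_mono_degree n i y : lie_mono n i y -> has_degree G v i (val y).
Proof.
elim=> [a|m p j l y1 y2 _ h1 _ h2]; first exact: has_degree_letter.
exact: has_degree_sbr.
Qed.

Lemma lie_mono_of (x : series K r) : lie_monomial v x ->
  exists n i y, lie_mono n i y /\ val y = x.
Proof.
elim=> [a|x1 x2 _ [n1 [i1 [y1 [h1 <-]]]] _ [n2 [i2 [y2 [h2 <-]]]]].
  by exists 1%N, (1 - v a), (flie_letter K v a); split=> //; constructor.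
by exists (n1 + n2)%N, (i1 + i2), (flie_br y1 y2); split=> //; constructor.
Qed.

Lemma spart_eq n (x : series K r) : order_eq n x -> spart n x = x.
Proof.
by move=> h; apply/funext => w; rewrite /spart; case: eqP => // ne; rewrite h //; apply/eqP.
Qed.

Lemma spart_ne m n (x : series K r) : order_eq n x -> m != n -> spart m x = 0.
Proof.
move=> h ne; apply/funext => w; rewrite /spart; case: eqP => // e.
by rewrite h // e.
Qed.

Lemma order_eq_spart n (x : series K r) : order_eq n (spart n x).
Proof. by move=> w ne; rewrite /spart (negPf ne). Qed.

Lemma lie_part_subproof n y : spart n (val y) \in lie_series v.
Proof.
apply/asboolP => m; have [->|ne] := eqVneq m n; last first.
  by rewrite (spart_ne (order_eq_spart (n:=n) _) ne); apply: lie_poly0.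
by rewrite spart_eq; [exact: (asboolW (valP y)) | apply: order_eq_spart].
Qed.

Definition lie_part n y : g := exist _ (spart n (val y)) (lie_part_subproof n y).

Lemma lie_part_ind n (P : g -> Prop) : P 0 ->
  (forall k y z, P y -> P z -> P (k *: y + z)) ->
  (forall i y, lie_mono n i y -> P y) -> forall y, order_eq n (val y) -> P y.
Proof.
move=> P0 PD Pm y h; have ly := asboolW (valP y) n.
rewrite (spart_eq h) in ly; have {h} e := esym (spart_eq h).
suff : forall x, lie_poly v x -> forall y : g, val y = spart n x -> P y by apply; eauto.
move=> {ly e y} x; elim=> [y e|k x1 x2 /lie_mono_of[m [i [y1 [l1 e1]]]] _ IH y e].
  by rewrite (_ : y = 0) //; apply: val_inj; rewrite e; apply/funext => w; rewrite /spart; case: ifP.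
rewrite spart_linear -e1 in e.
have [em|ne] := eqVneq n m; last first.
  apply: IH; rewrite e (spart_ne (lie_mono_order l1) ne) scaler0 add0r //.
subst m; rewrite (spart_eq (lie_mono_order l1)) in e.
have -> : y = k *: y1 + (y - k *: y1) by rewrite addrC subrK.
apply: PD; first exact: Pm l1.
apply: IH; apply/funext => w; rewrite valB valZ.
by rewrite (congr1 (@^~ w) e : val y w = k * val y1 w + spart n x2 w) addrAC subrr add0r.
Qed.

Lemma lie_part0 y : lie_part 0 y = 0.
Proof.
apply: (@lie_part_ind 0 (fun y => y = 0)) => //; last exact: order_eq_spart.
  by move=> k y1 y2 -> ->; rewrite scaler0 addr0.
by move=> i y1 /lie_mono_gt0.
Qed.

(** Density principle. An element of order [>= m] is a finite sum of homogeneous parts, each a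
    combination of monomials, plus a tail of order [>= N]; no infinite sum is ever handled.
    Equalities are proved with it by working modulo order [N], where the tail is trivial. *)
Lemma lie_ind m N (P : g -> Prop) :
  (forall y, order_ge N (val y) -> P y) ->
  (forall k y z, P y -> P z -> P (k *: y + z)) ->
  (forall n i y, (m <= n)%N -> lie_mono n i y -> P y) ->
  forall y, order_ge m (val y) -> P y.
Proof.
move=> Ptail PD Pm y hy.
have P0 : P 0 by apply: Ptail.
pose tail := y - \sum_(n < N) lie_part n y.
have -> : y = 1 *: (\sum_(n < N) lie_part n y) + tail by rewrite scale1r /tail addrC subrK.
apply: (PD).
  elim/big_rec: _ => // n x _ Px; rewrite -[lie_part n y]scale1r; apply: (PD) => //.
  have [le|lt] := leqP m n.
    refine (@lie_part_ind n P P0 PD (fun i z => @Pm n i z le) _ _).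
    exact: order_eq_spart.
  rewrite (_ : lie_part n y = 0) //; apply: val_inj; apply/funext => w /=.
  by rewrite /spart; case: eqP => // e; rewrite hy // e.
apply: Ptail => w lt; rewrite /tail valB val_sum.
rewrite (bigD1 (Ordinal lt)) //= /spart eqxx big1 ?addr0 ?subrr // => n.
by rewrite -val_eqE /= eq_sym => /negPf ->.
Qed.

Lemma lie_order1 y : order_ge 1 (val y).
Proof.
apply: (@lie_ind 0 1 (fun y => order_ge 1 (val y))) => //.
  by move=> k z1 z2 h1 h2; rewrite linearP; apply: order_geD.
by move=> n i z _ h; apply: order_geW (order_eq_ge (lie_mono_order h)); apply: lie_mono_gt0 h.
Qed.

Lemma lie_eq y z : (forall N, order_ge N (val (y - z))) -> y = z.
Proof.
move=> h; apply: val_inj; apply/funext => w; apply/eqP; rewrite -subr_eq0.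
by have := h (size w).+1 w (ltnSn _); rewrite raddfB => <-.
Qed.

Lemma val_order_geD n k y z : order_ge n (val y) -> order_ge n (val z) ->
  order_ge n (val (k *: y + z)).
Proof. by move=> hy hz; rewrite linearP; apply: order_geD. Qed.

Lemma flie_br_linearl k (a b y : g) : flie_br (k *: a + b) y = k *: flie_br a y + flie_br b y.
Proof. by apply: val_inj; exact: sbr_linearl. Qed.

Lemma flie_br_linearr k (a b y : g) : flie_br y (k *: a + b) = k *: flie_br y a + flie_br y b.
Proof. by apply: val_inj; exact: sbr_linearr. Qed.

Lemma flie_par_linear k (a b : g) : flie_par (k *: a + b) = k *: flie_par a + flie_par b.
Proof. by apply: val_inj; exact: spar_linear. Qed.

Lemma flie_par_br (a b : g) : flie_par (flie_br a b) = flie_br (flie_par a) (flie_par b).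
Proof. by apply: val_inj; rewrite /= spar_sbr. Qed.

Lemma flie_par_homog i y : has_degree G v i (val y) -> flie_par y = sg K i *: y.
Proof. by move=> h; apply: val_inj; rewrite /= (spar_homog h). Qed.

Lemma flie_letter_degree a : has_degree G v (1 - v a) (val (flie_letter K v a)).
Proof. exact: has_degree_letter. Qed.

Lemma flie_par_degree i y : has_degree G v i (val y) -> has_degree G v i (val (flie_par y)).
Proof. by move=> h; rewrite (flie_par_homog h) linearZ; apply: has_degreeZ0 => //; apply: gr_sg. Qed.

Lemma flie_par_order n y : order_ge n (val y) -> order_ge n (val (flie_par y)).
Proof. by move=> h w lt; rewrite /= /spar h ?mulr0. Qed.

Definition filtered (f : g -> g) : Prop :=
  forall n y, order_ge n (val y) -> order_ge n (val (f y)).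

(** Continuity gives for each [n] some index [N] with no bound on it. That is enough to send a
    remote tail into order [>= n], and the monomials before the tail then decide. *)
Lemma filtered_of (f : g -> g) : linear f -> continuous_endo f ->
  (forall n i y, lie_mono n i y -> order_ge n (val (f y))) -> filtered f.
Proof.
move=> lf cf fm n y hy; have [N hN] := cf n.
apply: (@lie_ind n N (fun y => order_ge n (val (f y)))) hy => //.
  by move=> k y1 y2 h1 h2; rewrite lf; apply: val_order_geD.
by move=> p i z le /fm; apply: order_geW.
Qed.

Lemma vector_field_filtered j (xi : g -> g) : vector_field G j xi -> filtered xi.
Proof.
move=> [lx cx dx bx]; apply: filtered_of => // n i y.
elim=> [a|m p i1 i2 y1 y2 h1 o1 h2 o2]; first exact: lie_order1.
rewrite (bx _ _ _ (lie_mono_degree h1)) addrC; apply: val_order_geD.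
  by apply: order_ge_sbr => //; apply/order_eq_ge/lie_mono_order/h1.
by apply: order_ge_sbr => //; apply/order_eq_ge/lie_mono_order/h2.
Qed.

Lemma lie_endo_filtered (phi : g -> g) : lie_endo G phi -> filtered phi.
Proof.
move=> [lx cx dx bx]; apply: filtered_of => // n i y.
elim=> [a|m p i1 i2 y1 y2 h1 o1 h2 o2]; first exact: lie_order1.
by rewrite bx; apply: order_ge_sbr.
Qed.

Lemma eq_on_lie_mono (f h : g -> g) : linear f -> linear h -> filtered f -> filtered h ->
  (forall n i y, lie_mono n i y -> f y = h y) -> f =1 h.
Proof.
move=> lf lh ff fh e y; apply: lie_eq => N.
apply: (@lie_ind 0 N (fun y => order_ge N (val (f y - h y)))) => //.
- move=> z hz; rewrite -scaleN1r addrC; apply: val_order_geD; [exact: fh|exact: ff].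
- move=> k y1 y2 h1 h2.
  rewrite lf lh (_ : _ - _ = k *: (f y1 - h y1) + (f y2 - h y2)); last first.
    by module_coefs K; ring.
  exact: val_order_geD.
- by move=> n i z _ /e ->; rewrite subrr.
Qed.
End FreeLie.

(** * The universal property of the Lie de Rham algebra *)

Section LinearProp.
Variables (K : pzRingType) (U V : lmodType K) (f : U -> V) (lf : linear f).
Lemma linP0 : f 0 = 0.
Proof. by have := lf (-1) 0 0; rewrite scaler0 addr0 scaleN1r addNr. Qed.
Lemma linPD x y : f (x + y) = f x + f y.
Proof. by have := lf 1 x y; rewrite !scale1r. Qed.
Lemma linPZ k x : f (k *: x) = k *: f x.
Proof. by have := lf k x 0; rewrite linP0 !addr0. Qed.
Lemma linPN x : f (- x) = - f x.
Proof. by rewrite -scaleN1r linPZ scaleN1r. Qed.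
Lemma linPB x y : f (x - y) = f x - f y.
Proof. by rewrite linPD linPN. Qed.
Lemma linPsum (I : Type) (s : seq I) (P : pred I) (F : I -> U) :
  f (\sum_(i <- s | P i) F i) = \sum_(i <- s | P i) f (F i).
Proof. exact: (big_morph f linPD linP0). Qed.
End LinearProp.

Section Words.
Variables (r N : nat) (K : comAlgType rat) (M : lmodType K).

Lemma sum_words (F : seq 'I_r -> M) (w : seq 'I_r) :
  \sum_(n < N) \sum_(u : n.-tuple 'I_r) (val u == w)%:R *: F u =
  if (size w < N)%N then F w else 0.
Proof.
have inner n : n != size w -> \sum_(u : n.-tuple 'I_r) ((val u == w)%:R : K) *: F u = 0.
  move=> ne; apply: big1 => u _; case: eqP => [e|_]; last exact: scale0r.
  by rewrite -e size_tuple eqxx in ne.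
case: ltnP => [lt|le]; last first.
  by apply: big1 => n _; apply: inner; rewrite ltn_eqF // (leq_trans _ le).
rewrite (bigD1 (Ordinal lt)) //= [X in _ + X]big1 ?addr0; last first.
  by move=> n; rewrite -val_eqE /=; exact: inner.
rewrite (bigD1 (in_tuple w)) //= eqxx scale1r big1 ?addr0 // => u.
by rewrite -val_eqE /= => /negPf ->; rewrite scale0r.
Qed.
End Words.

Section SeriesExt.
Variables (K : comAlgType rat) (r N : nat) (M : lmodType K).
(** Modulo order [N] a series is a finite combination of words, because there are finitely many
    letters. *)
Lemma series_ext (T1 T2 : series K r -> M) : linear T1 -> linear T2 ->
  (forall x, order_ge N x -> T1 x = 0) -> (forall x, order_ge N x -> T2 x = 0) ->
  (forall w, T1 (word K w) = T2 (word K w)) -> T1 =1 T2.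
Proof.
move=> l1 l2 z1 z2 e x.
pose p := \sum_(n < N) \sum_(u : n.-tuple 'I_r) x u *: word K u.
have -> : x = p + (x - p) by rewrite addrC subrK.
have hp : order_ge N (x - p).
  move=> w lt; rewrite (_ : (x - p) w = x w - p w) // /p fct_sumE.
  under eq_bigr do rewrite fct_sumE.
  have := @sum_words r N K K^o x w; rewrite lt => <-; apply/eqP; rewrite subr_eq0; apply/eqP.
  by apply: eq_bigr => n _; apply: eq_bigr => u _; rewrite serZ /word eq_sym mulrC.
have ep : T1 p = T2 p.
  rewrite !(linPsum l1, linPsum l2); apply: eq_bigr => n _.
  rewrite !(linPsum l1, linPsum l2); apply: eq_bigr => u _.
  by rewrite !(linPZ l1, linPZ l2) e.
by rewrite (linPD l1) (linPD l2) ep (z1 _ hp) (z2 _ hp).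
Qed.
End SeriesExt.

(** A filtered graded Lie algebra whose [N]-th filtration step is zero, which is what the relations
    generating [omega_eq N] call for. Degrees are predicates: no decomposition into homogeneous
    components is asked of [M]. *)
Record lie_target (K : comAlgType rat) (G : even_grading K) (N : nat) (M : lmodType K)
    (br : M -> M -> M) (deg : int -> M -> Prop) (fil : nat -> M -> Prop) : Prop :=
  LieTarget {
    lt_linl : forall c, linear (br^~ c);
    lt_linr : forall c, linear (br c);
    lt_deg0 : forall i, deg i 0;
    lt_degD : forall i a b, deg i a -> deg i b -> deg i (a + b);
    lt_degZ : forall i j k a, gr G i k -> deg j a -> deg (i + j) (k *: a);
    lt_deg_br : forall i j a b, deg i a -> deg j b -> deg (i + j) (br a b);
    lt_fil0 : forall n, fil n 0;
    lt_filD : forall n k a b, fil n a -> fil n b -> fil n (k *: a + b);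
    lt_filW : forall m n a, (m <= n)%N -> fil n a -> fil m a;
    lt_fil_br : forall m n a b, fil m a -> fil n b -> fil (m + n)%N (br a b);
    lt_filN : forall a, fil N a -> a = 0;
    lt_anti : forall i j a b, deg i a -> deg j b -> br a b = - sg K (i * j) *: br b a;
    lt_jacobi : forall i j a b c, deg i a -> deg j b ->
      br a (br b c) = br (br a b) c + sg K (i * j) *: br b (br a c) }.

Lemma wdeg_cons (r : nat) (v : 'I_r -> int) a (w : seq 'I_r) :
  wdeg v (a :: w) = (1 - v a) + wdeg v w.
Proof. by rewrite /wdeg big_cons. Qed.

Lemma wdeg1 (r : nat) (v : 'I_r -> int) a : wdeg v [:: a] = 1 - v a.
Proof. by rewrite /wdeg big_seq1. Qed.

Lemma wdeg0 (r : nat) (v : 'I_r -> int) : wdeg v [::] = 0.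
Proof. by rewrite /wdeg big_nil. Qed.

Section Universal.
Variables (K : comAlgType rat) (G : even_grading K) (r : nat) (v : 'I_r -> int).
Variables (N : nat) (M : lmodType K) (br : M -> M -> M).
Variables (deg : int -> M -> Prop) (fil : nat -> M -> Prop).
Local Notation g := (free_lie K v).

(** Here [f] gives the image of [y] and [h] that of [dy]. The signs in [id_hbr] come from the
    defining relation of [d[y, z]], once [y] acting on [dz] is written as [(-1)^{|y|} [y, dz]]. *)
Record interp_data (f h : g -> M) : Prop := InterpData {
  id_flin : linear f;
  id_hlin : linear h;
  id_fdeg : forall i y, has_degree G v i (val y) -> deg i (f y);
  id_hdeg : forall i y, has_degree G v i (val y) -> deg (i + 1) (h y);
  id_ffil : forall n y, order_ge n (val y) -> fil n (f y);
  id_hfil : forall n y, order_ge n (val y) -> fil n (h y);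
  id_fbr : forall i j y z, has_degree G v i (val y) -> has_degree G v j (val z) ->
    f (flie_br y z) = br (f y) (f z);
  id_hbr : forall i j y z, has_degree G v i (val y) -> has_degree G v j (val z) ->
    h (flie_br y z) = sg K i *: br (f y) (h z) - sg K (i * j + j) *: br (f z) (h y) }.

Variables (f h : g -> M).

Fixpoint interp_diff (w : seq 'I_r) (y : g) : M :=
  match w with
  | [::] => h y
  | a :: u => sg K (wdeg v [:: a]) *: br (f (flie_letter K v a)) (interp_diff u y)
  end.

Fixpoint interp (s : omega K v) : M :=
  match s with
  | OElt y => f y
  | ODiff w y => interp_diff w y
  | OBr a b => br (interp a) (interp b)
  | OAdd a b => interp a + interp b
  | OScale k a => k *: interp a
  | OZero => 0
  end.

Definition interp_tens (x : series K r) (y : g) : M := interp (otens N x y).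

Lemma interp_big (I : Type) (s : seq I) (F : I -> omega K v) :
  interp (\big[@OAdd _ _ _/@OZero _ _ _]_(i <- s) F i) = \sum_(i <- s) interp (F i).
Proof. by elim/big_rec2: _ => //= i x y _ <-. Qed.

Lemma interp_tensE x y :
  interp_tens x y = \sum_(n < N) \sum_(w : n.-tuple 'I_r) x w *: interp_diff w y.
Proof.
rewrite /interp_tens /otens interp_big; apply: eq_bigr => n _.
by rewrite interp_big.
Qed.

Lemma interp_tens_linl y : linear (interp_tens^~ y).
Proof.
move=> k a b /=; rewrite !interp_tensE scaler_sumr -big_split; apply: eq_bigr => n _.
rewrite /= scaler_sumr -big_split; apply: eq_bigr => w _ /=.
by rewrite serD serZ scalerDl scalerA.
Qed.

Lemma interp_tens_ge x y : order_ge N x -> interp_tens x y = 0.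
Proof.
move=> h0; rewrite interp_tensE big1 // => n _; rewrite big1 // => w _.
by rewrite h0 ?scale0r // size_tuple.
Qed.

Lemma interp_tens_words w y :
  interp_tens (word K w) y = if (size w < N)%N then interp_diff w y else 0.
Proof.
rewrite interp_tensE; exact: (@sum_words r N K M (interp_diff^~ y)).
Qed.

Hypothesis tgt : lie_target G N br deg fil.
Hypothesis dat : interp_data f h.

Let lf := id_flin dat.
Let lh := id_hlin dat.
Let brl := lt_linl tgt.
Let brr := lt_linr tgt.

Lemma fil_scale n k a : fil n a -> fil n (k *: a).
Proof. by move=> h0; rewrite -[_ *: _]addr0; apply: (lt_filD tgt) => //; apply: (lt_fil0 tgt). Qed.

Lemma deg_scale0 i k a : gr G 0 k -> deg i a -> deg i (k *: a).
Proof. by move=> h0 h1; rewrite -[i]add0r; apply: (lt_degZ tgt). Qed.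

Lemma interp_diff_lin w : linear (interp_diff w).
Proof.
elim: w => [|a w IH] k y z /=; first exact: lh.
by rewrite IH (brr _) scalerDr !scalerA mulrC.
Qed.

Lemma interp_diff_deg w y j :
  has_degree G v (j - 1 - wdeg v w) (val y) -> deg j (interp_diff w y).
Proof.
elim: w j => [|a w IH] j /= hy.
  by rewrite -(subrK 1 j); apply: (id_hdeg dat); rewrite /wdeg big_nil subr0 in hy.
apply: deg_scale0; first exact: gr_sg.
have -> : j = (1 - v a) + (j - (1 - v a)) by ring.
apply: (lt_deg_br tgt); first by apply: (id_fdeg dat); apply: has_degree_letter.
apply: IH; move: hy; rewrite wdeg_cons.
by have -> : j - 1 - ((1 - v a) + wdeg v w) = j - (1 - v a) - 1 - wdeg v w by ring.
Qed.

Lemma interp_diff_fil w y n : order_ge n (val y) -> fil (size w + n) (interp_diff w y).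
Proof.
move=> hy; elim: w => [|a w IH] /=; first exact: (id_hfil dat).
apply: fil_scale; rewrite -add1n -addnA. apply: (lt_fil_br tgt) => //.
by apply: (id_ffil dat); apply: lie_order1.
Qed.

Lemma interp_tens_word w y : interp_tens (word K w) y = interp_diff w y.
Proof.
rewrite interp_tens_words; case: ltnP => // le; apply/esym/(lt_filN tgt).
by apply: (lt_filW tgt) le _; rewrite -[size w]addn0; apply: interp_diff_fil.
Qed.


Let br0l a : br 0 a = 0. Proof. exact: linP0 (brl a). Qed.
Let br0r a : br a 0 = 0. Proof. exact: linP0 (brr a). Qed.
Let f0 n y : (N <= n)%N -> order_ge n (val y) -> f y = 0.
Proof. by move=> le h0; apply/(lt_filN tgt)/(lt_filW tgt le)/(id_ffil dat). Qed.

(** [flie_par] absorbs the sign [(-1)^{|y|}], which makes both sides linear in [y] and open to the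
    density principle. For a letter this is the definition of [interp_diff]; for a bracket it
    follows from the Jacobi identity. *)
Lemma interp_tens_act y x z :
  br (f (flie_par y)) (interp_tens x z) = interp_tens (smul (val y) x) z.
Proof.
move: y x z.
pose P (y : g) := forall x z, br (f (flie_par y)) (interp_tens x z) = interp_tens (smul (val y) x) z.
suff : forall y : g, order_ge 0 (val y) -> P y by move=> h0 y x z; apply: h0.
apply: (@lie_ind K r v 0 N P).
- move=> y hy x z; rewrite (@f0 N) //; last exact: flie_par_order.
  rewrite br0l interp_tens_ge // -[N]addn0; exact: order_ge_smul.
- move=> k y1 y2 h1 h2 x z.
  rewrite flie_par_linear lf (brl _) h1 h2 -interp_tens_linl; congr (interp_tens _ z).
  by rewrite -smul_linearl.
- move=> n i y _; elim=> [a|m p i1 i2 y1 y2 m1 h1 m2 h2] x z.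
    apply: (@series_ext K r N M (fun x => br (f (flie_par (flie_letter K v a))) (interp_tens x z))
      (fun x => interp_tens (smul (letter K a) x) z)) => [k a1 a2|k a1 a2|x0 h0|x0 h0|w].
    + by rewrite interp_tens_linl brr.
    + by rewrite smul_linearr interp_tens_linl.
    + by rewrite interp_tens_ge.
    + by rewrite interp_tens_ge // -[N]add0n; apply: order_ge_smul.
    + rewrite smul_letter_word !interp_tens_word /= wdeg1.
      rewrite (@flie_par_homog _ G _ _ (1 - v a)); last exact: has_degree_letter.
      by rewrite (linPZ lf) (linPZ (brl _)).
  have d1 := lie_mono_degree G m1; have d2 := lie_mono_degree G m2.
  have p1 := flie_par_degree d1; have p2 := flie_par_degree d2.
  rewrite flie_par_br (id_fbr dat p1 p2).
  have /= := lt_jacobi tgt (interp_tens x z) (id_fdeg dat p1) (id_fdeg dat p2).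
  rewrite h2 !h1 h2 => /esym/(canRL (addrK _)) ->.
  rewrite (sbr_homog d1 d2).
  have lx : linear (fun a : series K r => smul a x) by move=> k a b; apply: smul_linearl.
  rewrite (linPB lx) (linPZ lx) -!smulA (linPB (interp_tens_linl z)).
  by rewrite (linPZ (interp_tens_linl z)).
Qed.

Lemma interp_tens_act_homog i y x z : has_degree G v i (val y) ->
  br (f y) (interp_tens x z) = sg K i *: interp_tens (smul (val y) x) z.
Proof.
move=> hy; rewrite -interp_tens_act (flie_par_homog hy) (linPZ lf) (linPZ (brl _)).
by rewrite scalerA -sgD (_ : sg K (i + i) = 1) ?scale1r // sgE oddzD addbb.
Qed.

(** Both sides are linear in [x] and vanish in high order, so [x] may be a word. A letter in front
    acts on both sides alike, and the empty word is [id_hbr]. *)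
Lemma interp_tens_br i j x y z : has_degree G v i (val y) -> has_degree G v j (val z) ->
  interp_tens x (flie_br y z) =
  interp_tens (smul x (val y)) z - sg K (i * j) *: interp_tens (smul x (val z)) y.
Proof.
move=> hy hz; move: x.
have lx (a : series K r) : linear (fun x => smul x a) by move=> k b c; apply: smul_linearl.
apply: (@series_ext K r N M).
- exact: interp_tens_linl.
- move=> k a b /=; rewrite !lx !(interp_tens_linl _ _); module_coefs K; ring.
- by move=> x hx; rewrite interp_tens_ge.
- move=> x hx; rewrite !interp_tens_ge ?scaler0 ?subr0 // -[N]addn0;
    exact: order_ge_smul.
elim=> [|a w IH].
  rewrite !smul_one -[val y]smul_oner -[val z]smul_oner -!interp_tens_act.
  rewrite !interp_tens_word /= (id_hbr dat hy hz) (flie_par_homog hy) (flie_par_homog hz).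
  rewrite !(linPZ lf) !(linPZ (brl _)); module_coefs K; sg_ring.
have diff_cons y0 : interp_diff (a :: w) y0 =
    sg K (1 - v a) *: br (f (flie_letter K v a)) (interp_diff w y0) by rewrite -wdeg1.
rewrite interp_tens_word diff_cons -interp_tens_word IH -smul_letter_word -!smulA.
rewrite (linPB (brr _)) (linPZ (brr _)).
have act x0 z0 : br (f (flie_letter K v a)) (interp_tens x0 z0) =
    sg K (1 - v a) *: interp_tens (smul (letter K a) x0) z0.
  by apply: interp_tens_act_homog; apply: has_degree_letter.
rewrite !act.
by module_coefs K; sg_ring.
Qed.

Lemma interp_flie_br y z : f (flie_br y z) = br (f y) (f z).
Proof.
pose P (y z : g) := f (flie_br y z) = br (f y) (f z).
have tail (n : nat) (y1 z1 : g) : (N <= n)%N -> order_ge n (val (flie_br y1 z1)) ->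
  f (flie_br y1 z1) = 0 by exact: f0.
apply: (@lie_ind K r v 0 N (P^~ z)) => // [y1 h1|k y1 y2 h1 h2|n i y1 _ m1].
- rewrite /P (f0 (leqnn N) h1) br0l (@f0 N) // -[N]addn0; exact: order_ge_sbr.
- by rewrite /P flie_br_linearl !lf h1 h2 brl.
apply: (@lie_ind K r v 0 N (P y1)) => // [z1 h1|k z1 z2 h1 h2|p j z1 _ m2].
- rewrite /P (f0 (leqnn N) h1) br0r (@f0 N) // -[N]add0n; exact: order_ge_sbr.
- by rewrite /P flie_br_linearr !lf h1 h2 brr.
exact: (id_fbr dat (lie_mono_degree G m1) (lie_mono_degree G m2)).
Qed.

Lemma interp_degree s i : omega_degree G s i -> deg i (interp s).
Proof.
elim: s i => [y|w y|a IHa b IHb|a IHa b IHb|k a IHa|] i /=.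
- exact: (id_fdeg dat).
- exact: interp_diff_deg.
- case=> j [ha hb]; rewrite -(subrK j i) addrC; apply: (lt_deg_br tgt); eauto.
- by case=> ha hb; apply: (lt_degD tgt); eauto.
- case=> j [ha hb]; rewrite -(subrK j i) addrC; apply: (lt_degZ tgt) => //; eauto.
- by move=> _; apply: (lt_deg0 tgt).
Qed.

Lemma interp_fil s n : omega_weight_ge s n -> fil n (interp s).
Proof.
elim: s n => [y|w y|a IHa b IHb|a IHa b IHb|k a IHa|] n /=.
- exact: (id_ffil dat).
- move/(interp_diff_fil w); apply: (lt_filW tgt); lia.
- case=> m [m' [le ha hb]]; apply: (lt_filW tgt le); apply: (lt_fil_br tgt); eauto.
- case=> ha hb; rewrite -[interp a]scale1r; apply: (lt_filD tgt); eauto.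
- by move=> ha; apply: fil_scale; eauto.
- by move=> _; apply: (lt_fil0 tgt).
Qed.

(** Universal property of the truncated [Omega_Lie(g)]. Parity, derivations and pullbacks are all
    well defined on classes by this one check of the relations. *)
Theorem interp_eq s t : omega_eq G N s t -> interp s = interp t.
Proof.
elim=> {s t} //=.
- by move=> a b c _ -> _ ->.
- by move=> a a' b b' _ -> _ ->.
- by move=> a a' b b' _ -> _ ->.
- by move=> k a a' _ ->.
- by move=> a /interp_fil; apply: (lt_filN tgt).
- by move=> a b c; rewrite addrA.
- by move=> a b; rewrite addrC.
- by move=> a; rewrite addr0.
- by move=> k l a; rewrite scalerA.
- by move=> a; rewrite scale1r.
- by move=> a; rewrite scale0r.
- by move=> k l a; rewrite scalerDl.
- by move=> k a b; rewrite scalerDr.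
- by move=> a b c; rewrite (linPD (brl _)).
- by move=> a b c; rewrite (linPD (brr _)).
- by move=> k a b; rewrite (linPZ (brl _)).
- by move=> k a b; rewrite (linPZ (brr _)).
- by move=> i j a b ha hb; apply: (lt_anti tgt); apply: interp_degree.
- by move=> i j a b c ha hb; apply: (lt_jacobi tgt); apply: interp_degree.
- by move=> y z; rewrite (linPD lf).
- by move=> k y; rewrite (linPZ lf).
- exact: interp_flie_br.
- by move=> w y z; rewrite (linPD (interp_diff_lin w)).
- by move=> w k y; rewrite (linPZ (interp_diff_lin w)).
- move=> i j x y z hy hz; rewrite -[LHS]/(interp_tens x _) (interp_tens_br x hy hz).
  by rewrite scaleNr.
- move=> i x y z hy; exact: (interp_tens_act_homog x z hy).
Qed.
End Universal.

(** * Quotient modules *)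

Definition omegaq (K : comAlgType rat) (G : even_grading K) (r : nat)
  (v : 'I_r -> int) (N : nat) := classes (@omega_eq K G r v N).
Definition drq (K : comAlgType rat) (G : even_grading K) (r : nat)
  (v : 'I_r -> int) (N : nat) := classes (@dr_eq K G r v N).

Section OmegaQuotient.
Variables (K : comAlgType rat) (G : even_grading K) (r : nat) (v : 'I_r -> int) (N : nat).
Local Notation R := (@omega_eq K G r v N).
Local Notation cls := (class_of R).
Local Notation addq := (class_add (R := R) (@OAdd K r v)).

Lemma omega_addN a : R (OAdd (OScale (-1) a) a) (OZero K v).
Proof.
apply: oe_trans (oe_scale0 G N a); rewrite -(addNr 1).
apply: oe_sym; apply: oe_trans (oe_scaleDl G N _ _ _) _.
by apply: oe_add; [apply: oe_refl | apply: oe_scale1].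
Qed.

Lemma omega_add0 a : R (OAdd (OZero K v) a) a.
Proof. exact: oe_trans (oe_addC _ _ _ _) (oe_add0 _ _ _). Qed.

HB.instance Definition _ := gen_eqMixin (omegaq G v N).
HB.instance Definition _ := gen_choiceMixin (omegaq G v N).
HB.instance Definition _ :=
  let refl := @oe_refl K G r v N in
  let sym := @oe_sym K G r v N in
  let trans := @oe_trans K G r v N in
  let addR := @oe_add K G r v N in
  GRing.isZmodule.Build (omegaq G v N)
    (class_addA refl sym trans addR (@oe_addA K G r v N))
    (class_addC refl sym trans addR (@oe_addC K G r v N))
    (class_add0 refl sym trans addR omega_add0)
    (class_addN refl sym trans addR (@oe_scale K G r v N (-1)) omega_addN).

Definition ocls (s : omega K v) : omegaq G v N := cls s.

Lemma ocls_eq s t : R s t -> ocls s = ocls t.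
Proof. exact: (eq_class (@oe_sym K G r v N) (@oe_trans K G r v N)). Qed.

Lemma ocls_repr s : R s (class_repr (ocls s)).
Proof. exact: (class_repr_of (@oe_refl K G r v N) (@oe_sym K G r v N)). Qed.

Lemma oclsP (x : omegaq G v N) : exists s, x = ocls s.
Proof. by exists (class_repr x); rewrite /ocls class_reprK. Qed.

Lemma oclsD s t : ocls (OAdd s t) = ocls s + ocls t.
Proof.
exact: (esym (class_addE (@oe_refl K G r v N) (@oe_sym K G r v N) (@oe_trans K G r v N)
  (@oe_add K G r v N) s t)).
Qed.

Lemma ocls0 : ocls (OZero K v) = 0. Proof. by []. Qed.

Definition oscale (k : K) (x : omegaq G v N) := ocls (OScale k (class_repr x)).

Lemma oscaleE k s : oscale k (ocls s) = ocls (OScale k s).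
Proof. by apply/ocls_eq/oe_scale/oe_sym/ocls_repr. Qed.

Lemma oscaleA k l x : oscale k (oscale l x) = oscale (k * l) x.
Proof. by have [s ->] := oclsP x; rewrite !oscaleE; apply/ocls_eq/oe_scaleA. Qed.
Lemma oscale1 : left_id 1 oscale.
Proof. by move=> x; have [s ->] := oclsP x; rewrite !oscaleE; apply/ocls_eq/oe_scale1. Qed.
Lemma oscaleDr : right_distributive oscale +%R.
Proof.
move=> k x y; have [s ->] := oclsP x; have [t ->] := oclsP y.
by rewrite -oclsD !oscaleE -oclsD; apply/ocls_eq/oe_scaleDr.
Qed.
Lemma oscaleDl x : {morph oscale^~ x : k l / k + l}.
Proof.
move=> k l; have [s ->] := oclsP x.
by rewrite !oscaleE -oclsD; apply/ocls_eq/oe_scaleDl.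
Qed.
HB.instance Definition _ := GRing.Zmodule_isLmodule.Build K (omegaq G v N)
  oscaleA oscale1 oscaleDr oscaleDl.

Lemma oclsZ k s : ocls (OScale k s) = k *: ocls s.
Proof. exact: esym (oscaleE k s). Qed.

Definition obr (x y : omegaq G v N) : omegaq G v N :=
  ocls (OBr (class_repr x) (class_repr y)).

Lemma oclsBr s t : ocls (OBr s t) = obr (ocls s) (ocls t).
Proof. by apply/ocls_eq/oe_br; apply: ocls_repr. Qed.

Definition odeg i (x : omegaq G v N) := exists2 s, omega_degree G s i & ocls s = x.
Definition ofil n (x : omegaq G v N) := exists2 s, omega_weight_ge s n & ocls s = x.

Lemma omega_weight_geW m n (s : omega K v) :
  (m <= n)%N -> omega_weight_ge s n -> omega_weight_ge s m.
Proof.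
elim: s m n => [y|w y|a IHa b IHb|a IHa b IHb|k a IHa|] //= m n le.
- exact: order_geW.
- by apply: order_geW; lia.
- case=> p [q [le' ha hb]]; exists p, q; split=> //; exact: leq_trans le'.
- by case=> ha hb; split; eauto.
Qed.

(** The quotient is itself an admissible target; interpreting expressions in it yields parity and
    pullback as endomorphisms of the quotient. *)
Lemma omega_target : lie_target G N obr odeg ofil.
Proof.
split.
- move=> z k x y; have [a ->] := oclsP x; have [b ->] := oclsP y; have [c ->] := oclsP z.
  rewrite -oclsZ -oclsD -!oclsBr -oclsZ -oclsD; apply: ocls_eq.
  by apply: oe_trans (oe_brDl _ _ _ _ _) _; apply: oe_add (oe_refl _ _ _); apply: oe_brZl.
- move=> z k x y; have [a ->] := oclsP x; have [b ->] := oclsP y; have [c ->] := oclsP z.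
  rewrite -oclsZ -oclsD -!oclsBr -oclsZ -oclsD; apply: ocls_eq.
  by apply: oe_trans (oe_brDr _ _ _ _ _) _; apply: oe_add (oe_refl _ _ _); apply: oe_brZr.
- by move=> i; exists (OZero K v).
- by move=> i _ _ [a ha <-] [b hb <-]; exists (OAdd a b); rewrite ?oclsD.
- move=> i j k _ hk [a ha <-]; exists (OScale k a); rewrite ?oclsZ //=.
  by exists i; split=> //; rewrite addrC addKr.
- move=> i j _ _ [a ha <-] [b hb <-]; exists (OBr a b); rewrite ?oclsBr //=.
  by exists i; split=> //; rewrite addrC addKr.
- by move=> n; exists (OZero K v).
- move=> n k _ _ [a ha <-] [b hb <-].
  by exists (OAdd (OScale k a) b); rewrite ?oclsD ?oclsZ.
- by move=> m n _ le [a ha <-]; exists a => //; apply: omega_weight_geW ha.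
- move=> m n _ _ [a ha <-] [b hb <-]; exists (OBr a b); rewrite ?oclsBr //=.
  by exists m, n; split.
- by move=> _ [a ha <-]; apply/ocls_eq/oe_trunc.
- move=> i j _ _ [a ha <-] [b hb <-]; rewrite -!oclsBr -oclsZ.
  by apply/ocls_eq/oe_anti.
- move=> i j _ _ x [a ha <-] [b hb <-]; have [c ->] := oclsP x.
  rewrite -!oclsBr -oclsZ -oclsD; by apply/ocls_eq/oe_jacobi.
Qed.
End OmegaQuotient.

Section DrQuotient.
Variables (K : comAlgType rat) (G : even_grading K) (r : nat) (v : 'I_r -> int) (N : nat).
Local Notation R := (@dr_eq K G r v N).
Local Notation cls := (class_of R).

Lemma dr_addN a : R (DAdd (DScale (-1) a) a) (DZero K v).
Proof.
apply: de_trans (de_scale0 G N a); rewrite -(addNr 1).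
apply: de_sym; apply: de_trans (de_scaleDl G N _ _ _) _.
by apply: de_add; [apply: de_refl | apply: de_scale1].
Qed.

Lemma dr_add0 a : R (DAdd (DZero K v) a) a.
Proof. exact: de_trans (de_addC _ _ _ _) (de_add0 _ _ _). Qed.

HB.instance Definition _ := gen_eqMixin (drq G v N).
HB.instance Definition _ := gen_choiceMixin (drq G v N).
HB.instance Definition _ :=
  let refl := @de_refl K G r v N in
  let sym := @de_sym K G r v N in
  let trans := @de_trans K G r v N in
  let addR := @de_add K G r v N in
  GRing.isZmodule.Build (drq G v N)
    (class_addA refl sym trans addR (@de_addA K G r v N))
    (class_addC refl sym trans addR (@de_addC K G r v N))
    (class_add0 refl sym trans addR dr_add0)
    (class_addN refl sym trans addR (@de_scale K G r v N (-1)) dr_addN).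

Definition dcls (s : dr K v) : drq G v N := cls s.

Lemma dcls_eq s t : R s t -> dcls s = dcls t.
Proof. exact: (eq_class (@de_sym K G r v N) (@de_trans K G r v N)). Qed.

Lemma dcls_repr s : R s (class_repr (dcls s)).
Proof. exact: (class_repr_of (@de_refl K G r v N) (@de_sym K G r v N)). Qed.

Lemma dcls_inj s t : dcls s = dcls t -> R s t.
Proof. by move=> e; apply: de_trans (dcls_repr s) _; rewrite e; apply/de_sym/dcls_repr. Qed.

Lemma dclsP (x : drq G v N) : exists s, x = dcls s.
Proof. by exists (class_repr x); rewrite /dcls class_reprK. Qed.

Lemma dclsD s t : dcls (DAdd s t) = dcls s + dcls t.
Proof.
exact: (esym (class_addE (@de_refl K G r v N) (@de_sym K G r v N) (@de_trans K G r v N)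
  (@de_add K G r v N) s t)).
Qed.

Lemma dcls0 : dcls (DZero K v) = 0. Proof. by []. Qed.

Definition dscale (k : K) (x : drq G v N) := dcls (DScale k (class_repr x)).

Lemma dscaleE k s : dscale k (dcls s) = dcls (DScale k s).
Proof. by apply/dcls_eq/de_scale/de_sym/dcls_repr. Qed.

Lemma dscaleA k l x : dscale k (dscale l x) = dscale (k * l) x.
Proof. by have [s ->] := dclsP x; rewrite !dscaleE; apply/dcls_eq/de_scaleA. Qed.
Lemma dscale1 : left_id 1 dscale.
Proof. by move=> x; have [s ->] := dclsP x; rewrite !dscaleE; apply/dcls_eq/de_scale1. Qed.
Lemma dscaleDr : right_distributive dscale +%R.
Proof.
move=> k x y; have [s ->] := dclsP x; have [t ->] := dclsP y.
by rewrite -dclsD !dscaleE -dclsD; apply/dcls_eq/de_scaleDr.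
Qed.
Lemma dscaleDl x : {morph dscale^~ x : k l / k + l}.
Proof.
move=> k l; have [s ->] := dclsP x.
by rewrite !dscaleE -dclsD; apply/dcls_eq/de_scaleDl.
Qed.
HB.instance Definition _ := GRing.Zmodule_isLmodule.Build K (drq G v N)
  dscaleA dscale1 dscaleDr dscaleDl.

Lemma dclsZ k s : dcls (DScale k s) = k *: dcls s.
Proof. exact: esym (dscaleE k s). Qed.

Definition dten (x y : omegaq G v N) : drq G v N :=
  dcls (DTens (class_repr x) (class_repr y)).

Lemma dclsTens s t : dcls (DTens s t) = dten (ocls G N s) (ocls G N t).
Proof. by apply/dcls_eq/de_tens; apply: ocls_repr. Qed.

Lemma dten_linl z : linear (dten^~ z).
Proof.
move=> k x y; have [a ->] := oclsP x; have [b ->] := oclsP y; have [c ->] := oclsP z.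
rewrite -oclsZ -oclsD -!dclsTens -dclsZ -dclsD; apply: dcls_eq.
by apply: de_trans (de_tensDl _ _ _ _ _) _; apply: de_add (de_refl _ _ _); apply: de_tensZl.
Qed.

Lemma dten_linr z : linear (dten z).
Proof.
move=> k x y; have [a ->] := oclsP x; have [b ->] := oclsP y; have [c ->] := oclsP z.
rewrite -oclsZ -oclsD -!dclsTens -dclsZ -dclsD; apply: dcls_eq.
by apply: de_trans (de_tensDr _ _ _ _ _) _; apply: de_add (de_refl _ _ _); apply: de_tensZr.
Qed.

Lemma dten_comm i j x y : odeg i x -> odeg j y -> dten x y = sg K (i * j) *: dten y x.
Proof.
move=> [a ha <-] [b hb <-]; rewrite -!dclsTens -dclsZ; by apply/dcls_eq/de_comm.
Qed.

Lemma dten_inv x y z : dten x (obr y z) = dten (obr x y) z.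
Proof.
have [a ->] := oclsP x; have [b ->] := oclsP y; have [c ->] := oclsP z.
by rewrite -!oclsBr -!dclsTens; apply/dcls_eq/de_inv.
Qed.

Definition dfil n (x : drq G v N) := exists2 s, dr_weight_ge s n & dcls s = x.

Lemma dr_weight_geW m n (s : dr K v) :
  (m <= n)%N -> dr_weight_ge s n -> dr_weight_ge s m.
Proof.
elim: s m n => [a b|a IHa b IHb|k a IHa|] //= m n le.
- case=> p [q [le' ha hb]]; exists p, q; split=> //; exact: leq_trans le'.
- by case=> ha hb; split; eauto.
Qed.

Lemma dfil0 n : dfil n 0. Proof. by exists (DZero K v). Qed.
Lemma dfilD n k x y : dfil n x -> dfil n y -> dfil n (k *: x + y).
Proof.
by move=> [a ha <-] [b hb <-]; exists (DAdd (DScale k a) b); rewrite ?dclsD ?dclsZ.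
Qed.
Lemma dfilZ n k x : dfil n x -> dfil n (k *: x).
Proof. by move=> h; rewrite -[_ *: _]addr0; apply: dfilD => //; apply: dfil0. Qed.
Lemma dfilW m n x : (m <= n)%N -> dfil n x -> dfil m x.
Proof. by move=> le [a ha <-]; exists a => //; apply: dr_weight_geW ha. Qed.
Lemma dfilN x : dfil N x -> x = 0.
Proof. by move=> [a ha <-]; apply/dcls_eq/de_trunc. Qed.
Lemma dfil_ten m n x y : ofil m x -> ofil n y -> dfil (m + n) (dten x y).
Proof.
move=> [a ha <-] [b hb <-]; exists (DTens a b); rewrite ?dclsTens //=.
by exists m, n; split.
Qed.
End DrQuotient.

(** * The universal property of the Lie de Rham complex *)

Section DrUniversal.
Variables (K : comAlgType rat) (G : even_grading K) (r : nat) (v : 'I_r -> int) (N : nat).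
Variables (M : lmodType K) (B : omegaq G v N -> omegaq G v N -> M).

(** Such a [B] is a graded symmetric invariant bilinear map that vanishes in tensor degree [>= N];
    it induces a linear map on the truncated [DR_Lie(g)]. *)
Record dr_target : Prop := DrTarget {
  dt_linl : forall c, linear (B^~ c);
  dt_linr : forall c, linear (B c);
  dt_fil : forall m n a b, (N <= m + n)%N -> ofil m a -> ofil n b -> B a b = 0;
  dt_comm : forall i j a b, odeg i a -> odeg j b -> B a b = sg K (i * j) *: B b a;
  dt_inv : forall a b c, B a (obr b c) = B (obr a b) c }.

Fixpoint dr_interp (s : dr K v) : M :=
  match s with
  | DTens a b => B (ocls G N a) (ocls G N b)
  | DAdd a b => dr_interp a + dr_interp b
  | DScale k a => k *: dr_interp a
  | DZero => 0
  end.

Theorem dr_interp_eq s t : dr_target -> dr_eq G N s t -> dr_interp s = dr_interp t.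
Proof.
case=> bl bright bfil bcomm binv; elim=> {s t} //=.
- by move=> a b c _ -> _ ->.
- by move=> a a' b b' /(ocls_eq) -> /(ocls_eq) ->.
- by move=> a a' b b' _ -> _ ->.
- by move=> k a a' _ ->.
- elim=> [a b|a IHa b IHb|k a IHa|] //=.
  + case=> m [n [le ha hb]]; apply: bfil le _ _; [by exists a|by exists b].
  + by case=> /IHa -> /IHb ->; rewrite addr0.
  + by move/IHa => ->; rewrite scaler0.
- by move=> a b c; rewrite addrA.
- by move=> a b; rewrite addrC.
- by move=> a; rewrite addr0.
- by move=> k l a; rewrite scalerA.
- by move=> a; rewrite scale1r.
- by move=> a; rewrite scale0r.
- by move=> k l a; rewrite scalerDl.
- by move=> k a b; rewrite scalerDr.
- by move=> a b c; rewrite oclsD (linPD (bl _)).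
- by move=> a b c; rewrite oclsD (linPD (bright _)).
- by move=> k a b; rewrite oclsZ (linPZ (bl _)).
- by move=> k a b; rewrite oclsZ (linPZ (bright _)).
- by move=> i j a b ha hb; apply: bcomm; [exists a|exists b].
- by move=> a b c; rewrite !oclsBr binv.
Qed.
End DrUniversal.

(** * Generators, homogeneous elements and parity in the truncated algebra *)

Section OmegaGenerators.
Variables (K : comAlgType rat) (G : even_grading K) (r : nat) (v : 'I_r -> int) (N : nat).
Local Notation g := (free_lie K v).
Local Notation O := (omegaq G v N).
Local Notation br := (@obr K G r v N).
Local Notation tgt := (omega_target G v N).

Definition elt (y : g) : O := ocls G N (OElt y).
Definition dif (w : seq 'I_r) (y : g) : O := ocls G N (ODiff w y).

Lemma elt_lin : linear elt.
Proof.
move=> k y z; rewrite /elt -oclsZ -oclsD; apply: ocls_eq.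
by apply: oe_trans (oe_eltD _ _ _ _) _; apply: oe_add (oe_refl _ _ _); apply: oe_eltZ.
Qed.

Lemma dif_lin w : linear (dif w).
Proof.
move=> k y z; rewrite /dif -oclsZ -oclsD; apply: ocls_eq.
by apply: oe_trans (oe_diffD _ _ _ _ _) _; apply: oe_add (oe_refl _ _ _); apply: oe_diffZ.
Qed.

Lemma elt_br y z : elt (flie_br y z) = br (elt y) (elt z).
Proof. by rewrite -oclsBr; apply/ocls_eq/oe_elt_br. Qed.

Lemma elt_deg i y : has_degree G v i (val y) -> odeg i (elt y).
Proof. by exists (OElt y). Qed.

Lemma dif_deg i w y : has_degree G v (i - 1 - wdeg v w) (val y) -> odeg i (dif w y).
Proof. by exists (ODiff w y). Qed.

Lemma dif0_deg i y : has_degree G v i (val y) -> odeg (i + 1) (dif [::] y).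
Proof. by move=> h; apply: dif_deg; rewrite wdeg0 addrK subr0. Qed.

Lemma elt_fil n y : order_ge n (val y) -> ofil n (elt y).
Proof. by exists (OElt y). Qed.

Lemma dif_fil n w y : order_ge n (val y) -> ofil (size w + n) (dif w y).
Proof. by move=> h; exists (ODiff w y); rewrite //= addKn. Qed.

Lemma ocls_big (I : Type) (s : seq I) (F : I -> omega K v) :
  ocls G N (\big[@OAdd _ _ _/@OZero _ _ _]_(i <- s) F i) = \sum_(i <- s) ocls G N (F i).
Proof. by elim/big_rec2: _ => //= i x y _ <-; rewrite oclsD. Qed.

Lemma ocls_otens x y :
  ocls G N (otens N x y) = \sum_(n < N) \sum_(w : n.-tuple 'I_r) x w *: dif w y.
Proof.
rewrite /otens ocls_big; apply: eq_bigr => n _.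
by rewrite ocls_big; apply: eq_bigr => w _; rewrite oclsZ.
Qed.

Lemma ocls_otens_word w y : ocls G N (otens N (word K w) y) = dif w y.
Proof.
rewrite ocls_otens; have := @sum_words r N K O (dif^~ y) w; rewrite /word => ->.
case: ltnP => // le; apply/esym/(lt_filN tgt)/(lt_filW tgt le).
by rewrite -[size w]addn0; apply: dif_fil.
Qed.

Lemma elt_dif a w y : br (elt (flie_letter K v a)) (dif w y) = sg K (1 - v a) *: dif (a :: w) y.
Proof.
rewrite -!ocls_otens_word -smul_letter_word -oclsBr -oclsZ; apply: ocls_eq.
exact: (@oe_act _ _ _ _ _ _ _ (flie_letter K v a) _ (flie_letter_degree G v a)).
Qed.

Lemma dif_cons a w y : dif (a :: w) y = sg K (1 - v a) *: br (elt (flie_letter K v a)) (dif w y).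
Proof.
by rewrite elt_dif scalerA -sgD sgE oddzD addbb scale1r.
Qed.

Lemma dif_br i j y z : has_degree G v i (val y) -> has_degree G v j (val z) ->
  dif [::] (flie_br y z) =
  sg K i *: br (elt y) (dif [::] z) - sg K (i * j + j) *: br (elt z) (dif [::] y).
Proof.
move=> hy hz; rewrite -!ocls_otens_word.
rewrite (ocls_eq (oe_diff_br N (word K [::]) hy hz)) oclsD oclsZ !smul_one.
rewrite -!oclsBr (ocls_eq (oe_act N (word K [::]) _ hy)).
rewrite (ocls_eq (oe_act N (word K [::]) _ hz)) !oclsZ !smul_oner.
by module_coefs K; sg_ring.
Qed.

Inductive hom_span : O -> Prop :=
| hs_hom i x : odeg i x -> hom_span x
| hs_lin k x y : hom_span x -> hom_span y -> hom_span (k *: x + y).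

(** Tensor degree [>= N] vanishes in the quotient, so density leaves finitely many homogeneous
    terms. Identities stated for homogeneous elements thus extend linearly to all classes. *)
Lemma hom_span_all x : hom_span x.
Proof.
have s0 : hom_span 0 by apply: (@hs_hom 0); apply: (lt_deg0 tgt).
have zero n (y : O) : (N <= n)%N -> ofil n y -> y = 0.
  by move=> le h; apply/(lt_filN tgt)/(lt_filW tgt le).
have [s ->] := oclsP x; elim: s => [y|w y|a IHa b IHb|a IHa b IHb|k a IHa|] //=.
- apply: (@lie_ind K r v 0 N (fun y => hom_span (elt y))) => // [z h|k y1 y2 h1 h2|n i z _ m].
  + by rewrite (zero N (elt z)) //; apply: elt_fil.
  + by rewrite elt_lin; apply: hs_lin.
  + by apply: (@hs_hom i); apply: elt_deg; apply: lie_mono_degree m.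
- apply: (@lie_ind K r v 0 N (fun y => hom_span (dif w y))) => // [z h|k y1 y2 h1 h2|n i z _ m].
  + by rewrite (zero (size w + N)%N (dif w z)) ?leq_addl //; apply: dif_fil.
  + by rewrite dif_lin; apply: hs_lin.
  + apply: (@hs_hom (i + 1 + wdeg v w)); apply: dif_deg.
    have -> : i + 1 + wdeg v w - 1 - wdeg v w = i by ring.
    exact: lie_mono_degree m.
- rewrite oclsBr; elim: IHa => [i y hy|k y z _ h1 _ h2]; last first.
    by rewrite (lt_linl tgt (ocls G N b)); apply: hs_lin.
  elim: IHb => [j z hz|k y1 z _ h1 _ h2]; last by rewrite (lt_linr tgt y); apply: hs_lin.
  by apply: (@hs_hom (i + j)); apply: (lt_deg_br tgt).
- by rewrite oclsD -[ocls _ _ a]scale1r; apply: hs_lin.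
- by rewrite oclsZ -[_ *: _]addr0; apply: hs_lin.
Qed.

Lemma omega_hom_ind (P : O -> Prop) :
  (forall i x, odeg i x -> P x) ->
  (forall k x y, P x -> P y -> P (k *: x + y)) -> forall x, P x.
Proof. by move=> Ph Pl x; elim: (hom_span_all x) => [i y /Ph|k y z _ h1 _ h2] //; apply: Pl. Qed.

(** The minus sign on [dy] is there because [d] has degree one. *)
Lemma parity_data : interp_data G br (@odeg K G r v N) (@ofil K G r v N)
  (fun y => elt (flie_par y)) (fun y => - dif [::] (flie_par y)).
Proof.
split.
- by move=> k y z; rewrite flie_par_linear elt_lin.
- by move=> k y z; rewrite flie_par_linear dif_lin; module_coefs K; ring.
- by move=> i y h; apply/elt_deg/flie_par_degree.
- move=> i y h; rewrite -scaleN1r; have /= := lt_degZ tgt; move/(_ 0 (i + 1) (-1)).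
  rewrite add0r; apply; first by apply/gr_opp/gr_one.
  by apply/dif0_deg/flie_par_degree.
- by move=> n y h; apply/elt_fil/flie_par_order.
- move=> n y h; rewrite -scaleN1r -[_ *: _]addr0; apply: (lt_filD tgt); last exact: (lt_fil0 tgt).
  by rewrite -[n]add0n; apply/(@dif_fil n [::])/flie_par_order.
- by move=> i j y z _ _; rewrite flie_par_br elt_br.
- move=> i j y z hy hz; rewrite flie_par_br.
  rewrite (dif_br (flie_par_degree hy) (flie_par_degree hz)).
  by rewrite !(linPN (lt_linr tgt _)); module_coefs K; ring.
Qed.

Definition opar (x : O) : O := ocls G N (omega_par (class_repr x)).

Lemma interp_par s : interp br (fun y => elt (flie_par y)) (fun y => - dif [::] (flie_par y)) s =
  ocls G N (omega_par s).
Proof.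
elim: s => [y|w y|a IHa b IHb|a IHa b IHb|k a IHa|] //=.
- elim: w => [|a w IH] /=; first by rewrite oclsZ wdeg0 sgE scaleN1r.
  rewrite IH !oclsZ -/(dif _ _) -/(dif _ _) dif_cons wdeg1 wdeg_cons.
  rewrite (flie_par_homog (flie_letter_degree G v a)) (linPZ elt_lin).
  rewrite (linPZ (lt_linl tgt _)) (linPZ (lt_linr tgt _)).
  by module_coefs K; sg_ring.
- by rewrite IHa IHb -oclsBr.
- by rewrite IHa IHb -oclsD.
- by rewrite IHa -oclsZ.
Qed.

Lemma oparE s : opar (ocls G N s) = ocls G N (omega_par s).
Proof.
rewrite /opar -!interp_par; apply: (interp_eq tgt parity_data).
exact/oe_sym/ocls_repr.
Qed.

Lemma opar_lin : linear opar.
Proof.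
move=> k x y; have [a ->] := oclsP x; have [b ->] := oclsP y.
by rewrite -oclsZ -oclsD !oparE /= oclsD oclsZ.
Qed.

Lemma opar_br x y : opar (br x y) = br (opar x) (opar y).
Proof.
have [a ->] := oclsP x; have [b ->] := oclsP y.
by rewrite -oclsBr !oparE /= oclsBr.
Qed.

Lemma opar_fil n x : ofil n x -> ofil n (opar x).
Proof. by case=> s hs <-; rewrite oparE -interp_par; apply: (interp_fil tgt parity_data). Qed.

Lemma opar_homog i x : odeg i x -> opar x = sg K i *: x.
Proof.
case=> s hs <-; rewrite oparE; elim: s i hs => [y|w y|a IHa b IHb|a IHa b IHb|k a IHa|] i /=.
- by move=> h; rewrite -/(elt _) (flie_par_homog h) (linPZ elt_lin).
- move=> h; rewrite oclsZ -!/(dif _ _) (flie_par_homog h) (linPZ (dif_lin w)).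
  by module_coefs K; sg_ring.
- case=> j [ha hb]; rewrite !oclsBr (IHa _ ha) (IHb _ hb).
  rewrite (linPZ (lt_linl tgt _)) (linPZ (lt_linr tgt _)).
  by module_coefs K; sg_ring.
- by case=> ha hb; rewrite !oclsD (IHa _ ha) (IHb _ hb) scalerDr.
- case=> j [hk ha]; rewrite !oclsZ (IHa _ ha).
  (* A nonzero homogeneous scalar has even degree, so removing its degree [j] does not change the
     sign. *)
  rewrite -[in LHS](gr_parity hk); module_coefs K.
  by sg_ring.
- by rewrite ocls0 scaler0.
Qed.

(** The automorphism [x |-> (-1)^{e |x|} x]. With it the graded Leibniz rule is linear in both
    arguments and needs no homogeneity. *)
Definition opow (e : int) (x : O) : O := if oddz e then opar x else x.

Lemma opow_homog e i x : odeg i x -> opow e x = sg K (e * i) *: x.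
Proof.
rewrite /opow => h; case oe: (oddz e); last by rewrite sgE oddzM oe scale1r.
by rewrite (opar_homog h) !sgE oddzM oe.
Qed.

Lemma opow_lin e : linear (opow e).
Proof. by move=> k x y; rewrite /opow; case: ifP => _ //; apply: opar_lin. Qed.

Lemma opow_br e x y : opow e (br x y) = br (opow e x) (opow e y).
Proof. by rewrite /opow; case: ifP => _ //; apply: opar_br. Qed.

Lemma opow_fil e n x : ofil n x -> ofil n (opow e x).
Proof. by rewrite /opow; case: ifP => _ //; apply: opar_fil. Qed.

Lemma ocls_sign e s : ocls G N (omega_sign e s) = opow e (ocls G N s).
Proof. by rewrite /opow /omega_sign -/(oddz e); case: ifP => _ //; rewrite oparE. Qed.
End OmegaGenerators.

(** * Derivations *)

(** [f] and [h] are the prescribed values on [y] and [dy]. Condition [dd_hbr] is the Leibniz rule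
    applied to the relation for [d[y, z]] in the form of [dif_br]. *)
Record der_data (K : comAlgType rat) (G : even_grading K) (r : nat) (v : 'I_r -> int) (N : nat)
    (e : int) (f h : free_lie K v -> omegaq G v N) : Prop := DerData {
  dd_flin : linear f;
  dd_hlin : linear h;
  dd_fdeg : forall i y, has_degree G v i (val y) -> odeg (i + e) (f y);
  dd_hdeg : forall i y, has_degree G v i (val y) -> odeg (i + 1 + e) (h y);
  dd_ffil : forall n y, order_ge n (val y) -> ofil n (f y);
  dd_hfil : forall n y, order_ge n (val y) -> ofil n (h y);
  dd_fbr : forall i j y z, has_degree G v i (val y) -> has_degree G v j (val z) ->
    f (flie_br y z) = obr (f y) (elt G N z) + sg K (e * i) *: obr (elt G N y) (f z);
  dd_hbr : forall i j y z, has_degree G v i (val y) -> has_degree G v j (val z) ->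
    h (flie_br y z) =
    sg K i *: (obr (f y) (dif G N [::] z) + sg K (e * i) *: obr (elt G N y) (h z))
    - sg K (i * j + j) *: (obr (f z) (dif G N [::] y) + sg K (e * j) *: obr (elt G N z) (h y)) }.

(** The operator [D'] on [DR_Lie(g)] is carried along with [D], so that an identity between
    derivations, checked on generators, is available on forms at once. *)
Record is_der (K : comAlgType rat) (G : even_grading K) (r : nat) (v : 'I_r -> int) (N : nat)
    (e : int) (D : omegaq G v N -> omegaq G v N) (D' : drq G v N -> drq G v N) : Prop := IsDer {
  der_lin : linear D;
  der_lin' : linear D';
  der_deg : forall i x, odeg i x -> odeg (i + e) (D x);
  der_br : forall i x y, odeg i x ->
    D (obr x y) = obr (D x) y + sg K (e * i) *: obr x (D y);
  der_ten : forall i x y, odeg i x ->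
    D' (dten x y) = dten (D x) y + sg K (e * i) *: dten x (D y) }.

Section DerOps.
Variables (K : comAlgType rat) (G : even_grading K) (r : nat) (v : 'I_r -> int) (N : nat).
Local Notation g := (free_lie K v).
Local Notation O := (omegaq G v N).
Local Notation br := (@obr K G r v N).
Local Notation tgt := (omega_target G v N).
Local Notation elt := (elt G N).
Local Notation dif := (dif G N).
Variables (e : int) (f0 h0 : g -> omega K v).
Local Notation f := (fun y => ocls G N (f0 y)).
Local Notation h := (fun y => ocls G N (h0 y)).
Hypothesis dd : der_data e f h.

Let brl := lt_linl tgt.
Let brr := lt_linr tgt.

(* The bracket of [Omega (+) epsilon Omega], [epsilon] of degree [- e]: a derivation
   [D] of degree [e] is a morphism [x + epsilon D x] into this algebra. *)
Definition dual_br (x y : O * O) : O * O :=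
  (br x.1 y.1, br x.2 y.1 + br (opow e x.1) y.2).
Definition dual_deg i (x : O * O) := odeg i x.1 /\ odeg (i + e) x.2.
Definition dual_fil n (x : O * O) := ofil n x.1 /\ ofil n x.2.

Lemma pairE (a b c d : O) : a = c -> b = d -> (a, b) = (c, d).
Proof. by move=> -> ->. Qed.

Lemma odeg_lin i (x y : O) k : gr G 0 k -> odeg i x -> odeg i y -> odeg i (k *: x + y).
Proof.
move=> hk hx hy; apply: (lt_degD tgt) => //.
by rewrite -[i]add0r; apply: (lt_degZ tgt).
Qed.

Lemma dual_target : lie_target G N dual_br dual_deg dual_fil.
Proof.
split.
- move=> [c c'] k [a a'] [b b']; apply: pairE => /=; first exact: brl.
  by rewrite (opow_lin _ _ _) !(brl _ _ _); module_coefs K; ring.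
- move=> [c c'] k [a a'] [b b']; apply: pairE => /=; first exact: brr.
  by rewrite !(brr _ _ _); module_coefs K; ring.
- by move=> i; split; apply: (lt_deg0 tgt).
- by move=> i [a a'] [b b'] [h1 h2] [h3 h4]; split; apply: (lt_degD tgt).
- move=> i j k [a a'] hk [h1 h2]; split; first exact: (lt_degZ tgt).
  by rewrite -addrA; apply: (lt_degZ tgt).
- move=> i j [a a'] [b b'] [/= h1 h2] [/= h3 h4]; split=> /=; first exact: (lt_deg_br tgt).
  apply: (lt_degD tgt); first by rewrite addrAC; apply: (lt_deg_br tgt).
  rewrite (opow_homog _ h1) (linPZ (brl _)) -addrA -[i + _]add0r.
  by apply: (lt_degZ tgt); [apply: gr_sg | apply: (lt_deg_br tgt)].
- by move=> n; split; apply: (lt_fil0 tgt).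
- by move=> n k [a a'] [b b'] [h1 h2] [h3 h4]; split; apply: (lt_filD tgt).
- by move=> m n [a a'] le [h1 h2]; split; apply: (lt_filW tgt le).
- move=> m n [a a'] [b b'] [/= h1 h2] [/= h3 h4]; split=> /=; first exact: (lt_fil_br tgt).
  rewrite -[br a' b]scale1r; apply: (lt_filD tgt); apply: (lt_fil_br tgt) => //.
  exact: opow_fil.
- by move=> [a a'] [/(lt_filN tgt) /= -> /(lt_filN tgt) /= ->].
- move=> i j [a a'] [b b'] [/= h1 h2] [/= h3 h4]; apply: pairE => /=.
    exact: (lt_anti tgt).
  rewrite (opow_homog _ h1) (opow_homog _ h3) !(linPZ (brl _)).
  rewrite (lt_anti tgt h2 h3) (lt_anti tgt h1 h4); module_coefs K; sg_ring.
- move=> i j [a a'] [b b'] [c c'] [/= h1 h2] [/= h3 h4]; apply: pairE => /=.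
    exact: (lt_jacobi tgt).
  rewrite !opow_br (opow_homog _ h1) (opow_homog _ h3) !(linPZ (brl _), linPZ (brr _)).
  rewrite !(linPD (brl _), linPD (brr _)) !(linPZ (brl _), linPZ (brr _)).
  rewrite (lt_jacobi tgt _ h2 h3) (lt_jacobi tgt _ h1 h4) (lt_jacobi tgt _ h1 h3).
  by module_coefs K; sg_ring.
Qed.

Lemma dual_data : interp_data G dual_br dual_deg dual_fil
  (fun y => (elt y, f y)) (fun y => (dif [::] y, h y)).
Proof.
split.
- by move=> k y z; apply: pairE; [apply: elt_lin | apply: (dd_flin dd)].
- by move=> k y z; apply: pairE; [apply: dif_lin | apply: (dd_hlin dd)].
- by move=> i y hy; split; [apply: elt_deg | apply: (dd_fdeg dd)].
- by move=> i y hy; split; [apply: dif0_deg | apply: (dd_hdeg dd)].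
- by move=> n y hy; split; [apply: elt_fil | apply: (dd_ffil dd)].
- by move=> n y hy; split; [apply: (@dif_fil _ _ _ _ _ n [::]) | apply: (dd_hfil dd)].
- move=> i j y z hy hz; apply: pairE => /=; first exact: elt_br.
  by rewrite (dd_fbr dd hy hz) (opow_homog _ (elt_deg N hy)) (linPZ (brl _)).
- move=> i j y z hy hz; apply: pairE => /=; first exact: dif_br.
  rewrite (dd_hbr dd hy hz) (opow_homog _ (elt_deg N hy)) (opow_homog _ (elt_deg N hz)).
  by rewrite !(linPZ (brl _)).
Qed.

(** The syntactic derivation is the second component of a morphism. It inherits from that morphism
    its compatibility with the relations, its degree and its behaviour on the filtration. *)
Lemma interp_dual s : interp dual_br (fun y => (elt y, f y)) (fun y => (dif [::] y, h y)) s =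
  (ocls G N s, ocls G N (oder e f0 h0 s)).
Proof.
elim: s => [y|w y|a IHa b IHb|a IHa b IHb|k a IHa|] //=.
- elim: w => [|a w IH] //=; rewrite IH. rewrite wdeg1; apply: pairE => /=; first by rewrite -dif_cons.
  rewrite !oclsZ oclsD oclsZ !oclsBr.
  by rewrite (opow_homog _ (elt_deg N (flie_letter_degree G v a))) (linPZ (brl _)).
- by rewrite IHa IHb /dual_br /= oclsBr oclsD !oclsBr ocls_sign.
- by rewrite IHa IHb !oclsD.
- by rewrite IHa !oclsZ.
Qed.

Definition oop (x : O) : O := ocls G N (oder e f0 h0 (class_repr x)).

Lemma oopE s : oop (ocls G N s) = ocls G N (oder e f0 h0 s).
Proof.
have := interp_eq dual_target dual_data (ocls_repr G N s).
by rewrite !interp_dual => /(congr1 snd) /= ->.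
Qed.

Lemma oop_lin : linear oop.
Proof.
move=> k x y; have [a ->] := oclsP x; have [b ->] := oclsP y.
by rewrite -oclsZ -oclsD !oopE /= oclsD oclsZ.
Qed.

Lemma oop_deg i x : odeg i x -> odeg (i + e) (oop x).
Proof.
case=> s hs <-; rewrite oopE.
by have [_] := interp_degree dual_target dual_data hs; rewrite interp_dual.
Qed.

Lemma oop_fil n x : ofil n x -> ofil n (oop x).
Proof.
case=> s hs <-; rewrite oopE.
by have [_] := interp_fil dual_target dual_data hs; rewrite interp_dual.
Qed.

Lemma oop_br_par x y : oop (br x y) = br (oop x) y + br (opow e x) (oop y).
Proof.
have [a ->] := oclsP x; have [b ->] := oclsP y.
by rewrite -oclsBr !oopE /= oclsD !oclsBr ocls_sign.
Qed.

Definition dop (x : drq G v N) : drq G v N :=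
  dcls G N (dr_leibniz e (oder e f0 h0) (class_repr x)).

Let B x y : drq G v N := dten (oop x) y + dten (opow e x) (oop y).

Lemma leibniz_target : dr_target B.
Proof.
have tl := @dten_linl K G r v N; have tr := @dten_linr K G r v N.
split.
- by move=> c k x y; rewrite /B oop_lin opow_lin !(tl _ _ _); module_coefs K; ring.
- by move=> c k x y; rewrite /B oop_lin !(tr _ _ _); module_coefs K; ring.
- move=> m n a b le ha hb; apply: dfilN; apply: (dfilW le); rewrite /B -[X in X + _]scale1r.
  by apply: dfilD; apply: dfil_ten; rewrite //; do ?[exact: oop_fil|exact: opow_fil].
- move=> i j a b ha hb; rewrite /B (opow_homog _ ha) (opow_homog _ hb) !(linPZ (tl _)).
  rewrite (dten_comm (oop_deg ha) hb) (dten_comm ha (oop_deg hb)).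
  by module_coefs K; sg_ring.
- move=> a b c; rewrite /B !oop_br_par !(linPD (tr _)) !(linPD (tl _)) opow_br !dten_inv.
  by rewrite addrA.
Qed.

Lemma dr_interp_leibniz s : dr_interp B s = dcls G N (dr_leibniz e (oder e f0 h0) s).
Proof.
elim: s => [a b|a IHa b IHb|k a IHa|] //=.
- by rewrite /B !oopE dclsD !dclsTens ocls_sign.
- by rewrite IHa IHb dclsD.
- by rewrite IHa dclsZ.
Qed.

Lemma dopE s : dop (dcls G N s) = dcls G N (dr_leibniz e (oder e f0 h0) s).
Proof.
rewrite /dop -!dr_interp_leibniz; apply: (dr_interp_eq leibniz_target).
exact/de_sym/dcls_repr.
Qed.

Lemma dop_lin : linear dop.
Proof.
move=> k x y; have [a ->] := dclsP x; have [b ->] := dclsP y.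
by rewrite -dclsZ -dclsD !dopE /= dclsD dclsZ.
Qed.

Lemma oop_is_der : is_der e oop dop.
Proof.
split; [exact: oop_lin | exact: dop_lin | exact: oop_deg | |].
- by move=> i x y hx; rewrite oop_br_par (opow_homog _ hx) (linPZ (brl _)).
- move=> i x y hx; have [a ea] := oclsP x; have [b eb] := oclsP y.
  rewrite -[in RHS](linPZ (@dten_linl K G r v N _)) -(opow_homog _ hx) ea eb.
  by rewrite -dclsTens dopE /= dclsD !dclsTens !oopE ocls_sign.
Qed.
End DerOps.

(** * Cartan calculus *)

Section Derivations.
Variables (K : comAlgType rat) (G : even_grading K) (r : nat) (v : 'I_r -> int) (N : nat).
Local Notation g := (free_lie K v).
Local Notation O := (omegaq G v N).
Local Notation Dr := (drq G v N).
Local Notation br := (@obr K G r v N).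
Local Notation ten := (@dten K G r v N).
Local Notation tgt := (omega_target G v N).
Local Notation brl := (lt_linl tgt).
Local Notation brr := (lt_linr tgt).
Local Notation tenl := (@dten_linl K G r v N).
Local Notation tenr := (@dten_linr K G r v N).

Lemma is_der_comm e1 e2 D1 D1' D2 D2' :
  @is_der K G r v N e1 D1 D1' -> @is_der K G r v N e2 D2 D2' ->
  is_der (e1 + e2) (fun x => D1 (D2 x) - sg K (e1 * e2) *: D2 (D1 x))
                   (fun x => D1' (D2' x) - sg K (e1 * e2) *: D2' (D1' x)).
Proof.
move=> [l1 l1' d1 b1 t1] [l2 l2' d2 b2 t2]; split.
- by move=> k x y; rewrite !(l1, l2); module_coefs K; ring.
- by move=> k x y; rewrite !(l1', l2'); module_coefs K; ring.
- move=> i x hx; rewrite -scaleNr [X in odeg _ X]addrC; apply: odeg_lin.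
  + by apply/gr_opp/gr_sg.
  + by rewrite addrA; apply/d2/d1.
  + by rewrite [e1 + e2]addrC addrA; apply/d1/d2.
- move=> i x y hx; rewrite (b2 _ _ _ hx) (b1 _ _ _ hx) !(linPD l1, linPD l2, linPZ l1, linPZ l2).
  rewrite (b1 _ _ _ (d2 _ _ hx)) (b2 _ _ _ (d1 _ _ hx)) (b2 _ _ _ hx) (b1 _ _ _ hx).
  rewrite !(linPB (brl _), linPB (brr _)) !(linPZ (brl _), linPZ (brr _)).
  by module_coefs K; sg_ring.
- move=> i x y hx; rewrite (t2 _ _ _ hx) (t1 _ _ _ hx) !(linPD l1', linPD l2', linPZ l1', linPZ l2').
  rewrite (t1 _ _ _ (d2 _ _ hx)) (t2 _ _ _ (d1 _ _ hx)) (t2 _ _ _ hx) (t1 _ _ _ hx).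
  rewrite !(linPB (tenl _), linPB (tenr _)) !(linPZ (tenl _), linPZ (tenr _)).
  by module_coefs K; sg_ring.
Qed.

Lemma is_der_lin e k D1 D1' D2 D2' : gr G 0 k ->
  @is_der K G r v N e D1 D1' -> @is_der K G r v N e D2 D2' ->
  is_der e (fun x => k *: D1 x + D2 x) (fun x => k *: D1' x + D2' x).
Proof.
move=> hk [l1 l1' d1 b1 t1] [l2 l2' d2 b2 t2]; split.
- by move=> c x y; rewrite !(l1, l2); module_coefs K; ring.
- by move=> c x y; rewrite !(l1', l2'); module_coefs K; ring.
- by move=> i x hx; apply: odeg_lin => //; [apply: d1 | apply: d2].
- move=> i x y hx; rewrite (b2 _ _ _ hx) (b1 _ _ _ hx) (brl _ _ _) (brr _ _ _).
  by module_coefs K; ring.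
- move=> i x y hx; rewrite (t2 _ _ _ hx) (t1 _ _ _ hx) (tenl _ _ _) (tenr _ _ _).
  by module_coefs K; ring.
Qed.

Lemma is_der_par e D D' x y : @is_der K G r v N e D D' ->
  D (br x y) = br (D x) y + br (opow e x) (D y) /\
  D' (ten x y) = ten (D x) y + ten (opow e x) (D y).
Proof.
move=> [l l' _ b t]; move: x; apply: omega_hom_ind => [i x hx|k x z [h1 h2] [h3 h4]].
  by rewrite (opow_homog _ hx) (linPZ (brl _)) (linPZ (tenl _)) (b _ _ _ hx) (t _ _ _ hx).
rewrite (opow_lin _ _ _) !(brl _ _ _) !(tenl _ _ _) !l !l' h1 h2 h3 h4.
by rewrite !(brl _ _ _) !(tenl _ _ _); split; module_coefs K; ring.
Qed.

Lemma is_der_uniq e D1 D1' D2 D2' :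
  @is_der K G r v N e D1 D1' -> @is_der K G r v N e D2 D2' ->
  (forall y, D1 (elt G N y) = D2 (elt G N y)) ->
  (forall y, D1 (dif G N [::] y) = D2 (dif G N [::] y)) ->
  D1 =1 D2 /\ D1' =1 D2'.
Proof.
move=> H1 H2 he hd.
have [l1 l1' _ _ _] := H1; have [l2 l2' _ _ _] := H2.
have e0 : D1 =1 D2.
  move=> x; have [s ->] := oclsP x; elim: s => [y|w y|a IHa b IHb|a IHa b IHb|k a IHa|].
  - exact: he.
  - elim: w => [|a w IH]; first exact: hd.
    rewrite -!/(dif _ _ _ _) dif_cons.
    by rewrite (linPZ l1) (linPZ l2) (is_der_par _ _ H1).1 (is_der_par _ _ H2).1 he IH.
  - by rewrite oclsBr (is_der_par _ _ H1).1 (is_der_par _ _ H2).1 IHa IHb.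
  - by rewrite oclsD (linPD l1) (linPD l2) IHa IHb.
  - by rewrite oclsZ (linPZ l1) (linPZ l2) IHa.
  - by rewrite ocls0 (linP0 l1) (linP0 l2).
split=> // x; have [s ->] := dclsP x; elim: s => [a b|a IHa b IHb|k a IHa|].
- by rewrite dclsTens (is_der_par _ _ H1).2 (is_der_par _ _ H2).2 !e0.
- by rewrite dclsD (linPD l1') (linPD l2') IHa IHb.
- by rewrite dclsZ (linPZ l1') (linPZ l2') IHa.
- by rewrite dcls0 (linP0 l1') (linP0 l2').
Qed.

Lemma ext_data : @der_data K G r v N 1 (fun y => ocls G N (ODiff [::] y)) (fun=> ocls G N (OZero K v)).
Proof.
split.
- exact: dif_lin.
- by move=> k x y; rewrite ocls0 scaler0 addr0.
- by move=> i y; apply: dif0_deg.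
- by move=> i y hy; exists (OZero K v).
- by move=> n y; apply: (@dif_fil _ _ _ _ _ n [::]).
- by move=> n y hy; exists (OZero K v).
- move=> i j y z hy hz; rewrite -!/(dif _ _ _ _) (dif_br N hy hz).
  rewrite (lt_anti tgt (dif0_deg N hy) (elt_deg N hz)).
  by module_coefs K; sg_ring.
- move=> i j y z hy hz; rewrite -!/(dif _ _ _ _) ocls0 !(linP0 (brr _)).
  rewrite (lt_anti tgt (dif0_deg N hy) (dif0_deg N hz)).
  by module_coefs K; sg_ring.
Qed.

Definition ext_o : O -> O := oop 1 (ODiff [::]) (fun=> OZero K v).
Definition ext_d : Dr -> Dr := dop 1 (ODiff [::]) (fun=> OZero K v).
Lemma ext_der : is_der 1 ext_o ext_d. Proof. exact: oop_is_der ext_data. Qed.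
Lemma ext_elt y : ext_o (elt G N y) = dif G N [::] y.
Proof. exact: oopE ext_data _. Qed.
Lemma ext_dif y : ext_o (dif G N [::] y) = 0.
Proof. exact: oopE ext_data _. Qed.

Section VectorField.
Variables (j : int) (xi : g -> g).
Hypothesis vx : vector_field G j xi.

Lemma lie_data : @der_data K G r v N j (fun y => ocls G N (OElt (xi y)))
  (fun y => ocls G N (OScale (sg K j) (ODiff [::] (xi y)))).
Proof.
have [lx cx dx bx] := vx; have fx := vector_field_filtered vx.
split.
- by move=> k x y; rewrite -!/(elt _ _ _) lx elt_lin.
- by move=> k x y; rewrite !oclsZ -!/(dif _ _ _ _) lx dif_lin; module_coefs K; ring.
- by move=> i y /dx; apply: elt_deg.
- move=> i y hy; rewrite oclsZ -[i + 1 + j]add0r; apply: (lt_degZ tgt); first exact: gr_sg.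
  by rewrite addrAC; apply/dif0_deg/dx.
- by move=> n y /fx; apply: elt_fil.
- move=> n y /fx hy; rewrite oclsZ -[_ *: _]addr0; apply: (lt_filD tgt); last exact: (lt_fil0 tgt).
  exact: (@dif_fil _ _ _ _ _ n [::]).
- move=> i k y z hy hz; rewrite -!/(elt _ _ _) (bx _ _ _ hy) (linPD (@elt_lin _ _ _ _ _)).
  by rewrite (linPZ (@elt_lin _ _ _ _ _)) !elt_br.
- move=> i k y z hy hz; rewrite !oclsZ -!/(dif _ _ _ _) -!/(elt _ _ _) (bx _ _ _ hy).
  rewrite (linPD (dif_lin _ _ _)) (linPZ (dif_lin _ _ _)) (dif_br N (dx _ _ hy) hz).
  rewrite (dif_br N hy (dx _ _ hz)) !(linPZ (brr _)).
  by module_coefs K; sg_ring.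
Qed.

Lemma con_data : @der_data K G r v N (j - 1) (fun=> ocls G N (OZero K v))
  (fun y => ocls G N (OElt (xi y))).
Proof.
have [lx cx dx bx] := vx; have fx := vector_field_filtered vx.
split.
- by move=> k x y; rewrite ocls0 scaler0 addr0.
- by move=> k x y; rewrite -!/(elt _ _ _) lx elt_lin.
- by move=> i y hy; exists (OZero K v).
- by move=> i y /dx hy; rewrite (_ : i + 1 + (j - 1) = i + j); [apply: elt_deg | ring].
- by move=> n y hy; exists (OZero K v).
- by move=> n y /fx; apply: elt_fil.
- by move=> i k y z hy hz; rewrite ocls0 (linP0 (brl _)) (linP0 (brr _)) scaler0 addr0.
- move=> i k y z hy hz; rewrite ocls0 !(linP0 (brl _)) -!/(elt _ _ _) (bx _ _ _ hy).
  rewrite (linPD (@elt_lin _ _ _ _ _)) (linPZ (@elt_lin _ _ _ _ _)) !elt_br.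
  rewrite (lt_anti tgt (elt_deg N hz) (elt_deg N (dx _ _ hy))).
  by module_coefs K; sg_ring.
Qed.

Definition lie_o : O -> O :=
  oop j (@OElt K r v \o xi) (fun y => OScale (sg K j) (ODiff [::] (xi y))).
Definition lie_d : Dr -> Dr :=
  dop j (@OElt K r v \o xi) (fun y => OScale (sg K j) (ODiff [::] (xi y))).
Lemma lie_der : is_der j lie_o lie_d. Proof. exact: oop_is_der lie_data. Qed.
Lemma lie_elt y : lie_o (elt G N y) = elt G N (xi y).
Proof. exact: oopE lie_data _. Qed.
Lemma lie_dif y : lie_o (dif G N [::] y) = sg K j *: dif G N [::] (xi y).
Proof. by rewrite -oclsZ; exact: oopE lie_data _. Qed.

Definition con_o : O -> O := oop (j - 1) (fun=> OZero K v) (@OElt K r v \o xi).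
Definition con_d : Dr -> Dr := dop (j - 1) (fun=> OZero K v) (@OElt K r v \o xi).
Lemma con_der : is_der (j - 1) con_o con_d. Proof. exact: oop_is_der con_data. Qed.
Lemma con_elt y : con_o (elt G N y) = 0.
Proof. exact: oopE con_data _. Qed.
Lemma con_dif y : con_o (dif G N [::] y) = elt G N (xi y).
Proof. exact: oopE con_data _. Qed.
End VectorField.

(** As [d] is odd, its graded commutator with itself is twice its square. This commutator is a
    derivation that kills [y] and [dy], and [2] is invertible. *)
Lemma ext_sq x : ext_d (ext_d x) = 0.
Proof.
have zero_der : is_der (1 + 1) (fun=> 0 : O) (fun=> 0 : Dr).
  split=> [k a b|k a b|i a _|i a b _|i a b _].
  - by rewrite scaler0 addr0.
  - by rewrite scaler0 addr0.
  - exact: (lt_deg0 tgt).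
  - by rewrite (linP0 (brl _)) (linP0 (brr _)) scaler0 addr0.
  - by rewrite (linP0 (tenl _)) (linP0 (tenr _)) scaler0 addr0.
have [||_ /(_ x) e] := is_der_uniq (is_der_comm ext_der ext_der) zero_der.
- by move=> y; rewrite ext_elt ext_dif scaler0 subr0.
- by move=> y; rewrite ext_dif (linP0 (der_lin ext_der)) scaler0 subr0.
have {e} e : (2 : K) *: ext_d (ext_d x) = 0.
  by rewrite -e sgE; module_coefs K; rewrite /=; ring.
exact: (natr_scale_eq0 (n := 1)) e.
Qed.

Section TwoFields.
Variables (j k : int) (xi eta : g -> g).
Hypotheses (vx : vector_field G j xi) (vy : vector_field G k eta).

Lemma cartan x : lie_d j xi x = con_d j xi (ext_d x) + sg K j *: ext_d (con_d j xi x).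
Proof.
have c := is_der_comm (con_der vx) ext_der; rewrite subrK in c.
have [||_ /(_ x) ->] := is_der_uniq (lie_der vx) c.
- by move=> y; rewrite lie_elt // ext_elt con_elt // (linP0 (der_lin ext_der)) con_dif // scaler0 subr0.
- move=> y; rewrite lie_dif // ext_dif con_dif // (linP0 (der_lin (con_der vx))) ext_elt.
  by module_coefs K; sg_ring.
by module_coefs K; sg_ring.
Qed.

Definition bracket (y : g) : g := xi (eta y) - sg K (j * k) *: eta (xi y).

Lemma bracket_vector_field : vector_field G (j + k) bracket.
Proof.
have [lx cx dx bx] := vx; have [ly cy dy b_y] := vy; split.
- by move=> c a b; rewrite /bracket !(lx, ly); module_coefs K; ring.
- move=> n; exists n => y hy; rewrite /bracket -scaleNr addrC; apply: val_order_geD.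
  + by apply: (vector_field_filtered vy); apply: (vector_field_filtered vx).
  + by apply: (vector_field_filtered vx); apply: (vector_field_filtered vy).
- move=> i y hy; rewrite /bracket -scaleNr; apply: has_degreeD.
  + by rewrite [j + k]addrC addrA; apply/dx/dy.
  + by apply: has_degreeZ0; [apply/gr_opp/gr_sg | rewrite addrA; apply/dy/dx].
- move=> i y z hy; rewrite /bracket (b_y _ _ _ hy) (bx _ _ _ hy).
  rewrite !(linPD lx, linPD ly, linPZ lx, linPZ ly).
  rewrite (bx _ _ _ (dy _ _ hy)) (b_y _ _ _ (dx _ _ hy)) (b_y _ _ _ hy) (bx _ _ _ hy).
  have bl (c : g) : linear (fun a => flie_br a c) by move=> ? ? ?; apply: flie_br_linearl.
  have br (c : g) : linear (flie_br c) by move=> ? ? ?; apply: flie_br_linearr.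
  rewrite (linPB (bl _)) (linPZ (bl _)) (linPB (br _)) (linPZ (br _)).
  by module_coefs K; sg_ring.
Qed.

(** Used with [xi = m2] to turn [[m2, -]] into a Lie derivative of 1-forms, and with the Euler field
    to read the order of a field off the tensor degree of its contraction with the symplectic
    form. *)
Lemma con_bracket x : con_d (j + k) bracket x =
  lie_d j xi (con_d k eta x) - sg K (j * (k - 1)) *: con_d k eta (lie_d j xi x).
Proof.
have c := is_der_comm (lie_der vx) (con_der vy); rewrite addrA in c.
have [||_ /(_ x) ->] // := is_der_uniq (con_der bracket_vector_field) c.
- move=> y; rewrite (con_elt bracket_vector_field) (con_elt vy) (lie_elt vx) (con_elt vy).
  by rewrite (linP0 (der_lin (lie_der vx))) scaler0 subr0.
- move=> y; rewrite (con_dif bracket_vector_field) (con_dif vy) (lie_elt vx) (lie_dif vx).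
  rewrite (linPZ (der_lin (con_der vy))) (con_dif vy).
  rewrite /bracket (linPB (@elt_lin _ _ _ _ _)) (linPZ (@elt_lin _ _ _ _ _)).
  by module_coefs K; sg_ring.
Qed.

Lemma lie_ext x : lie_d j xi (ext_d x) = sg K j *: ext_d (lie_d j xi x).
Proof.
rewrite !cartan ext_sq (linP0 (der_lin' (con_der vx))).
rewrite (linPD (der_lin' ext_der)) (linPZ (der_lin' ext_der)) ext_sq.
by module_coefs K; sg_ring.
Qed.
End TwoFields.
End Derivations.

(** * The Euler field *)

Section Euler.
Variables (K : comAlgType rat) (G : even_grading K) (r : nat) (v : 'I_r -> int).
Local Notation g := (free_lie K v).

Definition euler_series (x : series K r) : series K r := fun w => (size w)%:R * x w.

Lemma euler_subproof (y : g) : euler_series (val y) \in lie_series v.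
Proof.
apply/asboolP => n.
have -> : spart n (euler_series (val y)) = n%:R *: spart n (val y) + 0.
  apply/funext => w; rewrite addr0 serZ /spart /euler_series.
  by case: eqP => [->|]; rewrite ?mulr0.
by apply: lie_polyZD (lie_poly0 _ _); exact: (asboolW (valP y)).
Qed.

Definition euler (y : g) : g := exist _ (euler_series (val y)) (euler_subproof y).

Lemma euler_val y w : val (euler y) w = (size w)%:R * val y w.
Proof. by []. Qed.

Lemma euler_order_eq n y : order_eq n (val y) -> euler y = n%:R *: y.
Proof.
move=> h; apply: val_inj; apply/funext => w; rewrite euler_val valZ.
by have [->//|ne] := eqVneq (size w) n; rewrite h // !mulr0.
Qed.

Lemma euler_letter a : euler (flie_letter K v a) = flie_letter K v a.
Proof.
rewrite (@euler_order_eq 1) ?scale1r // => w ne.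
by rewrite /= /letter; case: eqP => // e; rewrite e in ne.
Qed.

Lemma euler_field : vector_field G 0 euler.
Proof.
split.
- move=> k y z; apply: val_inj; apply/funext => w.
  by rewrite euler_val !valD !valZ !euler_val; ring.
- by move=> n; exists n => y hy w lt; rewrite euler_val hy // mulr0.
- move=> i y hy w; rewrite euler_val addr0 -[i - _]add0r.
  by apply: gr_mul (hy w); apply: gr_nat.
- move=> i y z _; apply: val_inj; apply/funext => w.
  rewrite euler_val valD valZ mul0r sgE /= mul1r mulr_sumr -big_split.
  apply: eq_bigr => a _ /=; rewrite /euler_series.
  have -> : (size w)%:R = (size (take a w))%:R + (size (drop a w))%:R :> K.
    by rewrite -natrD -size_cat cat_take_drop.
  by ring.
Qed.

Lemma euler_ge n (y : g) : order_ge n (val y) -> order_ge n.+1 (val (euler y - n%:R *: y)).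
Proof.
move=> hy w; rewrite ltnS leq_eqVlt => /orP[/eqP e|lt]; rewrite valB euler_val valZ.
  by rewrite e subrr.
by rewrite hy // !mulr0 subrr.
Qed.

Section EulerOps.
Variable N : nat.
Local Notation O := (omegaq G v N).
Local Notation br := (@obr K G r v N).
Local Notation tgt := (omega_target G v N).
Local Notation brl := (lt_linl tgt).
Local Notation brr := (lt_linr tgt).
Local Notation tenl := (@dten_linl K G r v N).
Local Notation tenr := (@dten_linr K G r v N).
Local Notation LE := (@lie_o K G r v N 0 euler).
Local Notation LEd := (@lie_d K G r v N 0 euler).
Local Notation der := (lie_der N euler_field).

Lemma opow0 (x : O) : opow 0 x = x. Proof. by []. Qed.

Lemma euler_br x y : LE (br x y) = br (LE x) y + br x (LE y).
Proof. by rewrite (is_der_par _ _ der).1 opow0. Qed.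

Lemma euler_ten x y : LEd (dten x y) = dten (LE x) y + dten x (LE y).
Proof. by rewrite (is_der_par _ _ der).2 opow0. Qed.

Lemma euler_dif w y : LE (dif G N w y) = dif G N w (euler y) + (size w)%:R *: dif G N w y.
Proof.
elim: w => [|a w IH].
  by rewrite (lie_dif _ euler_field) sgE scale1r scale0r addr0.
rewrite !dif_cons (linPZ (der_lin der)) euler_br IH (lie_elt _ euler_field) euler_letter.
rewrite (linPD (brr _)) (linPZ (brr _)) -[(size (a :: w))]addn1 natrD.
by module_coefs K; ring.
Qed.

Lemma euler_omega_weight s n : omega_weight s n -> LE (ocls G N s) = n%:R *: ocls G N s.
Proof.
elim: s n => [y|w y|a IHa b IHb|a IHa b IHb|k a IHa|] n /=.
- by move=> h; rewrite -/(elt _ _ _) (lie_elt _ euler_field) (euler_order_eq h) (linPZ (elt_lin _ _)).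
- case=> m [-> h]; rewrite -/(dif _ _ _ _) euler_dif (euler_order_eq h) (linPZ (dif_lin _ _ _)).
  by rewrite natrD; module_coefs K; ring.
- case=> m [m' [-> /IHa ha /IHb hb]]; rewrite oclsBr euler_br ha hb.
  by rewrite (linPZ (brl _)) (linPZ (brr _)) natrD scalerDl.
- by case=> /IHa ha /IHb hb; rewrite oclsD (linPD (der_lin der)) ha hb scalerDr.
- by move=> /IHa ha; rewrite oclsZ (linPZ (der_lin der)) ha; module_coefs K; ring.
- by move=> _; rewrite ocls0 (linP0 (der_lin der)) scaler0.
Qed.

Lemma euler_weight s n : dr_weight s n -> LEd (dcls G N s) = n%:R *: dcls G N s.
Proof.
elim: s n => [a b|a IHa b IHb|k a IHa|] n /=.
- case=> m [m' [-> /euler_omega_weight ha /euler_omega_weight hb]].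
  rewrite dclsTens euler_ten ha hb.
  by rewrite (linPZ (tenl _)) (linPZ (tenr _)) natrD scalerDl.
- by case=> /IHa ha /IHb hb; rewrite dclsD (linPD (der_lin' der)) ha hb scalerDr.
- by move=> /IHa ha; rewrite dclsZ (linPZ (der_lin' der)) ha; module_coefs K; ring.
- by move=> _; rewrite dcls0 (linP0 (der_lin' der)) scaler0.
Qed.

Lemma euler_omega_fil s n : omega_weight_ge s n ->
  ofil n.+1 (LE (ocls G N s) - n%:R *: ocls G N s).
Proof.
have addf m x y : ofil m x -> ofil m y -> ofil m (x + y : O).
  by move=> hx hy; rewrite -[x]scale1r; apply: (lt_filD tgt).
have scf m k x : ofil m x -> ofil m (k *: x : O).
  by move=> hx; rewrite -[_ *: _]addr0; apply: (lt_filD tgt) => //; apply: (lt_fil0 tgt).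
elim: s n => [y|w y|a IHa b IHb|a IHa b IHb|k a IHa|] n /=.
- move=> h; rewrite -/(elt _ _ _) (lie_elt _ euler_field) -(linPZ (elt_lin _ _)).
  by rewrite -(linPB (elt_lin _ _)); apply/elt_fil/euler_ge.
- move=> h; rewrite -/(dif _ _ _ _) euler_dif.
  have [le|lt] := leqP (size w) n.
    rewrite (_ : _ - _ = dif G N w (euler y - (n - size w)%:R *: y)).
      apply: (lt_filW tgt) (dif_fil _ _ _ (euler_ge h)); lia.
    rewrite (linPB (dif_lin _ _ _)) (linPZ (dif_lin _ _ _)) natrB //.
    by module_coefs K; ring.
  (* Here [n - size w] is [0] and the hypothesis on [y] is empty, but the word alone has more than
     [n] letters. *)
  have ge (z : g) : ofil n.+1 (dif G N w z).
    by apply: (lt_filW tgt lt); rewrite -[size w]addn0; apply: dif_fil.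
  by rewrite -scaleNr; apply: (addf); [apply: (addf)|]; do ?apply: scf.
- case=> m [m' [le wa wb]]; have ha := IHa _ wa; have hb := IHb _ wb.
  have fa : ofil m (ocls G N a) by exists a.
  have fb : ofil m' (ocls G N b) by exists b.
  rewrite oclsBr euler_br.
  set x := ocls G N a in ha fa *; set y := ocls G N b in hb fb *.
  (* The bracket may lie deeper than [n]: the last term has coefficient [0] when [m + m' = n] and
     lies in filtration [n.+1] otherwise. *)
  rewrite (_ : _ - _ = (br (LE x - m%:R *: x) y + br x (LE y - m'%:R *: y))
     + (m%:R + m'%:R - n%:R) *: br x y).
    apply: (addf); first apply: (addf).
    + by apply: (lt_filW tgt) (lt_fil_br tgt ha fb).
    + by apply: (lt_filW tgt) (lt_fil_br tgt fa hb); rewrite addnS.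
    + move: le; rewrite leq_eqVlt => /orP[/eqP e|lt].
        by rewrite -natrD -e subrr scale0r; apply: (lt_fil0 tgt).
      by apply: scf; apply: (lt_filW tgt lt); apply: (lt_fil_br tgt).
  rewrite (linPB (brl _)) (linPB (brr _)) (linPZ (brl _)) (linPZ (brr _)).
  by module_coefs K; ring.
- case=> /IHa ha /IHb hb; rewrite oclsD (linPD (der_lin der)).
  by rewrite scalerDr opprD addrACA; apply: (addf).
- move=> /IHa ha; rewrite oclsZ (linPZ (der_lin der)) scalerA mulrC -scalerA -scalerBr.
  exact: scf.
- by move=> _; rewrite ocls0 (linP0 (der_lin der)) scaler0 subr0; apply: (lt_fil0 tgt).
Qed.

Lemma euler_fil x n : dfil n x -> dfil n.+1 (LEd x - n%:R *: x).
Proof.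
have addf m (y z : drq G v N) : dfil m y -> dfil m z -> dfil m (y + z).
  by move=> hx hy; rewrite -[y]scale1r; apply: dfilD.
case=> s hs <- {x}; elim: s n hs => [a b|a IHa b IHb|k a IHa|] n /=.
- case=> m [m' [le wa wb]].
  have ha := euler_omega_fil wa; have hb := euler_omega_fil wb.
  have fa : ofil m (ocls G N a) by exists a.
  have fb : ofil m' (ocls G N b) by exists b.
  rewrite dclsTens euler_ten.
  set x := ocls G N a in ha fa *; set y := ocls G N b in hb fb *.
  rewrite (_ : _ - _ = (dten (LE x - m%:R *: x) y + dten x (LE y - m'%:R *: y))
     + (m%:R + m'%:R - n%:R) *: dten x y).
    apply: (addf); first apply: (addf).
    + by apply: dfilW (dfil_ten ha fb).
    + by apply: dfilW (dfil_ten fa hb); rewrite addnS.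
    + move: le; rewrite leq_eqVlt => /orP[/eqP e|lt].
        by rewrite -natrD -e subrr scale0r; apply: dfil0.
      by apply: dfilZ; apply: (dfilW lt); apply: dfil_ten.
  rewrite (linPB (tenl _)) (linPB (tenr _)) (linPZ (tenl _)) (linPZ (tenr _)).
  by module_coefs K; ring.
- case=> /IHa ha /IHb hb; rewrite dclsD (linPD (der_lin' der)).
  by rewrite scalerDr opprD addrACA; apply: (addf).
- move=> /IHa ha; rewrite dclsZ (linPZ (der_lin' der)) scalerA mulrC -scalerA -scalerBr.
  exact: dfilZ.
- by move=> _; rewrite dcls0 (linP0 (der_lin' der)) scaler0 subr0; apply: dfil0.
Qed.

(** On filtration [n + k + 1] the Euler field acts by [n + k + 1] modulo the next step, while it
    acts on [x] by [n]. Hence [(k + 1) x] lies one step deeper, and so does [x] because [k + 1] is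
    invertible. Iterating brings [x] into filtration [N], which is zero. *)
Lemma pure_weight_eq0 n x : LEd x = n%:R *: x -> dfil n.+1 x -> x = 0.
Proof.
move=> ex h; suff h' k : dfil (n.+1 + k) x.
  by apply: dfilN; apply: dfilW (h' N); apply: leq_addl.
elim: k => [|k IH]; first by rewrite addn0.
have := euler_fil IH; rewrite ex addnS.
have [c ec] := nat_inv K k.
move/(@dfilZ _ _ _ _ _ _ (- c)); congr (dfil _ _).
have -> : (n.+1 + k)%:R = n%:R + k.+1%:R :> K by rewrite -natrD addSnnS.
transitivity ((c * k.+1%:R) *: x); last by rewrite ec scale1r.
by module_coefs K; ring.
Qed.
End EulerOps.
End Euler.

(** * Degrees, weights and form degrees of expressions *)

Section Syntax.
Variables (K : comAlgType rat) (G : even_grading K) (r : nat) (v : 'I_r -> int).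
Local Notation g := (free_lie K v).
Implicit Types (s t : omega K v) (y : g) (i j k : int).

Lemma omega_degree_eq s i j : omega_degree G s i -> i = j -> omega_degree G s j.
Proof. by move=> h <-. Qed.

Lemma dr_degree_eq (s : dr K v) i j : dr_degree G s i -> i = j -> dr_degree G s j.
Proof. by move=> h <-. Qed.

Lemma omega_par_degree s i : omega_degree G s i -> omega_degree G (omega_par s) i.
Proof.
elim: s i => [y|w y|a IHa b IHb|a IHa b IHb|k a IHa|] i //=.
- exact: flie_par_degree.
- move/flie_par_degree => h; exists 0; rewrite subr0; split=> //.
  by apply/gr_opp/gr_sg.
- by case=> j [/IHa ha /IHb hb]; exists j.
- by case=> /IHa ha /IHb hb.
- by case=> j [hk /IHa ha]; exists j.
Qed.

Lemma omega_par_form s p : omega_form s p -> omega_form (omega_par s) p.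
Proof.
elim: s p => [y|w y|a IHa b IHb|a IHa b IHb|k a IHa|] p //=.
- by case=> m [n [e /IHa ha /IHb hb]]; exists m, n.
- by case=> /IHa ha /IHb hb.
- exact: IHa.
Qed.

Lemma flie_par_order_eq n y : order_eq n (val y) -> order_eq n (val (flie_par y)).
Proof. by move=> h w ne; rewrite /= /spar h ?mulr0. Qed.

Lemma omega_par_weight s n : omega_weight s n -> omega_weight (omega_par s) n.
Proof.
elim: s n => [y|w y|a IHa b IHb|a IHa b IHb|k a IHa|] n //=.
- exact: flie_par_order_eq.
- by case=> m [-> h]; exists m; split=> //; apply: flie_par_order_eq.
- by case=> m [m' [e /IHa ha /IHb hb]]; exists m, m'.
- by case=> /IHa ha /IHb hb.
- exact: IHa.
Qed.

Lemma omega_sign_degree e s i : omega_degree G s i -> omega_degree G (omega_sign e s) i.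
Proof. by rewrite /omega_sign; case: ifP => _ //; apply: omega_par_degree. Qed.
Lemma omega_sign_form e s p : omega_form s p -> omega_form (omega_sign e s) p.
Proof. by rewrite /omega_sign; case: ifP => _ //; apply: omega_par_form. Qed.
Lemma omega_sign_weight e s n : omega_weight s n -> omega_weight (omega_sign e s) n.
Proof. by rewrite /omega_sign; case: ifP => _ //; apply: omega_par_weight. Qed.

Lemma flie_letter_order a : order_eq 1 (val (flie_letter K v a)).
Proof. by apply: lie_mono_order; apply: lm_letter. Qed.

Section Oder.
Variables (e : int) (f h : g -> omega K v).

Lemma oder_degree s i :
  (forall i y, has_degree G v i (val y) -> omega_degree G (f y) (i + e)) ->
  (forall i y, has_degree G v i (val y) -> omega_degree G (h y) (i + 1 + e)) ->
  omega_degree G s i -> omega_degree G (oder e f h s) (i + e).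
Proof.
move=> hf hh; elim: s i => [y|w y|a IHa b IHb|a IHa b IHb|k a IHa|] i //=.
- exact: hf.
- elim: w i => [|a w IH] i hy.
    by rewrite /= -[i](subrK 1); apply: hh; rewrite wdeg0 subr0 in hy.
  rewrite wdeg_cons in hy; exists 0; split; first exact: gr_sg.
  split.
    exists (1 - v a + e); split; first exact/hf/has_degree_letter.
    by move: hy => /=; congr (has_degree _ _ _ _); ring.
  exists 0; split; first exact: gr_sg.
  exists (1 - v a); split; first exact: has_degree_letter.
  apply: (@omega_degree_eq _ (i - (1 - v a) + e)); last by ring.
  by apply: IH; move: hy; congr (has_degree _ _ _ _); ring.
- case=> j [ha hb]; split.
    exists (j + e); split; first exact: IHa.
    by apply: omega_degree_eq hb _; ring.
  exists j; split; first exact: omega_sign_degree.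
  by apply: (omega_degree_eq (IHb _ hb)); ring.
- by case=> /IHa ha /IHb hb.
- case=> j [hk ha]; exists j; split=> //.
  by apply: (omega_degree_eq (IHa _ ha)); ring.
Qed.

Lemma oder_weight c s n :
  (forall n y, order_eq n (val y) -> omega_weight (f y) (n + c)) ->
  (forall n y, order_eq n (val y) -> omega_weight (h y) (n + c)) ->
  omega_weight s n -> omega_weight (oder e f h s) (n + c).
Proof.
move=> hf hh; elim: s n => [y|w y|a IHa b IHb|a IHa b IHb|k a IHa|] n //=.
- exact: hf.
- case=> m [-> hy]; elim: w => [|a w IH] /=; first exact: hh.
  split.
    exists (1 + c)%N, (size w + m)%N; split; [by lia | exact/hf/flie_letter_order |].
    by exists m.
  by exists 1%N, (size w + m + c)%N; split; [lia | exact: flie_letter_order | exact: IH].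
- case=> m [m' [-> ha hb]]; split.
    by exists (m + c)%N, m'; split; [lia | exact: IHa |].
  by exists m, (m' + c)%N; split; [lia | exact: omega_sign_weight | exact: IHb].
- by case=> /IHa ha /IHb hb.
- exact: IHa.
Qed.

Lemma dr_leibniz_degree (s : dr K v) i :
  (forall i y, has_degree G v i (val y) -> omega_degree G (f y) (i + e)) ->
  (forall i y, has_degree G v i (val y) -> omega_degree G (h y) (i + 1 + e)) ->
  dr_degree G s i -> dr_degree G (dr_leibniz e (oder e f h) s) (i + e).
Proof.
move=> hf hh; elim: s i => [a b|a IHa b IHb|k a IHa|] i //=.
- case=> j [ha hb]; split.
    exists (j + e); split; first exact: oder_degree.
    by apply: omega_degree_eq hb _; ring.
  exists j; split; first exact: omega_sign_degree.
  by apply: (omega_degree_eq (oder_degree hf hh hb)); ring.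
- by case=> /IHa ha /IHb hb.
- case=> j [hk ha]; exists j; split=> //.
  by apply: (dr_degree_eq (IHa _ ha)); ring.
Qed.

Lemma dr_leibniz_weight c (s : dr K v) n :
  (forall n y, order_eq n (val y) -> omega_weight (f y) (n + c)) ->
  (forall n y, order_eq n (val y) -> omega_weight (h y) (n + c)) ->
  dr_weight s n -> dr_weight (dr_leibniz e (oder e f h) s) (n + c).
Proof.
move=> hf hh; elim: s n => [a b|a IHa b IHb|k a IHa|] n //=.
- case=> m [m' [-> ha hb]]; split.
    by exists (m + c)%N, m'; split; [lia | exact: oder_weight |].
  by exists m, (m' + c)%N; split; [lia | exact: omega_sign_weight | exact: oder_weight].
- by case=> /IHa ha /IHb hb.
- exact: IHa.
Qed.
End Oder.

Lemma omega_d_form s p : omega_form s p -> omega_form (omega_d s) p.+1.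
Proof.
elim: s p => [y|w y|a IHa b IHb|a IHa b IHb|k a IHa|] p //=.
- by move=> ->.
- move=> ->; elim: w => [|a w IH] //=; split; first by exists 1%N, 1%N.
  by exists 0%N, 2%N.
- case=> m [n [-> ha hb]]; split.
    by exists m.+1, n; split=> //; apply: IHa.
  exists m, n.+1; split; [by rewrite addnS | exact: omega_sign_form | exact: IHb].
- by case=> /IHa ha /IHb hb.
- exact: IHa.
Qed.

Lemma dr_d_form (s : dr K v) p : dr_form s p -> dr_form (dr_leibniz 1 (@omega_d K r v) s) p.+1.
Proof.
elim: s p => [a b|a IHa b IHb|k a IHa|] p //=.
- case=> m [n [-> ha hb]]; split.
    by exists m.+1, n; split=> //; apply: omega_d_form.
  exists m, n.+1; split; [by rewrite addnS | exact: omega_sign_form | exact: omega_d_form].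
- by case=> /IHa ha /IHb hb.
- exact: IHa.
Qed.

(* A contraction inserts [OZero] next to factors of positive form degree, so it is
   not syntactically of form degree [p - 1]; it is equal to an expression that is. *)
Lemma con_omega_clean j (xi : g -> g) s p i : vector_field G j xi ->
  omega_form s p -> omega_degree G s i ->
  exists t, [/\ omega_form t p.-1, omega_degree G t (i + (j - 1)),
    forall N, ocls G N t = con_o j xi (ocls G N s) & p = 0%N -> t = OZero K v].
Proof.
move=> vx; elim: s p i => [y|w y|a IHa b IHb|a IHa b IHb|k a IHa|] p i /=.
- move=> -> _; exists (OZero K v); split=> // N.
  by rewrite -/(elt _ _ _) (con_elt _ vx).
- move=> ->; elim: w i => [|a w IH] i hy.
    exists (OElt (xi y)); split=> // [/=|N]; last by rewrite -/(dif _ _ _ _) (con_dif _ vx).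
    have [_ _ dx _] := vx; have := dx _ _ hy; congr (has_degree _ _ _ _).
    by rewrite wdeg0; ring.
  have [|t [ft dt et _]] := IH (i - (1 - v a)).
    by rewrite wdeg_cons in hy; move: hy; congr (has_degree _ _ _ _); ring.
  exists (OScale (sg K (1 - v a)) (OScale (sg K ((j - 1) * (1 - v a)))
    (OBr (OElt (flie_letter K v a)) t))).
  split=> [||N|//].
  + by exists 0%N, 0%N.
  + exists 0; split; first exact: gr_sg.
    exists 0; split; first exact: gr_sg.
    exists (1 - v a); split; first exact: has_degree_letter.
    by apply: omega_degree_eq dt _; ring.
  + rewrite !oclsZ oclsBr et -/(dif G N (a :: w) y) dif_cons.
    have der := con_der N vx.
    rewrite (linPZ (der_lin der)) (der_br der _ (elt_deg N (flie_letter_degree G v a))).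
    by rewrite (con_elt _ vx) (linP0 (lt_linl (omega_target G v N) _)) add0r.
- case=> m [n [-> fa fb]] [l [da db]].
  have [ta [fta dta eta za]] := IHa _ _ fa da; have [tb [ftb dtb etb zb]] := IHb _ _ fb db.
  have step N : con_o j xi (ocls G N (OBr a b)) =
      ocls G N (OBr ta b) + ocls G N (OBr (omega_sign (j - 1) a) tb).
    by rewrite oclsBr (is_der_par _ _ (con_der N vx)).1 -eta -etb -ocls_sign -!oclsBr.
  have d1 : omega_degree G (OBr ta b) (i + (j - 1)).
    by exists (l + (j - 1)); split=> //; apply: omega_degree_eq db _; ring.
  have d2 : omega_degree G (OBr (omega_sign (j - 1) a) tb) (i + (j - 1)).
    exists l; split; first exact: omega_sign_degree.
    by apply: omega_degree_eq dtb _; ring.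
  have z1 N : m = 0%N -> ocls G N (OBr ta b) = 0.
    by move=> /za ->; rewrite oclsBr ocls0 (linP0 (lt_linl (omega_target G v N) _)).
  have z2 N : n = 0%N -> ocls G N (OBr (omega_sign (j - 1) a) tb) = 0.
    by move=> /zb ->; rewrite oclsBr ocls0 (linP0 (lt_linr (omega_target G v N) _)).
  (* If [m = 0] the predecessor does not drop, and the term that contracts [a] could spoil the form
     degree. That term vanishes, so it is left out of the witness; likewise for [b] when [n = 0]. *)
  case: m n => [|m] [|n] in fa fb fta ftb za zb z1 z2 *.
  + by exists (OZero K v); split=> // N; rewrite step z1 // z2 // addr0.
  + exists (OBr (omega_sign (j - 1) a) tb); split=> // [|N].
      by exists 0%N, n; split=> //; apply: omega_sign_form.
    by rewrite step z1 // add0r.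
  + exists (OBr ta b); split=> // [|N].
      by exists m, 0%N.
    by rewrite step z2 // addr0.
  + exists (OAdd (OBr ta b) (OBr (omega_sign (j - 1) a) tb)); split=> // [|N].
      split; first by exists m, n.+1.
      by exists m.+1, n; split; [rewrite addnS | exact: omega_sign_form |].
    by rewrite step oclsD.
- case=> fa fb [da db].
  have [ta [fta dta eta za]] := IHa _ _ fa da; have [tb [ftb dtb etb zb]] := IHb _ _ fb db.
  case: p => [|p] in fa fb fta ftb za zb *.
    exists (OZero K v); split=> // N; rewrite oclsD (linPD (der_lin (con_der N vx))).
    by rewrite -eta -etb za // zb // addr0.
  exists (OAdd ta tb); split=> // N.
  by rewrite !oclsD (linPD (der_lin (con_der N vx))) eta etb.
- move=> fa [l [hk da]]; have [ta [fta dta eta za]] := IHa _ _ fa da.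
  case: p => [|p] in fa fta za *.
    exists (OZero K v); split=> // N; rewrite oclsZ (linPZ (der_lin (con_der N vx))).
    by rewrite -eta za // scaler0.
  exists (OScale k ta); split=> // [|N].
    by exists l; split=> //; apply: omega_degree_eq dta _; ring.
  by rewrite !oclsZ (linPZ (der_lin (con_der N vx))) eta.
- move=> _ _; exists (OZero K v); split=> // N.
  by rewrite ocls0 (linP0 (der_lin (con_der N vx))).
Qed.

Lemma con_dr_clean j (xi : g -> g) (s : dr K v) p i : vector_field G j xi ->
  dr_form s p -> dr_degree G s i ->
  exists t : dr K v, [/\ dr_form t p.-1, dr_degree G t (i + (j - 1)),
    forall N, dcls G N t = con_d j xi (dcls G N s) & p = 0%N -> t = DZero K v].
Proof.
move=> vx; elim: s p i => [a b|a IHa b IHb|k a IHa|] p i /=.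
- case=> m [n [-> fa fb]] [l [da db]].
  have [ta [fta dta eta za]] := con_omega_clean vx fa da.
  have [tb [ftb dtb etb zb]] := con_omega_clean vx fb db.
  have step N : con_d j xi (dcls G N (DTens a b)) =
      dcls G N (DTens ta b) + dcls G N (DTens (omega_sign (j - 1) a) tb).
    by rewrite dclsTens (is_der_par _ _ (con_der N vx)).2 -eta -etb -ocls_sign -!dclsTens.
  have d1 : dr_degree G (DTens ta b) (i + (j - 1)).
    by exists (l + (j - 1)); split=> //; apply: omega_degree_eq db _; ring.
  have d2 : dr_degree G (DTens (omega_sign (j - 1) a) tb) (i + (j - 1)).
    exists l; split; first exact: omega_sign_degree.
    by apply: omega_degree_eq dtb _; ring.
  have z1 N : m = 0%N -> dcls G N (DTens ta b) = 0.
    by move=> /za ->; rewrite dclsTens ocls0 (linP0 (dten_linl _)).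
  have z2 N : n = 0%N -> dcls G N (DTens (omega_sign (j - 1) a) tb) = 0.
    by move=> /zb ->; rewrite dclsTens ocls0 (linP0 (dten_linr _)).
  case: m n => [|m] [|n] in fa fb fta ftb za zb z1 z2 *.
  + by exists (DZero K v); split=> // N; rewrite step z1 // z2 // addr0.
  + exists (DTens (omega_sign (j - 1) a) tb); split=> // [|N].
      by exists 0%N, n; split=> //; apply: omega_sign_form.
    by rewrite step z1 // add0r.
  + exists (DTens ta b); split=> // [|N].
      by exists m, 0%N.
    by rewrite step z2 // addr0.
  + exists (DAdd (DTens ta b) (DTens (omega_sign (j - 1) a) tb)); split=> // [|N].
      split; first by exists m, n.+1.
      by exists m.+1, n; split; [rewrite addnS | exact: omega_sign_form |].
    by rewrite step dclsD.
- case=> fa fb [da db].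
  have [ta [fta dta eta za]] := IHa _ _ fa da; have [tb [ftb dtb etb zb]] := IHb _ _ fb db.
  case: p => [|p] in fa fb fta ftb za zb *.
    exists (DZero K v); split=> // N; rewrite dclsD (linPD (der_lin' (con_der N vx))).
    by rewrite -eta -etb za // zb // addr0.
  exists (DAdd ta tb); split=> // N.
  by rewrite !dclsD (linPD (der_lin' (con_der N vx))) eta etb.
- move=> fa [l [hk da]]; have [ta [fta dta eta za]] := IHa _ _ fa da.
  case: p => [|p] in fa fta za *.
    exists (DZero K v); split=> // N; rewrite dclsZ (linPZ (der_lin' (con_der N vx))).
    by rewrite -eta za // scaler0.
  exists (DScale k ta); split=> // [|N].
    by exists l; split=> //; apply: dr_degree_eq dta _; ring.
  by rewrite !dclsZ (linPZ (der_lin' (con_der N vx))) eta.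
- move=> _ _; exists (DZero K v); split=> // N.
  by rewrite dcls0 (linP0 (der_lin' (con_der N vx))).
Qed.
End Syntax.

(** * Symplectic forms *)

Section Forms.
Variables (K : comAlgType rat) (G : even_grading K) (r : nat) (v : 'I_r -> int).
Local Notation g := (free_lie K v).
Implicit Types (al be : Defs.form K v) (y : g) (i j k : int).

Lemma form_eqP al be :
  form_eq G al be <-> forall N, dcls G N (al N) = dcls G N (be N).
Proof.
by split=> h N; [apply: dcls_eq; exact: h | apply: dcls_inj; exact: h].
Qed.

Lemma dcls_d (s : dr K v) N :
  dcls G N (dr_leibniz 1 (@omega_d K r v) s) = ext_d (dcls G N s).
Proof. exact: esym (dopE (ext_data G v N) _). Qed.

Lemma dcls_form_d al N : dcls G N (form_d al N) = ext_d (dcls G N (al N)).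
Proof. exact: esym (dopE (ext_data G v N) _). Qed.

Lemma dcls_form_L j (xi : g -> g) al N : vector_field G j xi ->
  dcls G N (form_L j xi al N) = lie_d j xi (dcls G N (al N)).
Proof. by move=> vx; exact: esym (dopE (lie_data N vx) _). Qed.

Lemma dcls_form_i j (xi : g -> g) al N : vector_field G j xi ->
  dcls G N (form_i j xi al N) = con_d j xi (dcls G N (al N)).
Proof. by move=> vx; exact: esym (dopE (con_data N vx) _). Qed.

Lemma is_form_scale p j (c : K) al :
  gr G 0 c -> is_form G p j al -> is_form G p j (form_scale c al).
Proof.
move=> hk h N; have [f d e] := h N; split=> //; last exact: de_scale.
by exists 0; rewrite subr0.
Qed.

Lemma is_form_d p j al : is_form G p j al -> is_form G p.+1 j (form_d al).
Proof.
move=> h N; have [f d e] := h N; split.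
- exact: dr_d_form.
- have := @dr_leibniz_degree _ G _ _ 1 (ODiff [::]) (fun=> OZero K v) _ _ _ _ d.
  move/(_ _ _)/(dr_degree_eq); apply=> //; last by rewrite -addn1 PoszD addrA.
  by move=> i y hy /=; rewrite addrK wdeg0 subr0.
- by apply: dcls_inj; rewrite /form_d !dcls_d (dcls_eq e).
Qed.

Lemma form_orderP p n al : form_order G p n al ->
  forall N, lie_d 0 (@euler K r v) (dcls G N (al N)) = (n + p)%:R *: dcls G N (al N).
Proof.
by move=> h N; have [s [ws /(dcls_eq) ->]] := h N; apply: euler_weight.
Qed.

(** [form_i] need not be syntactically of form degree [p], so a cleaned representative is chosen for
    each truncation. It represents the contraction in every quotient at once, which gives the
    compatibility of successive truncations. *)
Lemma is_form_con p j k (xi : g -> g) al : vector_field G j xi -> is_form G p.+1 k al ->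
  exists2 be, is_form G p (k + j) be &
    forall N, dcls G N (be N) = con_d j xi (dcls G N (al N)).
Proof.
move=> vx h.
have ex N : exists t : dr K v, [/\ dr_form t p, dr_degree G t (k + j + p%:Z) &
    forall M, dcls G M t = con_d j xi (dcls G M (al N))].
  have [f d e] := h N; have [t [ft dt et _]] := con_dr_clean vx f d.
  by exists t; split=> //; apply: dr_degree_eq dt _; rewrite -addn1 PoszD; ring.
exists (fun N => sval (cid (ex N))) => [N|N]; last by case: cid => t [_ _ et] /=.
case: cid => t [ft dt et]; case: cid => t' [ft' dt' et'] /=; split=> //.
apply: dcls_inj; rewrite et et'; congr con_d.
by have [_ _ e] := h N; apply: dcls_eq.
Qed.

Lemma vector_field_lin j c (xi eta : g -> g) : gr G 0 c ->
  vector_field G j xi -> vector_field G j eta -> vector_field G j (fun y => c *: xi y + eta y).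
Proof.
move=> hc vx vy; have [lx cx dx bx] := vx; have [ly cy dy b_y] := vy; split.
- by move=> k a b; rewrite lx ly; module_coefs K; ring.
- move=> n; exists n => y hy; apply: val_order_geD.
  + exact: (vector_field_filtered vx).
  + exact: (vector_field_filtered vy).
- move=> i y hy; apply: has_degreeD; last exact: dy.
  by apply: has_degreeZ0 => //; apply: dx.
- move=> i y z hy; rewrite (bx _ _ _ hy) (b_y _ _ _ hy).
  have bl (a : g) : linear (fun b => flie_br b a) by move=> ? ? ?; apply: flie_br_linearl.
  have br (a : g) : linear (flie_br a) by move=> ? ? ?; apply: flie_br_linearr.
  by rewrite (bl _) (br _); module_coefs K; ring.
Qed.

Lemma vector_field0 j : vector_field G j (fun=> 0 : g).
Proof.
split=> [k a b|n|i y _|i y z _].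
- by rewrite scaler0 addr0.
- by exists n.
- exact: has_degree0.
- have bl (a : g) : linear (fun b => flie_br b a) by move=> ? ? ?; apply: flie_br_linearl.
  have br (a : g) : linear (flie_br a) by move=> ? ? ?; apply: flie_br_linearr.
  by rewrite (linP0 (bl _)) (linP0 (br _)) scaler0 addr0.
Qed.

Lemma vector_fieldZ j c (xi : g -> g) : gr G 0 c ->
  vector_field G j xi -> vector_field G j (fun y => c *: xi y).
Proof.
move=> hc vx; have := vector_field_lin hc vx (vector_field0 j).
by congr vector_field; apply/funext => y; rewrite addr0.
Qed.

Lemma con_lin j c (xi eta : g -> g) N x : gr G 0 c ->
  vector_field G j xi -> vector_field G j eta ->
  con_d j (fun y => c *: xi y + eta y) x = c *: con_d j xi x + con_d j eta x :> drq G v N.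
Proof.
move=> hc vx vy; have vl := vector_field_lin hc vx vy.
have [||_ ->] // := is_der_uniq (con_der N vl) (is_der_lin hc (con_der N vx) (con_der N vy)).
- by move=> y; rewrite (con_elt _ vl) (con_elt _ vx) (con_elt _ vy) scaler0 addr0.
- by move=> y; rewrite (con_dif _ vl) (con_dif _ vx) (con_dif _ vy) (elt_lin _ _).
Qed.

Lemma con_zero j N x : con_d j (fun=> 0 : g) x = 0 :> drq G v N.
Proof.
have v0 := vector_field0 j; have := con_lin x (gr_one G) v0 v0.
have -> : (fun y : g => 1 *: (0 : g) + 0 : g) = (fun=> 0).
  by apply/funext => y; rewrite scaler0 addr0.
by rewrite scale1r => /esym/(canRL (addrK _)); rewrite subrr.
Qed.

Lemma con_scale j c (xi : g -> g) N x : gr G 0 c -> vector_field G j xi ->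
  con_d j (fun y => c *: xi y) x = c *: con_d j xi x :> drq G v N.
Proof.
move=> hc vx; have := con_lin x hc vx (vector_field0 j).
rewrite con_zero addr0 => <-; congr (con_d _ _ x).
by apply/funext => y; rewrite addr0.
Qed.

Lemma lie_lin j c (xi eta : g -> g) N x : gr G 0 c ->
  vector_field G j xi -> vector_field G j eta ->
  lie_d j (fun y => c *: xi y + eta y) x = c *: lie_d j xi x + lie_d j eta x :> drq G v N.
Proof.
move=> hc vx vy; have vl := vector_field_lin hc vx vy.
rewrite !(cartan vl, cartan vx, cartan vy) !(con_lin _ hc vx vy).
by rewrite (der_lin' (ext_der _ _ _) _ _ _); module_coefs K; ring.
Qed.
End Forms.

Section Symplectic.
Variables (K : comAlgType rat) (G : even_grading K) (r : nat) (v : 'I_r -> int).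
Local Notation g := (free_lie K v).
Variables (om : Defs.form K v) (e : int).
Hypotheses (som : symplectic_form G e om) (oom : form_order G 2 0 om).
Local Notation x N := (dcls G N (om N)).

Lemma ext_om N : ext_d (x N) = 0.
Proof. by case: som => _ /form_eqP /(_ N); rewrite dcls_form_d. Qed.

Lemma con_inj j (xi eta : g -> g) : vector_field G j xi -> vector_field G j eta ->
  (forall N, con_d j xi (x N) = con_d j eta (x N)) -> xi = eta.
Proof.
move=> vx vy h; case: som => _ _ inj _; apply: (inj j) => //.
by apply/form_eqP => N; rewrite !dcls_form_i.
Qed.

Lemma symplecticP j (xi : g -> g) : symplectic_field G om j xi <->
  vector_field G j xi /\ forall N, lie_d j xi (x N) = 0.
Proof.
split=> -[vx h]; split=> //.
  by move=> N; have /form_eqP /(_ N) := h; rewrite dcls_form_L.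
by apply/form_eqP => N; rewrite dcls_form_L.
Qed.

Lemma symplectic_lin j c (xi eta : g -> g) : gr G 0 c ->
  symplectic_field G om j xi -> symplectic_field G om j eta ->
  symplectic_field G om j (fun y => c *: xi y + eta y).
Proof.
move=> hc /symplecticP[vx hx] /symplecticP[vy hy]; apply/symplecticP; split.
  exact: vector_field_lin.
by move=> N; rewrite lie_lin // hx hy scaler0 addr0.
Qed.

Lemma symplectic_of_closed j (xi : g -> g) : vector_field G j xi ->
  (forall N, ext_d (con_d j xi (x N)) = 0) -> symplectic_field G om j xi.
Proof.
move=> vx h; apply/symplecticP; split=> // N.
by rewrite cartan // h ext_om (linP0 (der_lin' (con_der N vx))) scaler0 addr0.
Qed.

Lemma closed_of_symplectic j (xi : g -> g) N : symplectic_field G om j xi ->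
  ext_d (con_d j xi (x N)) = 0.
Proof.
move=> /symplecticP[vx /(_ N)]; rewrite cartan // ext_om (linP0 (der_lin' (con_der N vx))) add0r.
move/(congr1 ( *:%R (sg K j))); rewrite scaler0 scalerA -sgD sgE oddzD addbb scale1r //.
Qed.

Lemma Upsilon_spec j k (al : Defs.form K v) : k = j + e -> is_form G 0 k al ->
  vector_field G j (Upsilon G om e k al) /\
  forall N, con_d j (Upsilon G om e k al) (x N) = sg K k *: ext_d (dcls G N (al N)).
Proof.
move=> ek h; have hd := is_form_d h; rewrite ek in hd.
case: som => _ _ _ /(_ j _ hd)[xi vx ex].
(* [Phi_inv] falls back to [0] when no field is found; surjectivity of [Phi] excludes this. *)
have [vy ey] : vector_field G j (Phi_inv G om j (form_d al)) /\
    form_eq G (form_i j (Phi_inv G om j (form_d al)) om) (form_d al).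
  exact: (@xgetPex _ (fun=> 0) (fun xi => vector_field G j xi /\
    form_eq G (form_i j xi om) (form_d al)) (ex_intro _ xi (conj vx ex))).
rewrite /Upsilon (_ : k - e = j); last by rewrite ek addrK.
split; first by apply: vector_fieldZ => //; apply: gr_sg.
move=> N; rewrite con_scale //; last exact: gr_sg.
by move/form_eqP/(_ N): ey; rewrite dcls_form_i // dcls_form_d => ->.
Qed.

Lemma Upsilon_symplectic j k (al : Defs.form K v) : k = j + e -> is_form G 0 k al ->
  symplectic_field G om j (Upsilon G om e k al).
Proof.
move=> ek h; have [vx ex] := Upsilon_spec ek h; apply: symplectic_of_closed => // N.
by rewrite ex (linPZ (der_lin' (ext_der _ _ _))) ext_sq scaler0.
Qed.

(* The Euler field acts on forms of tensor degree [n] by [n], so that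
   [con (bracket euler xi) om = c * con xi om] with [c] the excess of the tensor
   degree of [con xi om] over that of [om]. *)
Lemma order_of_con j c (xi : g -> g) : vector_field G j xi ->
  (forall N, lie_d 0 (@euler K r v) (con_d j xi (x N)) = (c + 2)%:R *: con_d j xi (x N)) ->
  endo_order c.+1 xi.
Proof.
move=> vx h; have ve := euler_field G v.
have vb := bracket_vector_field ve vx.
have eb : bracket 0 j (@euler K r v) xi = (fun y => c%:R *: xi y).
  rewrite add0r in vb; apply: (con_inj vb) => [|N].
    by apply: vector_fieldZ => //; apply: gr_nat.
  rewrite con_scale //; last exact: gr_nat.
  have := con_bracket ve vx (x N); rewrite add0r => ->.
  rewrite h (form_orderP oom) (linPZ (der_lin' (con_der N vx))) mul0r sgE /= add0n natrD.
  by module_coefs K; ring.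
move=> a y hy w; rewrite addnS /= => ne.
have [lx _ _ _] := vx.
have := congr1 (fun f => val (f y) w) eb; rewrite /bracket (euler_order_eq hy) (linPZ lx).
rewrite valB euler_val !valZ mul0r sgE /= mul1r => E.
have {}E : ((size w)%:R - (a + c)%:R) * val (xi y) w = 0.
  rewrite natrD.
  transitivity ((size w)%:R * val (xi y) w - a%:R * val (xi y) w - c%:R * val (xi y) w).
    by ring.
  by rewrite E subrr.
(* By [E] the coefficient at [w] is killed by the integer [size w - (a + c)], nonzero away from
   order [a + c]. Natural subtraction forces a case for each sign. *)
have cancel_nat p (z : K) : p.+1%:R * z = 0 -> z = 0.
  by have [q eq] := nat_inv K p; move/(congr1 ( *%R q)); rewrite mulrA eq mul1r mulr0.
have [lt|gt|eq] := ltngtP (size w) (a + c)%N; last by rewrite eq eqxx in ne.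
  apply: (cancel_nat (a + c - size w).-1).
  have -> : (a + c - size w).-1.+1 = (a + c - size w)%N by lia.
  by rewrite natrB; [rewrite -opprB mulNr E oppr0 | lia].
apply: (cancel_nat (size w - (a + c)).-1).
have -> : (size w - (a + c)).-1.+1 = (size w - (a + c))%N by lia.
by rewrite natrB // ltnW.
Qed.
End Symplectic.

(** * The Poincare lemma *)

Section Poincare.
Variables (K : comAlgType rat) (G : even_grading K) (r : nat) (v : 'I_r -> int).
Local Notation g := (free_lie K v).
Local Notation eul := (@euler K r v).
Local Notation veul := (euler_field G v).

Lemma omega_L_form j (xi : g -> g) (s : omega K v) p :
  omega_form s p -> omega_form (omega_L j xi s) p.
Proof.
elim: s p => [y|w y|a IHa b IHb|a IHa b IHb|k a IHa|] p //=.
- move=> ->; elim: w => [|a w IH] //=; split; first by exists 0%N, 1%N.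
  by exists 0%N, 1%N.
- case=> m [n [-> ha hb]]; split.
    by exists m, n; split=> //; apply: IHa.
  by exists m, n; split; [|exact: omega_sign_form | exact: IHb].
- by case=> /IHa ha /IHb hb.
- exact: IHa.
Qed.

Lemma dr_L_form j (xi : g -> g) (s : dr K v) p :
  dr_form s p -> dr_form (dr_leibniz j (omega_L j xi) s) p.
Proof.
elim: s p => [a b|a IHa b IHb|k a IHa|] p //=.
- case=> m [n [-> ha hb]]; split.
    by exists m, n; split=> //; apply: omega_L_form.
  exists m, n; split=> //; [exact: omega_sign_form | exact: omega_L_form].
- by case=> /IHa ha /IHb hb.
- exact: IHa.
Qed.

Lemma is_form_L p j k (xi : g -> g) (al : Defs.form K v) : vector_field G j xi ->
  is_form G p k al -> is_form G p (k + j) (form_L j xi al).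
Proof.
move=> vx h N; have [f d e] := h N; have [_ _ dx _] := vx; split.
- exact: dr_L_form.
- apply: (@dr_degree_eq _ _ _ _ _ (k + p%:Z + j)); last by ring.
  apply: dr_leibniz_degree d => i y hy /=; first exact: dx.
  exists 0; split; first exact: gr_sg.
  by have := dx _ _ hy; congr (has_degree _ _ _ _); rewrite wdeg0; ring.
- apply: dcls_inj; rewrite /form_L.
  by rewrite -!(dopE (lie_data N vx)) (dcls_eq e).
Qed.

Lemma endo_order_succ c (xi : g -> g) n y : endo_order c.+1 xi ->
  order_eq n (val y) -> order_eq (n + c) (val (xi y)).
Proof. by move=> h hy; have := h n y hy; rewrite addnS. Qed.

Lemma form_order_L p n c j (xi : g -> g) (al : Defs.form K v) : vector_field G j xi ->
  endo_order c.+1 xi -> form_order G p n al -> form_order G p (n + c) (form_L j xi al).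
Proof.
move=> vx ox h N; have [s [ws es]] := h N.
exists (dr_leibniz j (omega_L j xi) s); split.
  rewrite -addnA [(c + p)%N]addnC addnA; apply: dr_leibniz_weight ws => m y hy /=.
    exact: endo_order_succ.
  by exists (m + c)%N; split=> //; apply: endo_order_succ.
apply: dcls_inj; rewrite /form_L -!(dopE (lie_data N vx)).
by rewrite (dcls_eq es).
Qed.

Lemma con_form0 j k (xi : g -> g) (al : Defs.form K v) N : vector_field G j xi ->
  is_form G 0 k al -> con_d j xi (dcls G N (al N)) = 0.
Proof.
move=> vx h; have [f d _] := h N.
by have [t [_ _ <- ->]] := con_dr_clean vx f d.
Qed.

(** [i_E] kills 0-forms, so [L_E = i_E d] on them. A closed 0-form is therefore annihilated by its
    order, a positive integer and hence invertible. *)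
Lemma ext_form0_inj k n (al : Defs.form K v) : is_form G 0 k al -> form_order G 0 n.+1 al ->
  (forall N, ext_d (dcls G N (al N)) = 0) -> form_eq G al (form_zero K v).
Proof.
move=> h o e; apply/form_eqP => N; rewrite dcls0.
have := form_orderP o N; rewrite (cartan veul) e (con_form0 N veul h).
rewrite (linP0 (der_lin' (con_der N veul))) (linP0 (der_lin' (ext_der G v N))) scaler0 addr0 addn0.
by move/esym/(@natr_scale_eq0 K).
Qed.

Lemma order_ext k n (al : Defs.form K v) N : is_form G 0 k al -> form_order G 0 n al ->
  lie_d 0 eul (ext_d (dcls G N (al N))) = n%:R *: ext_d (dcls G N (al N)).
Proof.
move=> h o; rewrite (lie_ext veul) sgE scale1r (form_orderP o) addn0.
by rewrite (linPZ (der_lin' (ext_der G v N))).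
Qed.

Variables (om : Defs.form K v) (e : int).
Hypotheses (som : symplectic_form G e om) (oom : form_order G 2 0 om).
Local Notation x N := (dcls G N (om N)).

Lemma Upsilon_order j k n (al : Defs.form K v) : k = j + e -> is_form G 0 k al ->
  form_order G 0 n.+2 al -> endo_order n.+1 (Upsilon G om e k al).
Proof.
move=> ek h o; have [vx ex] := Upsilon_spec som ek h.
apply: (order_of_con som oom vx) => N.
by rewrite ex (linPZ (der_lin' (lie_der N veul))) (order_ext N h o) addn2 scalerA mulrC -scalerA.
Qed.

Lemma Upsilon_surj j k c (xi : g -> g) : k = j + e -> symplectic_field G om j xi ->
  endo_order c.+1 xi -> exists al, [/\ is_form G 0 k al, form_order G 0 c.+2 al &
    Upsilon G om e k al = xi].
Proof.
move=> ek sx ox; have [vx _] := sx.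
have [f2 _ _ _] := som; have [be fbe ebe] := is_form_con vx f2.
have [ga fga ega] := is_form_con veul fbe.
(* [q] inverts [c + 2], the tensor degree of [i_xi om]. This 1-form is closed, so
   [d i_E i_xi om = (c + 2) i_xi om]; the factor [sg K k] cancels the sign in [Upsilon]. *)
have [q hq eq] := gr_nat_inv G c.+1.
have hs : gr G 0 (q * sg K k) by rewrite -[0]addr0; apply: gr_mul => //; apply: gr_sg.
pose al := form_scale (q * sg K k) ga.
have fal : is_form G 0 k al.
  by apply: is_form_scale => //; rewrite ek addrC -[e + j]addr0.
have eal N : ext_d (dcls G N (al N)) = sg K k *: con_d j xi (x N).
  rewrite dclsZ ega (linPZ (der_lin' (ext_der G v N))) ebe.
  have := cartan veul (con_d j xi (x N)); rewrite (closed_of_symplectic som N sx).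
  rewrite (linP0 (der_lin' (con_der N veul))) add0r sgE scale1r => <-.
  have [s [ws es]] := oom N.
  have w : dr_weight (dr_leibniz (j - 1) (omega_i j xi) s) (2 + c).
    apply: dr_leibniz_weight ws => // m y hy /=; exact: endo_order_succ.
  have -> : con_d j xi (x N) = dcls G N (dr_leibniz (j - 1) (omega_i j xi) s).
    by rewrite (dcls_eq es) -(dopE (con_data N vx)).
  rewrite (euler_weight G N w) !scalerA; congr (_ *: _).
  by rewrite mulrAC add2n eq mul1r.
exists al; split=> //.
  (* The form [ga] was chosen for its form degree, and no tensor degree is known for its
     representatives. The literal double contraction of a homogeneous representative of [om] has the
     right tensor degree, since [i_E] preserves it. *)
  move=> N; have [s [ws es]] := oom N.
  pose t := dr_leibniz (0 - 1) (omega_i 0 eul) (dr_leibniz (j - 1) (omega_i j xi) s).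
  exists (DScale (q * sg K k) t); split.
    rewrite /= addn0 -[c.+2]/(2 + c)%N -[(2 + c)%N]addn0.
    apply: dr_leibniz_weight => //.
      by move=> m y hy /=; rewrite ?addn0 => w ne; rewrite /euler_series hy ?mulr0.
    apply: dr_leibniz_weight ws => // m y hy /=; exact: endo_order_succ.
  apply: dcls_inj; rewrite !dclsZ ega ebe (dcls_eq es).
  by rewrite -(dopE (con_data N veul)) -(dopE (con_data N vx)).
have [vu eu] := Upsilon_spec som ek fal.
apply: (con_inj som vu vx) => N; rewrite eu eal scalerA -sgD sgE oddzD addbb scale1r //.
Qed.
End Poincare.

(** * Exponentials *)

Section Convolution.
Variables (K : comAlgType rat) (G : even_grading K).

Definition nat_inv_of n : K := s2val (cid2 (gr_nat_inv G n)).
Lemma nat_inv_ofE n : nat_inv_of n * n.+1%:R = 1.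
Proof. exact: s2valP' (cid2 (gr_nat_inv G n)). Qed.
Lemma gr_nat_inv_of n : gr G 0 (nat_inv_of n).
Proof. exact: s2valP (cid2 (gr_nat_inv G n)). Qed.

Section Conv.
Variable M : lmodType K.
Implicit Types F : nat -> nat -> M.

Definition conv F k : M := \sum_(i < k.+1) F i (k - i)%N.

(** Derivative of a Cauchy product: [k + 1 = i + (k + 1 - i)] is split over the two indices of each
    term. Induction on this identity replaces computations with factorials. *)
Lemma conv_succ F (P Q : nat -> nat -> M) k :
  (forall i j, i.+1%:R *: F i.+1 j = P i j) ->
  (forall i j, j.+1%:R *: F i j.+1 = Q i j) ->
  k.+1%:R *: conv F k.+1 = conv (fun i j => P i j + Q i j) k.
Proof.
move=> hP hQ; rewrite /conv scaler_sumr big_split /=.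
transitivity (\sum_(i < k.+2) i%:R *: F i (k.+1 - i)%N
  + \sum_(i < k.+2) (k.+1 - i)%:R *: F i (k.+1 - i)%N).
  rewrite -big_split; apply: eq_bigr => i _ /=.
  by rewrite -scalerDl -natrD subnKC // -ltnS.
congr (_ + _).
  rewrite big_ord_recl /= scale0r add0r; apply: eq_bigr => i _.
  by rewrite /bump /= add1n hP subSS.
rewrite big_ord_recr /= subnn scale0r addr0; apply: eq_bigr => i _.
by rewrite subSn ?hQ // -ltnS.
Qed.

(** A square of indices is the triangle [i + j < n], cut along its diagonals, plus the corner
    [i + j >= n]. In a product of truncated exponentials the corner has high order. *)
Lemma conv_square F n :
  \sum_(i < n) \sum_(j < n) F i j =
  \sum_(k < n) conv F k + \sum_(i < n) \sum_(n - i <= j < n) F i j.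
Proof.
have -> : \sum_(k < n) conv F k = \sum_(i < n) \sum_(0 <= j < n - i) F i j.
  elim: n => [|n IH]; first by rewrite !big_ord0.
  rewrite big_ord_recr /= IH.
  transitivity (\sum_(i < n.+1) (\sum_(0 <= j < n - i) F i j + F i (n - i)%N)).
    rewrite big_split /= big_ord_recr /= subnn big_nil addr0 //.
  by apply: eq_bigr => i _; rewrite subSn ?big_nat_recr //= -ltnS.
rewrite -big_split; apply: eq_bigr => i _ /=.
by rewrite -big_cat_nat ?leq_subr //= big_mkord.
Qed.

Variables (D : M -> M) (lD : linear D).

(** The divided power [D^k / k!]. The inverses are homogeneous of degree [0], so that [dpow]
    preserves degrees when [D] does. *)
Fixpoint dpow k (x : M) : M := if k is n.+1 then nat_inv_of n *: D (dpow n x) else x.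

Lemma dpow_succ k x : k.+1%:R *: dpow k.+1 x = D (dpow k x).
Proof. by rewrite /= scalerA mulrC nat_inv_ofE scale1r. Qed.

Lemma dpow_lin k : linear (dpow k).
Proof.
elim: k => [|k IH] c x y //=; rewrite IH lD scalerDr !scalerA mulrC //.
Qed.

Lemma dpow_comm k x : D (dpow k x) = dpow k (D x).
Proof. by elim: k => //= k IH; rewrite (linPZ lD) IH. Qed.

Lemma dpow_zero k x : D x = 0 -> dpow k.+1 x = 0.
Proof.
move=> h; elim: k => [|k IH]; first by rewrite /= h scaler0.
by rewrite [dpow _ _]/= -/(dpow k.+1 x) IH (linP0 lD) scaler0.
Qed.

Lemma natr_scale_inj n (x y : M) : n.+1%:R *: x = n.+1%:R *: y -> x = y.
Proof.
move=> h; apply/eqP; rewrite -subr_eq0; apply/eqP/(@natr_scale_eq0 K n).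
by rewrite scalerBr h subrr.
Qed.
End Conv.

Lemma dpow_bilinear (U1 U2 W : lmodType K) (B : U1 -> U2 -> W)
    (D1 : U1 -> U1) (D2 : U2 -> U2) (D : W -> W) x y k :
  (forall c, linear (B^~ c)) -> (forall c, linear (B c)) ->
  linear D -> (forall a b, D (B a b) = B (D1 a) b + B a (D2 b)) ->
  dpow D k (B x y) = conv (fun i j => B (dpow D1 i x) (dpow D2 j y)) k.
Proof.
move=> bl br lD h; elim: k => [|k IH]; first by rewrite /conv big_ord1.
apply: (@natr_scale_inj _ k); rewrite dpow_succ IH {1}/conv (linPsum lD).
rewrite (@conv_succ _ _ (fun i j => B (D1 (dpow D1 i x)) (dpow D2 j y))
  (fun i j => B (dpow D1 i x) (D2 (dpow D2 j y)))) => [|i j|i j].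
- by apply: eq_bigr => i _; rewrite h.
- by rewrite -(linPZ (bl _)) dpow_succ.
- by rewrite -(linPZ (br _)) dpow_succ.
Qed.

(** The component of index [k + 1] of [exp D exp (- D) = 1]: multiplied by [k + 1] it becomes a sum
    in which the two Leibniz terms cancel. *)
Lemma dpow_opp (M : lmodType K) (D D' : M -> M) x k :
  linear D -> linear D' -> (forall a, D' a = - D a) ->
  conv (fun i j => dpow D i (dpow D' j x)) k.+1 = 0.
Proof.
move=> lD lD' h; apply: (@natr_scale_inj _ k); rewrite scaler0.
rewrite (@conv_succ _ _ (fun i j => D (dpow D i (dpow D' j x)))
  (fun i j => dpow D i (D' (dpow D' j x)))) => [|i j|i j].
- apply: big1 => i _; rewrite h (linPN (dpow_lin lD _)) dpow_comm // subrr //.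
- exact: dpow_succ.
- by rewrite -(linPZ (dpow_lin lD _)) dpow_succ.
Qed.
End Convolution.

Section Exponential.
Variables (K : comAlgType rat) (G : even_grading K) (r : nat) (v : 'I_r -> int).
Local Notation g := (free_lie K v).
Local Notation dpow := (dpow G).

(** Membership in [(c + 1)], with the shift written additively: it avoids the predecessor in
    [endo_order_ge], and shifts add under composition. *)
Definition raises c (f : g -> g) :=
  forall n y, order_ge n (val y) -> order_ge (n + c) (val (f y)).

Section Exp.
Variables (xi : g -> g).
Hypotheses (vx : vector_field G 0 xi) (rx : raises 1 xi).
Let lx : linear xi. Proof. by case: vx. Qed.

Lemma val_sum_ge n (I : Type) (s : seq I) (P : pred I) (F : I -> g) :
  (forall i, P i -> order_ge n (val (F i))) -> order_ge n (val (\sum_(i <- s | P i) F i)).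
Proof. by move=> h w lt; rewrite val_sum big1 // => i Pi; apply: h. Qed.

Lemma dpow_order k n y : order_ge n (val y) -> order_ge (n + k) (val (dpow xi k y)).
Proof.
move=> hy; elim: k => [|k IH]; first by rewrite addn0.
by move=> w lt; rewrite [dpow _ _ _]/= valZ (rx IH) ?mulr0 //; lia.
Qed.

Lemma dpow_degree k i y : has_degree G v i (val y) -> has_degree G v i (val (dpow xi k y)).
Proof.
move=> hy; elim: k => //= k IH; apply: has_degreeZ0; first exact: gr_nat_inv_of.
by case: vx => _ _ dx _; rewrite -[i]addr0; apply: dx.
Qed.

Definition exp_trunc n (y : g) : g := \sum_(k < n) dpow xi k y.

(** The exponential is given coefficient by coefficient. Every element of [g] has order at least
    [1], so the [k]-th term starts in order [k + 1] and the terms with [k >= size w] vanish at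
    [w]. *)
Definition exp_series (y : g) : series K r := fun w => val (exp_trunc (size w) y) w.

Lemma exp_trunc_val n y w : (size w <= n)%N -> val (exp_trunc n y) w = exp_series y w.
Proof.
move=> le; rewrite /exp_series /exp_trunc !val_sum -!(big_mkord xpredT (fun k => val (dpow xi k y) w)).
rewrite (big_cat_nat (leq0n _) le) /= [X in _ + X]big_nat_cond [X in _ + X]big1 ?addr0 // => k.
by rewrite andbT => /andP[h _]; have /(_ w) := dpow_order (k := k) (lie_order1 y); apply; lia.
Qed.

Lemma exp_subproof y : exp_series y \in lie_series v.
Proof.
apply/asboolP => n; have := asboolW (valP (exp_trunc n y)) n.
congr lie_poly; apply/funext => w; rewrite /spart; case: eqP => // <-.
by rewrite exp_trunc_val.
Qed.

Definition lie_exp (y : g) : g := exist _ (exp_series y) (exp_subproof y).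

Lemma lie_exp_val y w : val (lie_exp y) w = val (exp_trunc (size w) y) w.
Proof. by []. Qed.

Lemma lie_exp_trunc n y : order_ge n.+1 (val (lie_exp y - exp_trunc n y)).
Proof. by move=> w lt; rewrite valB exp_trunc_val // subrr. Qed.

Lemma exp_trunc_lin n : linear (exp_trunc n).
Proof.
move=> k y z; rewrite /exp_trunc scaler_sumr -big_split; apply: eq_bigr => i _ /=.
exact: dpow_lin.
Qed.

Lemma lie_exp_lin : linear lie_exp.
Proof.
move=> k y z; apply: val_inj; apply/funext => w; rewrite valD valZ.
by rewrite !lie_exp_val exp_trunc_lin valD valZ.
Qed.

Lemma exp_trunc_order m n y : order_ge m (val y) -> order_ge m (val (exp_trunc n y)).
Proof.
by move=> hy; apply: val_sum_ge => k _; apply: order_geW (dpow_order (k := k) hy); apply: leq_addr.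
Qed.

Lemma lie_exp_order m y : order_ge m (val y) -> order_ge m (val (lie_exp y)).
Proof. by move=> hy w lt; rewrite lie_exp_val (exp_trunc_order _ hy). Qed.

Lemma lie_exp_degree i y : has_degree G v i (val y) -> has_degree G v i (val (lie_exp y)).
Proof.
move=> hy w; rewrite /= /exp_series /exp_trunc val_sum; apply: gr_bigsum => k _.
exact: dpow_degree.
Qed.

Lemma val_order_tri n (a b c : g) : order_ge n (val (a - b)) -> order_ge n (val (b - c)) ->
  order_ge n (val (a - c)).
Proof.
move=> h1 h2 w lt; have := h1 w lt; have := h2 w lt; rewrite !valB => e2 e1.
by rewrite -(addrNK (val b w) (val a w)) -addrA e1 add0r.
Qed.

Lemma val_order_opp n (a b : g) : order_ge n (val (a - b)) -> order_ge n (val (b - a)).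
Proof. by move=> h w lt; rewrite -opprB valN h // oppr0. Qed.

Let brl c : linear (fun a : g => flie_br a c). Proof. by move=> ? ? ?; apply: flie_br_linearl. Qed.
Let brr c : linear (fun a : g => flie_br c a). Proof. by move=> ? ? ?; apply: flie_br_linearr. Qed.

Lemma vector_field0_br y z : xi (flie_br y z) = flie_br (xi y) z + flie_br y (xi z).
Proof.
have fx := vector_field_filtered vx.
have [_ _ _ bx] := vx.
apply: (@eq_on_lie_mono K r v (fun y => xi (flie_br y z))
  (fun y => flie_br (xi y) z + flie_br y (xi z))) => [k a b|k a b|n a h|n a h|n i a m].
- by rewrite brl lx.
- by rewrite lx !(brl _ _ _); module_coefs K; ring.
- by apply: fx; rewrite -[n]addn0; apply: order_ge_sbr.
- rewrite -[X in X + _]scale1r; apply: val_order_geD; rewrite -[n]addn0; apply: order_ge_sbr => //.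
  by apply: fx.
- by rewrite (bx i) ?mul0r ?sgE ?scale1r //; apply: lie_mono_degree m.
Qed.

Lemma lie_exp_br y z : lie_exp (flie_br y z) = flie_br (lie_exp y) (lie_exp z).
Proof.
apply: lie_eq => N.
apply: (@val_order_tri _ _ (exp_trunc N (flie_br y z))).
  by exact: order_geW (leqnSn N) (@lie_exp_trunc N _).
apply: (@val_order_tri _ _ (flie_br (exp_trunc N y) (exp_trunc N z))).
  apply: val_order_opp.
  have -> : exp_trunc N (flie_br y z) =
      \sum_(k < N) conv (fun i j => flie_br (dpow xi i y) (dpow xi j z)) k.
    by apply: eq_bigr => k _; apply: dpow_bilinear => // a b; apply: vector_field0_br.
  have -> : flie_br (exp_trunc N y) (exp_trunc N z) =
      \sum_(i < N) \sum_(j < N) flie_br (dpow xi i y) (dpow xi j z).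
    rewrite /exp_trunc (linPsum (brl _)); apply: eq_bigr => i _.
    by rewrite (linPsum (brr _)).
  (* Only the corner [i + j >= N] is left, and its terms have order at least [i + j + 2]. *)
  rewrite (conv_square (fun i j => flie_br (dpow xi i y) (dpow xi j z))) addrC addKr.
  apply: val_sum_ge => i _.
  rewrite big_nat_cond; apply: val_sum_ge => j /andP[/andP[h _] _].
  apply: (@order_geW _ _ _ (1 + i + (1 + j))); first by lia.
  by apply: order_ge_sbr; apply: dpow_order; apply: lie_order1.
apply: (@val_order_tri _ _ (flie_br (lie_exp y) (exp_trunc N z))); apply: val_order_opp.
  rewrite -(linPB (brl _)) -[N]addn0; apply: order_ge_sbr => //.
  by rewrite addn0; exact: order_geW (leqnSn N) (@lie_exp_trunc N _).
rewrite -(linPB (brr _)) -[N]add0n; apply: order_ge_sbr => //.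
by rewrite add0n; exact: order_geW (leqnSn N) (@lie_exp_trunc N _).
Qed.

Lemma lie_exp_endo : lie_endo G lie_exp.
Proof.
split; [exact: lie_exp_lin | | exact: lie_exp_degree | exact: lie_exp_br].
by move=> n; exists n => y; apply: lie_exp_order.
Qed.

(** The [k]-th term raises order by [k c], and [2 c >= c + 1]: from the quadratic term on, order
    goes up by at least [c + 1]. *)
Lemma lie_exp_expand c y n : (1 <= c)%N -> raises c xi -> order_ge n (val y) ->
  order_ge (n + c) (val (lie_exp y - y)) /\
  order_ge (n + c + 1) (val (lie_exp y - y - xi y)).
Proof.
move=> c1 rc hy.
have hk k : order_ge (n + k * c) (val (dpow xi k y)).
  elim: k => [|k IH]; first by rewrite mul0n addn0.
  move=> w lt; rewrite [dpow _ _ _]/= valZ (rc _ _ IH) ?mulr0 //; lia.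
have e1 : dpow xi 1 y = xi y.
  by rewrite /= -[RHS]scale1r -(nat_inv_ofE G 0) mulr1.
have main m (z : g) (s : nat) : z = exp_trunc s y ->
    (forall k, (s <= k)%N -> order_ge m (val (dpow xi k y))) -> order_ge m (val (lie_exp y - z)).
  move=> -> h w lt; rewrite valB (_ : val (lie_exp y) w = val (exp_trunc (s + size w) y) w); last first.
    exact/esym/exp_trunc_val/leq_addl.
  rewrite /exp_trunc !val_sum -!(big_mkord xpredT (fun k => val (dpow xi k y) w)).
  rewrite (big_cat_nat (leq0n s) (leq_addr _ _)) /=.
  rewrite addrAC subrr add0r big_nat_cond big1 // => k.
  by case/andP=> /andP[le _] _; apply: h.
split.
  apply: (main _ _ 1%N) => [|k le]; first by rewrite /exp_trunc big_ord1.
  by apply: order_geW (hk k); nia.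
rewrite -addrA -opprD; apply: (main _ _ 2%N) => [|k le].
  by rewrite /exp_trunc big_ord_recr big_ord1 e1.
by apply: order_geW (hk k); nia.
Qed.
End Exp.

Lemma lie_expK (xi eta : g -> g) (vx : vector_field G 0 xi) (rx : raises 1 xi)
    (vn : vector_field G 0 eta) (rn : raises 1 eta) : (forall y, eta y = - xi y) ->
  cancel (lie_exp rn) (lie_exp rx).
Proof.
have [lx _ _ _] := vx; have [ln _ _ _] := vn.
move=> neg y; apply: lie_eq => N.
apply: (@val_order_tri _ _ (exp_trunc xi N.+1 (lie_exp rn y))).
  by apply: order_geW (lie_exp_trunc rx (n := N.+1) _); lia.
apply: (@val_order_tri _ _ (exp_trunc xi N.+1 (exp_trunc eta N.+1 y))).
  rewrite -(linPB (exp_trunc_lin vx _)); apply: (exp_trunc_order rx).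
  by apply: order_geW (lie_exp_trunc rn (n := N.+1) _); lia.
have -> : exp_trunc xi N.+1 (exp_trunc eta N.+1 y) =
    \sum_(i < N.+1) \sum_(j < N.+1) dpow xi i (dpow eta j y).
  apply: eq_bigr => i _; rewrite /exp_trunc (linPsum (dpow_lin G lx i)) //.
pose F i j := dpow xi i (dpow eta j y).
rewrite (conv_square F) (_ : \sum_(k < N.+1) conv F k = y); last first.
  rewrite big_ord_recl big1 => [|k _]; first by rewrite addr0 /conv big_ord1.
  exact: dpow_opp.
rewrite addrAC subrr add0r; apply: val_sum_ge => i _.
rewrite big_nat_cond; apply: val_sum_ge => j /andP[/andP[h _] _].
apply: (@order_geW _ _ _ (1 + j + i)); first by lia.
by apply: (dpow_order rx); apply: (dpow_order rn); apply: lie_order1.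
Qed.
End Exponential.

(** * Pullbacks of forms *)

Section LieRaises.
Variables (K : comAlgType rat) (G : even_grading K) (r : nat) (v : 'I_r -> int) (N : nat).
Local Notation g := (free_lie K v).
Local Notation O := (omegaq G v N).
Local Notation Dr := (drq G v N).
Local Notation br := (@obr K G r v N).
Local Notation ten := (@dten K G r v N).
Local Notation tgt := (omega_target G v N).
Local Notation brl := (lt_linl tgt).
Local Notation brr := (lt_linr tgt).
Local Notation tenl := (@dten_linl K G r v N).
Local Notation tenr := (@dten_linr K G r v N).

Lemma ofilD n (x y : O) : ofil n x -> ofil n y -> ofil n (x + y).
Proof. by move=> hx hy; rewrite -[x]scale1r; apply: (lt_filD tgt). Qed.
Lemma ofilZ n k (x : O) : ofil n x -> ofil n (k *: x).
Proof. by move=> hx; rewrite -[_ *: _]addr0; apply: (lt_filD tgt) => //; apply: (lt_fil0 tgt). Qed.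
Lemma dfil_add n (x y : Dr) : dfil n x -> dfil n y -> dfil n (x + y).
Proof. by move=> hx hy; rewrite -[x]scale1r; apply: dfilD. Qed.

Section Raise.
Variables (c : nat) (xi : g -> g).
Hypotheses (vx : vector_field G 0 xi) (rx : raises c xi).
Local Notation L := (@lie_o K G r v N 0 xi).
Local Notation Ld := (@lie_d K G r v N 0 xi).
Local Notation der := (lie_der N vx).

Lemma lie0_br x y : L (br x y) = br (L x) y + br x (L y).
Proof. by rewrite (is_der_par _ _ der).1 opow0. Qed.

Lemma lie0_ten x y : Ld (ten x y) = ten (L x) y + ten x (L y).
Proof. by rewrite (is_der_par _ _ der).2 opow0. Qed.

Lemma lie0_dif w y n : order_ge n (val y) -> ofil (size w + n + c) (L (dif G N w y)).
Proof.
move=> hy; elim: w => [|a w IH].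
  rewrite (lie_dif _ vx) sgE scale1r; apply: (@dif_fil _ _ _ _ _ _ [::]); exact: rx.
rewrite dif_cons (linPZ (der_lin der)) lie0_br (lie_elt _ vx).
apply/ofilZ/ofilD.
  apply: (lt_filW tgt _ (lt_fil_br tgt (elt_fil _ _ (rx (lie_order1 _))) (dif_fil _ _ w hy))).
  by rewrite /=; lia.
apply: (lt_filW tgt _ (lt_fil_br tgt (elt_fil _ _ (lie_order1 _)) IH)).
by rewrite /=; lia.
Qed.

Lemma lie0_ofil n x : ofil n x -> ofil (n + c) (L x).
Proof.
case=> s hs <- {x}; elim: s n hs => [y|w y|a IHa b IHb|a IHa b IHb|k a IHa|] n /=.
- by move=> hy; rewrite -/(elt _ _ _) (lie_elt _ vx); apply/elt_fil/rx.
- by move=> hy; apply: (lt_filW tgt _ (lie0_dif w hy)); lia.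
- case=> m [m' [le ha hb]]; rewrite oclsBr lie0_br.
  have fa : ofil m (ocls G N a) by exists a.
  have fb : ofil m' (ocls G N b) by exists b.
  apply: ofilD.
    by apply: (lt_filW tgt _ (lt_fil_br tgt (IHa _ ha) fb)); lia.
  by apply: (lt_filW tgt _ (lt_fil_br tgt fa (IHb _ hb))); lia.
- by case=> /IHa ha /IHb hb; rewrite oclsD (linPD (der_lin der)); apply: ofilD.
- by move=> /IHa ha; rewrite oclsZ (linPZ (der_lin der)); apply: ofilZ.
- by move=> _; rewrite ocls0 (linP0 (der_lin der)); apply: (lt_fil0 tgt).
Qed.

End Raise.

(** * Pullback along an exponential is the exponential of the Lie derivative *)

Section ExpForms.
Variables (xi : g -> g).
Hypotheses (vx : vector_field G 0 xi) (rx : raises 1 xi).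
Local Notation L := (@lie_o K G r v N 0 xi).
Local Notation Ld := (@lie_d K G r v N 0 xi).
Local Notation der := (lie_der N vx).
Local Notation phi := (lie_exp G rx).

(** The whole exponential series of [L_xi]: each application raises the filtration by one and
    filtration [N] is zero, so later terms vanish. *)
Definition exp_o (x : O) : O := \sum_(k < N.+1) dpow G L k x.
Definition exp_d (x : Dr) : Dr := \sum_(k < N.+1) dpow G Ld k x.

Lemma exp_o_lin : linear exp_o.
Proof.
move=> k x y; rewrite /exp_o scaler_sumr -big_split; apply: eq_bigr => i _ /=.
exact: (dpow_lin G (der_lin der)).
Qed.

Lemma exp_d_lin : linear exp_d.
Proof.
move=> k x y; rewrite /exp_d scaler_sumr -big_split; apply: eq_bigr => i _ /=.
exact: (dpow_lin G (der_lin' der)).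
Qed.

Lemma dpow_ofil k x : ofil k (dpow G L k x).
Proof.
elim: k => [|k IH].
  have [s ->] := oclsP x; exists s => //; elim: s => //= [a ha b hb].
  by exists 0%N, 0%N.
by rewrite /=; apply: ofilZ; rewrite -addn1; apply: (lie0_ofil vx rx).
Qed.

Lemma exp_bilinear (W : lmodType K) (B : O -> O -> W) (D : W -> W) x y :
  (forall c, linear (B^~ c)) -> (forall c, linear (B c)) -> linear D ->
  (forall a b, D (B a b) = B (L a) b + B a (L b)) ->
  (forall m m' a b, (N < m + m')%N -> ofil m a -> ofil m' b -> B a b = 0) ->
  \sum_(k < N.+1) dpow G D k (B x y) = B (exp_o x) (exp_o y).
Proof.
move=> bl bright lD h z; rewrite /exp_o (linPsum (bl _)).
under [RHS]eq_bigr do rewrite (linPsum (bright _)).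
rewrite (conv_square (fun i j => B (dpow G L i x) (dpow G L j y))).
rewrite [X in _ = _ + X]big1 ?addr0 => [|i _].
  by apply: eq_bigr => k _; apply: dpow_bilinear.
rewrite big_nat_cond big1 // => j /andP[/andP[hj _] _].
by apply: (z i j); [lia | exact: dpow_ofil | exact: dpow_ofil].
Qed.

Lemma exp_br x y : exp_o (br x y) = br (exp_o x) (exp_o y).
Proof.
apply: exp_bilinear; [exact: brl | exact: brr | exact: der_lin der | exact: lie0_br |].
move=> m m' a b lt ha hb; apply: (lt_filN tgt).
by apply: (lt_filW tgt _ (lt_fil_br tgt ha hb)); apply: ltnW.
Qed.

Lemma exp_ten x y : exp_d (ten x y) = ten (exp_o x) (exp_o y).
Proof.
apply: exp_bilinear; [exact: tenl | exact: tenr | exact: der_lin' der | exact: lie0_ten |].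
move=> m m' a b lt ha hb; apply: dfilN.
by apply: dfilW (dfil_ten ha hb); apply: ltnW.
Qed.

Lemma exp_trunc_fil y (F : g -> O) : linear F ->
  (forall n y, order_ge n (val y) -> ofil n (F y)) ->
  F (phi y) = F (exp_trunc G xi N.+1 y).
Proof.
move=> lF fF; apply/eqP; rewrite -subr_eq0 -(linPB lF); apply/eqP/(lt_filN tgt)/fF.
by apply: order_geW (lie_exp_trunc G rx (n := N.+1) y); lia.
Qed.

Lemma dpow_intertwine (F : g -> O) k y : linear F -> (forall y, L (F y) = F (xi y)) ->
  dpow G L k (F y) = F (dpow G xi k y).
Proof. by move=> lF h; elim: k => //= k ->; rewrite h (linPZ lF). Qed.

Lemma exp_elt y : exp_o (elt G N y) = elt G N (phi y).
Proof.
rewrite (exp_trunc_fil _ (elt_lin _ _)) => [|n z]; last exact: elt_fil.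
rewrite (linPsum (elt_lin _ _)); apply: eq_bigr => k _.
by apply: dpow_intertwine => [|z]; [exact: elt_lin | exact: lie_elt].
Qed.

Lemma exp_dif y : exp_o (dif G N [::] y) = dif G N [::] (phi y).
Proof.
rewrite (exp_trunc_fil _ (dif_lin _ _ _)) => [|n z]; last exact: (@dif_fil _ _ _ _ _ n [::]).
rewrite (linPsum (dif_lin _ _ _)); apply: eq_bigr => k _.
apply: dpow_intertwine => [|z]; first exact: dif_lin.
by rewrite (lie_dif _ vx) sgE scale1r.
Qed.

(** Both operations are linear and multiplicative and agree on [y] and [dy]. It follows that the
    pullback fixes every form killed by [L_xi]. *)
Lemma ocls_pull_exp s : ocls G N (omega_pull phi s) = exp_o (ocls G N s).
Proof.
elim: s => [y|w y|a IHa b IHb|a IHa b IHb|k a IHa|] /=.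
- by rewrite -!/(elt _ _ _) exp_elt.
- elim: w => [|a w IH] /=; first by rewrite -!/(dif _ _ _ _) exp_dif.
  rewrite oclsZ oclsBr IH -!/(dif _ _ _ _) -!/(elt _ _ _) dif_cons (linPZ exp_o_lin).
  by rewrite exp_br exp_elt wdeg1.
- by rewrite !oclsBr IHa IHb exp_br.
- by rewrite !oclsD IHa IHb (linPD exp_o_lin).
- by rewrite !oclsZ IHa (linPZ exp_o_lin).
- by rewrite ocls0 (linP0 exp_o_lin).
Qed.

Lemma dcls_pull_exp s : dcls G N (dr_map (omega_pull phi) s) = exp_d (dcls G N s).
Proof.
elim: s => [a b|a IHa b IHb|k a IHa|] /=.
- by rewrite !dclsTens !ocls_pull_exp exp_ten.
- by rewrite !dclsD IHa IHb (linPD exp_d_lin).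
- by rewrite !dclsZ IHa (linPZ exp_d_lin).
- by rewrite dcls0 (linP0 exp_d_lin).
Qed.

Lemma exp_fixed x : Ld x = 0 -> exp_d x = x.
Proof.
move=> h; rewrite /exp_d big_ord_recl big1 ?addr0 // => k _.
exact: (dpow_zero G (der_lin' der) _ h).
Qed.
End ExpForms.

(** * Pullback along an arbitrary endomorphism *)

Section Pull.
Variables (phi : g -> g).
Hypothesis ephi : lie_endo G phi.
Let lphi : linear phi. Proof. by case: ephi. Qed.
Let fphi : filtered phi. Proof. exact: lie_endo_filtered ephi. Qed.

Lemma pull_data : interp_data G br (@odeg K G r v N) (@ofil K G r v N)
  (fun y => elt G N (phi y)) (fun y => dif G N [::] (phi y)).
Proof.
have [_ _ dphi bphi] := ephi; split.
- by move=> k y z; rewrite lphi elt_lin.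
- by move=> k y z; rewrite lphi dif_lin.
- by move=> i y /dphi; apply: elt_deg.
- by move=> i y /dphi; apply: dif0_deg.
- by move=> n y /fphi; apply: elt_fil.
- by move=> n y /fphi; apply: (@dif_fil _ _ _ _ _ n [::]).
- by move=> i j y z _ _; rewrite bphi elt_br.
- by move=> i j y z hy hz; rewrite bphi (dif_br N (dphi _ _ hy) (dphi _ _ hz)).
Qed.

Local Notation P := (interp br (fun y => elt G N (phi y)) (fun y => dif G N [::] (phi y))).

Lemma interp_pull s : P s = ocls G N (omega_pull phi s).
Proof.
elim: s => [y|w y|a IHa b IHb|a IHa b IHb|k a IHa|] //=.
- by elim: w => [|a w IH] //=; rewrite oclsZ oclsBr IH.
- by rewrite IHa IHb oclsBr.
- by rewrite IHa IHb oclsD.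
- by rewrite IHa oclsZ.
Qed.

Definition pull_o (x : O) : O := ocls G N (omega_pull phi (class_repr x)).

Lemma pull_oE s : pull_o (ocls G N s) = ocls G N (omega_pull phi s).
Proof.
rewrite /pull_o -!interp_pull; apply: (interp_eq tgt pull_data).
exact/oe_sym/ocls_repr.
Qed.

Lemma pull_o_lin : linear pull_o.
Proof.
move=> k x y; have [a ->] := oclsP x; have [b ->] := oclsP y.
by rewrite -oclsZ -oclsD !pull_oE /= oclsD oclsZ.
Qed.

Lemma pull_o_br x y : pull_o (br x y) = br (pull_o x) (pull_o y).
Proof.
have [a ->] := oclsP x; have [b ->] := oclsP y.
by rewrite -oclsBr !pull_oE /= oclsBr.
Qed.

Lemma pull_o_deg i x : odeg i x -> odeg i (pull_o x).
Proof. by case=> s hs <-; rewrite pull_oE -interp_pull; apply: (interp_degree tgt pull_data). Qed.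

Lemma pull_o_fil n x : ofil n x -> ofil n (pull_o x).
Proof. by case=> s hs <-; rewrite pull_oE -interp_pull; apply: (interp_fil tgt pull_data). Qed.

Lemma pull_elt y : pull_o (elt G N y) = elt G N (phi y).
Proof. exact: pull_oE. Qed.
Lemma pull_dif y : pull_o (dif G N [::] y) = dif G N [::] (phi y).
Proof. exact: pull_oE. Qed.

Let B x y : Dr := ten (pull_o x) (pull_o y).

Lemma pull_target : dr_target B.
Proof.
split.
- by move=> c k x y; rewrite /B pull_o_lin (tenl _ _ _).
- by move=> c k x y; rewrite /B pull_o_lin (tenr _ _ _).
- move=> m n a b le ha hb; apply: dfilN; apply: (dfilW le).
  by apply: dfil_ten; apply: pull_o_fil.
- by move=> i j a b ha hb; apply: dten_comm; apply: pull_o_deg.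
- by move=> a b c; rewrite /B !pull_o_br dten_inv.
Qed.

Lemma dr_interp_pull s : dr_interp B s = dcls G N (dr_map (omega_pull phi) s).
Proof.
elim: s => [a b|a IHa b IHb|k a IHa|] //=.
- by rewrite /B !pull_oE dclsTens.
- by rewrite IHa IHb dclsD.
- by rewrite IHa dclsZ.
Qed.

Lemma pull_eq s t : dcls G N s = dcls G N t ->
  dcls G N (dr_map (omega_pull phi) s) = dcls G N (dr_map (omega_pull phi) t).
Proof. by move/dcls_inj => h; rewrite -!dr_interp_pull; apply: (dr_interp_eq pull_target h). Qed.

(** * First order expansion of a pullback *)

Section Leading.
Variables (c : nat) (xi : g -> g).
Hypotheses (c1 : (1 <= c)%N) (vx : vector_field G 0 xi) (rx : raises c xi).
Hypotheses (r1 : raises c (fun y => phi y - y)) (r2 : raises c.+1 (fun y => phi y - y - xi y)).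
Local Notation L := (@lie_o K G r v N 0 xi).
Local Notation Ld := (@lie_d K G r v N 0 xi).
Local Notation der := (lie_der N vx).

(** When [a' - a] and [b' - b] raise the filtration by [c >= 1], the product of the two differences
    raises it by [2 c >= c + 1]. To first order a pullback therefore acts as a derivation. *)
Lemma expand_bilinear (W : lmodType K) (B' : O -> O -> W) (a b a' b' la lb : O) :
  (forall c, linear (B'^~ c)) -> (forall c, linear (B' c)) ->
  B' a' b' - B' a b = B' (a' - a) b' + B' a (b' - b) /\
  B' a' b' - B' a b - (B' la b + B' a lb) =
  B' (a' - a - la) b + B' a (b' - b - lb) + B' (a' - a) (b' - b).
Proof.
move=> bl bright; split.
  by rewrite (linPB (bl _)) (linPB (bright _)) addrA subrK.
by rewrite !(linPB (bl _)) !(linPB (bright _)); module_coefs K; ring.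
Qed.

Lemma pull_leading_dif w y n : order_ge n (val y) ->
  ofil (size w + n + c) (pull_o (dif G N w y) - dif G N w y) /\
  ofil (size w + n + c.+1) (pull_o (dif G N w y) - dif G N w y - L (dif G N w y)).
Proof.
move=> hy; elim: w => [|a w [IH1 IH2]].
  rewrite pull_dif (lie_dif _ vx) sgE scale1r -!(linPB (dif_lin _ _ _)).
  by split; apply: (@dif_fil _ _ _ _ _ _ [::]); [exact: r1 | exact: r2].
rewrite dif_cons (linPZ pull_o_lin) (linPZ (der_lin der)) -!scalerBr.
rewrite pull_o_br (lie0_br vx) pull_elt (lie_elt _ vx).
set z := flie_letter K v a.
have [-> ->] := expand_bilinear (elt G N z) (dif G N w y) (elt G N (phi z))
  (pull_o (dif G N w y)) (elt G N (xi z)) (L (dif G N w y)) brl brr.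
rewrite -!(linPB (elt_lin _ _)).
have z1 := lie_order1 z.
have fw := dif_fil G N w hy.
have e1 : ofil (1 + c) (elt G N (phi z - z)) by apply/elt_fil/r1.
have e2 : ofil (1 + c.+1) (elt G N (phi z - z - xi z)) by apply/elt_fil/r2.
split; apply: ofilZ.
  apply: ofilD.
    by apply: (lt_filW tgt _ (lt_fil_br tgt e1 (pull_o_fil fw))); rewrite /=; lia.
  by apply: (lt_filW tgt _ (lt_fil_br tgt (elt_fil G N z1) IH1)); rewrite /=; lia.
apply: ofilD; first apply: ofilD.
- by apply: (lt_filW tgt _ (lt_fil_br tgt e2 fw)); rewrite /=; lia.
- by apply: (lt_filW tgt _ (lt_fil_br tgt (elt_fil G N z1) IH2)); rewrite /=; lia.
- by apply: (lt_filW tgt _ (lt_fil_br tgt e1 IH1)); rewrite /=; lia.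
Qed.

Lemma pull_leading_omega s n : omega_weight_ge s n ->
  ofil (n + c) (pull_o (ocls G N s) - ocls G N s) /\
  ofil (n + c.+1) (pull_o (ocls G N s) - ocls G N s - L (ocls G N s)).
Proof.
elim: s n => [y|w y|a IHa b IHb|a IHa b IHb|k a IHa|] n /=.
- move=> hy; rewrite -/(elt _ _ _) pull_elt (lie_elt _ vx) -!(linPB (elt_lin _ _)).
  by split; apply: elt_fil; [exact: r1 | exact: r2].
- move=> hy; have [h1 h2] := pull_leading_dif w hy.
  by split; [apply: (lt_filW tgt _ h1) | apply: (lt_filW tgt _ h2)]; lia.
- case=> m [m' [le ha hb]]; rewrite oclsBr pull_o_br (lie0_br vx).
  have fa : ofil m (ocls G N a) by exists a.
  have fb : ofil m' (ocls G N b) by exists b.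
  have [a1 a2] := IHa _ ha; have [b1 b2] := IHb _ hb.
  have [-> ->] := expand_bilinear (ocls G N a) (ocls G N b) (pull_o (ocls G N a))
    (pull_o (ocls G N b)) (L (ocls G N a)) (L (ocls G N b)) brl brr.
  split; first apply: ofilD.
  + by apply: (lt_filW tgt _ (lt_fil_br tgt a1 (pull_o_fil fb))); lia.
  + by apply: (lt_filW tgt _ (lt_fil_br tgt fa b1)); lia.
  apply: ofilD; first apply: ofilD.
  + by apply: (lt_filW tgt _ (lt_fil_br tgt a2 fb)); lia.
  + by apply: (lt_filW tgt _ (lt_fil_br tgt fa b2)); lia.
  + by apply: (lt_filW tgt _ (lt_fil_br tgt a1 b1)); lia.
- case=> /IHa [a1 a2] /IHb [b1 b2]; rewrite oclsD (linPD pull_o_lin) (linPD (der_lin der)).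
  split.
    by rewrite opprD addrACA; apply: ofilD.
  set x := ocls G N a in a2 *; set y := ocls G N b in b2 *.
  rewrite (_ : _ - _ = (pull_o x - x - L x) + (pull_o y - y - L y)); first exact: ofilD.
  by module_coefs K; ring.
- move=> /IHa [a1 a2]; rewrite oclsZ (linPZ pull_o_lin) (linPZ (der_lin der)) -!scalerBr.
  by split; apply: ofilZ.
- move=> _; rewrite ocls0 (linP0 pull_o_lin) (linP0 (der_lin der)) !subr0.
  by split; apply: (lt_fil0 tgt).
Qed.

Lemma pull_leading s n : dr_weight_ge s n ->
  dfil (n + c.+1) (dcls G N (dr_map (omega_pull phi) s) - dcls G N s - Ld (dcls G N s)).
Proof.
elim: s n => [a b|a IHa b IHb|k a IHa|] n /=.
- case=> m [m' [le ha hb]]; rewrite !dclsTens -!pull_oE (lie0_ten vx).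
  have fa : ofil m (ocls G N a) by exists a.
  have fb : ofil m' (ocls G N b) by exists b.
  have [a1 a2] := pull_leading_omega ha; have [b1 b2] := pull_leading_omega hb.
  have [_ ->] := expand_bilinear (ocls G N a) (ocls G N b) (pull_o (ocls G N a))
    (pull_o (ocls G N b)) (L (ocls G N a)) (L (ocls G N b)) tenl tenr.
  apply: dfil_add; first apply: dfil_add.
  + by apply: dfilW (dfil_ten a2 fb); lia.
  + by apply: dfilW (dfil_ten fa b2); lia.
  + by apply: dfilW (dfil_ten a1 b1); lia.
- case=> /IHa ha /IHb hb; rewrite !dclsD (linPD (der_lin' der)).
  set x := dcls G N a in ha *; set y := dcls G N b in hb *.
  rewrite (_ : _ - _ = (dcls G N (dr_map (omega_pull phi) a) - x - Ld x) +
    (dcls G N (dr_map (omega_pull phi) b) - y - Ld y)); first exact: dfil_add.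
  by module_coefs K; ring.
- move=> /IHa ha; rewrite !dclsZ (linPZ (der_lin' der)) -!scalerBr.
  exact: dfilZ.
- by move=> _; rewrite dcls0 (linP0 (der_lin' der)) !subr0; apply: dfil0.
Qed.
End Leading.
End Pull.
End LieRaises.

(** * Leading terms of symplectomorphisms *)

Section LeadingTerm.
Variables (K : comAlgType rat) (G : even_grading K) (r : nat) (v : 'I_r -> int).
Local Notation g := (free_lie K v).

Lemma lie_part_lin n : linear (@lie_part K r v n).
Proof.
move=> k y z; apply: val_inj; apply/funext => w; rewrite valD valZ /= /spart.
by case: ifP => _; rewrite ?serD ?serZ // mulr0 addr0.
Qed.

Lemma raises_of c (f : g -> g) : linear f -> filtered f ->
  (forall n i y, lie_mono n i y -> order_ge (n + c) (val (f y))) -> raises c f.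
Proof.
move=> lf ff h n y hy.
apply: (@lie_ind K r v n (n + c) (fun y => order_ge (n + c) (val (f y)))) hy.
- exact: ff.
- by move=> k y1 y2 h1 h2; rewrite lf; apply: val_order_geD.
- by move=> p i z le /h; apply: order_geW; rewrite leq_add2r.
Qed.

Lemma raises_endo c (f : g -> g) : linear f -> filtered f -> endo_order c.+1 f -> raises c f.
Proof.
move=> lf ff h; apply: raises_of => // n i y /lie_mono_order/(endo_order_succ h).
exact: order_eq_ge.
Qed.

Lemma raisesP c (f : g -> g) : raises c f <-> endo_order_ge c.+1 f.
Proof. by split=> h n y hy; have := h n y hy; rewrite addnS. Qed.

Lemma raises_filtered c (f : g -> g) : raises c f -> filtered f.
Proof. by move=> h n y /h; apply: order_geW; apply: leq_addr. Qed.

Lemma raisesW c d (f : g -> g) : (c <= d)%N -> raises d f -> raises c f.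
Proof. by move=> le h n y /h; apply: order_geW; rewrite leq_add2l. Qed.

Lemma raises_comp c d (f h : g -> g) : raises c f -> raises d h -> raises (d + c) (f \o h).
Proof. by move=> hf hh n y /hh /hf /=; rewrite addnA. Qed.

Lemma raisesD c (f h : g -> g) : raises c f -> raises c h -> raises c (fun y => f y + h y).
Proof. by move=> hf hh n y hy; rewrite -[f y]scale1r; apply: val_order_geD; [apply: hf | apply: hh]. Qed.

Lemma raisesN c (f : g -> g) : raises c f -> raises c (fun y => - f y).
Proof. by move=> hf n y hy w lt; rewrite valN (hf _ _ hy) ?oppr0. Qed.

Lemma raisesB c (f h : g -> g) : raises c f -> raises c h -> raises c (fun y => f y - h y).
Proof. by move=> hf hh; apply: raisesD => //; apply: raisesN. Qed.

Lemma raises_ext c (f h : g -> g) : f =1 h -> raises c f -> raises c h.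
Proof. by move=> e hf n y hy; rewrite -e; apply: hf. Qed.

(** On a monomial of order [n] the value has order exactly [n + c] and at the same time at least
    [n + c + 1]. *)
Lemma pure_raises_eq0 c (f : g -> g) : linear f -> endo_order c.+1 f -> raises c.+1 f ->
  forall y, f y = 0.
Proof.
move=> lf h rf; apply: (eq_on_lie_mono lf) => [k a b|||n i y m].
- by rewrite scaler0 addr0.
- exact: raises_filtered rf.
- by [].
have hy := lie_mono_order m.
apply: val_inj; apply/funext => w; rewrite val0.
have [e|ne] := eqVneq (size w) (n + c)%N.
  by apply: (rf n y (order_eq_ge hy)); rewrite e addnS.
exact: (endo_order_succ h hy).
Qed.

Section Leading.
Variables (phi : g -> g) (c : nat).
Hypotheses (ephi : lie_endo G phi) (c1 : (0 < c)%N) (rphi : raises c (fun y => phi y - y)).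
Let lphi : linear phi. Proof. by case: ephi. Qed.

(** The part of [phi - id] that raises order by exactly [c], assembled order by order. If
    [size w < c] the subtraction stops at [0], which is harmless because the free Lie algebra has no
    part of order [0]. *)
Definition leading_series (y : g) : series K r := fun w =>
  val (phi (lie_part (size w - c) y) - lie_part (size w - c) y) w.

Lemma leading_subproof y : leading_series y \in lie_series v.
Proof.
apply/asboolP => n; pose p := lie_part (n - c) y.
have := asboolW (valP (phi p - p)) n; congr lie_poly.
by apply/funext => w; rewrite /spart /leading_series; case: eqP => // ->.
Qed.

Definition leading (y : g) : g := exist _ (leading_series y) (leading_subproof y).

Lemma leading_val y w : val (leading y) w =
  val (phi (lie_part (size w - c) y) - lie_part (size w - c) y) w.
Proof. by []. Qed.

Lemma leading_lin : linear leading.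
Proof.
move=> k y z; apply: val_inj; apply/funext => w; rewrite valD valZ !leading_val.
by rewrite lie_part_lin lphi !(valB, valD, valZ); ring.
Qed.

Lemma lie_part_lt n m (y : g) : order_ge n (val y) -> (m < n)%N -> lie_part m y = 0.
Proof.
move=> hy lt; apply: val_inj; apply/funext => w; rewrite /= /spart.
by case: eqP => // e; rewrite hy // e.
Qed.

Lemma leading_ge a y : order_ge a (val y) -> order_ge (a + c) (val (leading y)).
Proof.
move=> hy w lt; rewrite leading_val.
have [lt'|le] := ltnP (size w - c) a.
  by rewrite (lie_part_lt hy lt') (linP0 lphi) subrr.
have e : (a = 0)%N by lia.
have -> : (size w - c = 0)%N by lia.
by rewrite lie_part0 (linP0 lphi) subrr.
Qed.

Lemma leading_approx a y : order_ge a (val y) ->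
  order_ge (a + c.+1) (val (phi y - y - leading y)).
Proof.
move=> hy w; rewrite addnS ltnS leq_eqVlt => /orP[/eqP e|lt]; last first.
  by rewrite valB (rphi hy lt) (leading_ge hy lt) subrr.
rewrite valB leading_val e addnK.
pose z := y - lie_part a y.
have hz : order_ge a.+1 (val z).
  move=> u; rewrite ltnS leq_eqVlt => /orP[/eqP eu|lt]; rewrite valB /= /spart.
    by rewrite eu eqxx subrr.
  by rewrite (ltn_eqF lt) subr0 hy.
have := rphi hz; move/(_ w); rewrite addSn e ltnSn => /(_ isT).
rewrite /z (linPB lphi) !valB => ez.
by rewrite -[RHS]ez; ring.
Qed.

Lemma leading_endo_order : endo_order c.+1 leading.
Proof.
move=> a y hy w; rewrite addnS leading_val => ne.
have [e|ne'] := eqVneq (size w - c)%N a; last first.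
  rewrite (_ : lie_part _ y = 0) ?(linP0 lphi) ?subrr //.
  by apply: val_inj; apply: spart_ne hy ne'.
have -> : (size w - c)%N = 0%N by move: ne => /=; rewrite -e; lia.
by rewrite lie_part0 (linP0 lphi) subrr.
Qed.

(** Expanding the multiplicativity of [phi] leaves, besides the Leibniz terms, the bracket of
    [phi a - a] with [phi b - b], which raises order by [2 c > c]. *)
Lemma leading_field : vector_field G 0 leading.
Proof.
have [_ _ dphi bphi] := ephi.
have fl : filtered leading by move=> n y /leading_ge; apply: order_geW; apply: leq_addr.
have bl (a : g) : linear (fun b => flie_br b a) by move=> ? ? ?; apply: flie_br_linearl.
have br (a : g) : linear (flie_br a) by move=> ? ? ?; apply: flie_br_linearr.
split; [exact: leading_lin | by move=> n; exists n => y; apply: fl | |].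
  move=> i y hy w; rewrite leading_val addr0.
  have hp : has_degree G v i (val (lie_part (size w - c) y)).
    by move=> u; rewrite /= /spart; case: ifP => _; [exact: hy | exact: gr_zero].
  by rewrite valB; apply: gr_sub; [apply: dphi | exact: hp].
move=> i y z _; rewrite mul0r sgE scale1r.
apply: (@eq_on_lie_mono K r v (fun y => leading (flie_br y z))
  (fun y => flie_br (leading y) z + flie_br y (leading z))) => [k a b|k a b|n a h|n a h|n j a ma].
- by rewrite bl leading_lin.
- by rewrite leading_lin !(bl _ _ _); module_coefs K; ring.
- by apply: fl; rewrite -[n]addn0; apply: order_ge_sbr.
- rewrite -[X in X + _]scale1r; apply: val_order_geD; rewrite -[n]addn0; apply: order_ge_sbr => //.
  exact: fl.
apply: (@eq_on_lie_mono K r v (fun z => leading (flie_br a z))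
  (fun z => flie_br (leading a) z + flie_br a (leading z))) => [k b d|k b d|p b h|p b h|p l b mb].
- by rewrite br leading_lin.
- by rewrite leading_lin !(br _ _ _); module_coefs K; ring.
- by apply: fl; rewrite -[p]add0n; apply: order_ge_sbr.
- rewrite -[X in X + _]scale1r; apply: val_order_geD; rewrite -[p]add0n; apply: order_ge_sbr => //.
  exact: fl.
(* Both sides are of weight [n + p + c], and they agree up to order [n + p + c + 1]. *)
have ha := lie_mono_order ma; have hb := lie_mono_order mb.
have ga := order_eq_ge ha; have gb := order_eq_ge hb.
have n0 := lie_mono_gt0 ma; have p0 := lie_mono_gt0 mb.
have la := endo_order_succ leading_endo_order ha.
have lb := endo_order_succ leading_endo_order hb.
have lab := endo_order_succ leading_endo_order (order_eq_sbr v ha hb : order_eq _ (val (flie_br a b))).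
apply: val_inj; apply/funext => w; rewrite valD.
have [e|ne] := eqVneq (size w) (n + p + c)%N; last first.
  have -> : val (flie_br (leading a) b) w = 0.
    by apply: (order_eq_sbr v la hb); rewrite addnAC.
  have -> : val (flie_br a (leading b)) w = 0.
    by apply: (order_eq_sbr v ha lb); rewrite addnA.
  by rewrite addr0; exact: lab.
pose X1 := flie_br (phi a - a - leading a) b.
pose X2 := flie_br a (phi b - b - leading b).
pose X3 := flie_br (phi a - a) (phi b - b).
have E : phi (flie_br a b) - flie_br a b =
    (X1 + flie_br (leading a) b) + (X2 + flie_br a (leading b)) + X3.
  rewrite bphi /X1 /X2 /X3 !(linPB (bl _)) !(linPB (br _)).
  by module_coefs K; ring.
have z1 : val X1 w = 0.
  by apply: (order_ge_sbr v (leading_approx ga) gb); lia.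
have z2 : val X2 w = 0.
  by apply: (order_ge_sbr v ga (leading_approx gb)); lia.
have z3 : val X3 w = 0.
  by apply: (order_ge_sbr v (rphi ga) (rphi gb)); lia.
have := leading_approx (order_ge_sbr v ga gb : order_ge _ (val (flie_br a b))).
move=> /(_ w); rewrite e addnS ltnSn => /(_ isT).
rewrite E valB => /eqP; rewrite subr_eq0 => /eqP <-.
by rewrite !valD z1 z2 z3 !add0r addr0.
Qed.
End Leading.

Lemma omega_weight_weight_ge (s : omega K v) n : omega_weight s n -> omega_weight_ge s n.
Proof.
elim: s n => [y|w y|a IHa b IHb|a IHa b IHb|k a IHa|] n //=.
- exact: order_eq_ge.
- by case=> m [-> /order_eq_ge]; rewrite addKn.
- by case=> m [m' [-> /IHa ha /IHb hb]]; exists m, m'.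
- by case=> /IHa ha /IHb hb.
- exact: IHa.
Qed.

Lemma dr_weight_weight_ge (s : dr K v) n : dr_weight s n -> dr_weight_ge s n.
Proof.
elim: s n => [a b|a IHa b IHb|k a IHa|] n //=.
- case=> m [m' [-> ha hb]]; exists m, m'.
  by split=> //; apply: omega_weight_weight_ge.
- by case=> /IHa ha /IHb hb.
- exact: IHa.
Qed.

(** * Symplectomorphisms and symplectic fields of degree zero *)

Section Symplecto.
Variables (om : Defs.form K v) (e : int).
Hypotheses (som : symplectic_form G e om) (oom : form_order G 2 0 om).

Lemma pull_symplectic_exp (xi : g -> g) (rx : raises 1 xi) :
  symplectic_field G om 0 xi -> form_eq G (form_pull (lie_exp G rx) om) om.
Proof.
move=> /symplecticP[vx hx]; apply/form_eqP => N.
by rewrite /form_pull (dcls_pull_exp N vx rx) (exp_fixed vx).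
Qed.

Lemma exp_symplectomorphism c (xi : g -> g) : symplectic_field G om 0 xi -> (0 < c)%N ->
  endo_order c.+1 xi -> exists phi psi,
  [/\ symplectomorphism G om phi psi, raises c (fun y => phi y - y) &
      raises c.+1 (fun y => phi y - y - xi y)].
Proof.
move=> sx c1 ox; have [vx _] := sx; have [lx _ _ _] := vx.
have rc := raises_endo lx (vector_field_filtered vx) ox.
have r1 := raisesW c1 rc.
have sn : symplectic_field G om 0 (fun y => - xi y).
  have := symplectic_lin (gr_opp (gr_one G)) sx sx => /(symplectic_lin (gr_opp (gr_one G)) sx).
  congr (symplectic_field _ _ _ _); apply/funext => y; module_coefs K; ring.
have [vn _] := sn; have rn := raisesN r1.
exists (lie_exp G r1), (lie_exp G rn); split.
- split; last exact: pull_symplectic_exp.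
  split; [exact: lie_exp_endo | exact: lie_exp_endo | | exact: lie_expK].
  by apply: lie_expK => // y; rewrite opprK.
- by move=> n y hy; have [] := lie_exp_expand G r1 c1 rc hy.
- by move=> n y hy; have [_] := lie_exp_expand G r1 c1 rc hy; rewrite addn1 -addnS.
Qed.

(** [L_xi om] has tensor degree exactly [c + 2]. As [phi] preserves [om], it is also, up to sign,
    the error of the first order expansion of the pullback, which lies in tensor degree [>= c + 3];
    so it vanishes by the Euler argument. *)
Lemma leading_symplectic c (phi : g -> g) : lie_endo G phi -> (0 < c)%N ->
  raises c (fun y => phi y - y) -> form_eq G (form_pull phi om) om -> exists xi,
  [/\ symplectic_field G om 0 xi, endo_order c.+1 xi &
      raises c.+1 (fun y => phi y - y - xi y)].
Proof.
move=> ephi c1 rphi pom.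
have vx := leading_field ephi c1 rphi.
have ox : endo_order c.+1 (leading phi c) by apply: leading_endo_order.
have rx : raises c (leading phi c) by move=> n y; apply: leading_ge.
have r2 : raises c.+1 (fun y => phi y - y - leading phi c y).
  by move=> n y; apply: leading_approx.
exists (leading phi c); split=> //; apply/symplecticP; split=> // N.
apply: (@pure_weight_eq0 K G r v N (2 + c)).
  have := form_orderP (form_order_L vx ox oom) N.
  by rewrite dcls_form_L // add0n addnC.
have [s [ws es]] := oom N.
have wge : dr_weight_ge s 2 by exact: dr_weight_weight_ge.
have := pull_leading N ephi c1 vx rphi r2 wge.
rewrite -(pull_eq ephi (dcls_eq es)) -(dcls_eq es).
have /form_eqP /(_ N) := pom; rewrite /form_pull => ->.
rewrite subrr sub0r => h; rewrite -[lie_d _ _ _]opprK -scaleN1r; apply: dfilZ.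
by rewrite addnS in h.
Qed.
End Symplecto.
End LeadingTerm.

(** * Extensions *)

Section Extensions.
Variables (K : comAlgType rat) (G : even_grading K) (A : frobenius G).
Local Notation g := (free_lie K (@fdeg _ _ A)).
Local Notation om := (@fom _ _ A).
Local Notation e := (@fom_deg _ _ A).
Local Notation m2 := (@fm2 _ _ A).
Local Notation som := (fom_symplectic A).
Local Notation oom := (@fom_order _ _ A).
Local Notation sm2 := (fm2_symplectic A).
Implicit Types (mn eta xi : g -> g).

Lemma symplectic_linear j xi : symplectic_field G om j xi -> linear xi.
Proof. by case=> [[]]. Qed.

Lemma symplectic_filtered j xi : symplectic_field G om j xi -> filtered xi.
Proof. by case=> /vector_field_filtered. Qed.

Lemma symplectic_raises j c xi : symplectic_field G om j xi -> endo_order c.+1 xi -> raises c xi.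
Proof. by move=> s; apply: raises_endo; [apply: symplectic_linear s | apply: symplectic_filtered s]. Qed.

Lemma symplecticD j xi eta : symplectic_field G om j xi -> symplectic_field G om j eta ->
  symplectic_field G om j (fun y => xi y + eta y).
Proof.
move=> h1 h2; have := symplectic_lin (gr_one G) h1 h2.
by congr symplectic_field; apply/funext => y; rewrite scale1r.
Qed.

Lemma symplecticB j xi eta : symplectic_field G om j xi -> symplectic_field G om j eta ->
  symplectic_field G om j (fun y => xi y - eta y).
Proof.
move=> h1 h2; have := symplectic_lin (gr_opp (gr_one G)) h2 h1.
by congr symplectic_field; apply/funext => y; rewrite scaleN1r addrC.
Qed.

Lemma symplecticZ j k xi : gr G 0 k -> symplectic_field G om j xi ->
  symplectic_field G om j (fun y => k *: xi y).
Proof.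
move=> hk h; have := symplectic_lin hk h (symplecticB h h).
by congr symplectic_field; apply/funext => y; rewrite subrr addr0.
Qed.

Lemma endo_orderD n xi eta : endo_order n xi -> endo_order n eta ->
  endo_order n (fun y => xi y + eta y).
Proof. by move=> h1 h2 a y hy w ne; rewrite valD (h1 _ _ hy) // (h2 _ _ hy) // addr0. Qed.

Lemma endo_orderZ n k xi : endo_order n xi -> endo_order n (fun y => k *: xi y).
Proof. by move=> h a y hy w ne; rewrite valZ (h _ _ hy) // mulr0. Qed.

Lemma endo_orderB n xi eta : endo_order n xi -> endo_order n eta ->
  endo_order n (fun y => xi y - eta y).
Proof. by move=> h1 h2 a y hy w ne; rewrite valB (h1 _ _ hy) // (h2 _ _ hy) // subr0. Qed.

Lemma endo_order_comp b c xi eta : endo_order b.+1 xi -> endo_order c.+1 eta ->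
  endo_order (c + b).+1 (fun y => xi (eta y)).
Proof.
move=> h1 h2 a y hy; rewrite addnS addnA.
exact: (endo_order_succ h1 (endo_order_succ h2 hy)).
Qed.

Lemma raises_m2 : raises 1 m2.
Proof. apply: (symplectic_raises sm2); exact: fm2_order. Qed.

Variables (c : nat) (m : g -> g).
Hypotheses (c1 : (0 < c)%N) (ms : SC_structure c.+2 m).
Let sm : symplectic_field G om 1 m. Proof. by case: ms. Qed.
Let lm2 : linear m2. Proof. exact: symplectic_linear sm2. Qed.

Lemma raises_m : raises 2 (fun y => m y - m2 y).
Proof.
have s := symplecticB sm sm2.
apply: raises_of; [exact: symplectic_linear s | exact: symplectic_filtered s |].
move=> n i y my; case: ms => _ [mi [omi mi2 em]] _.
have hy := lie_mono_order my.
have -> : m y - m2 y = \sum_(3 <= i < c.+2) mi i y.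
  by rewrite em big_ltn // mi2 addrAC subrr add0r.
rewrite big_nat_cond; apply: val_sum_ge => j /andP[/andP[hj _] _].
by apply: order_geW (order_eq_ge (omi j n y hy)); lia.
Qed.

(** The cocycles of [[m2, -]] in order [n = c + 2]. Both fields have odd degree, so the graded
    commutator is a sum. *)
Definition harmonic eta :=
  [/\ symplectic_field G om 1 eta, endo_order c.+2 eta & forall y, m2 (eta y) + eta (m2 y) = 0].

Definition exact_field eta := exists xi,
  [/\ symplectic_field G om 0 xi, endo_order c.+1 xi & forall y, eta y = xi (m2 y) - m2 (xi y)].

(** Adding [eta] changes the square of [mu] by [[m2, eta]] and three errors. In these [mu - m2]
    raises order by [2] and [eta] by [c + 1], and [2 (c + 1) >= c + 3] because [c >= 1]. *)
Lemma square_diff (mu eta : g -> g) : linear mu -> linear eta -> 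
  raises 2 (fun y => mu y - m2 y) -> raises c.+1 eta ->
  raises c.+3 (fun y => (mu (mu y + eta y) + eta (mu y + eta y)) - mu (mu y)
    - (m2 (eta y) + eta (m2 y))).
Proof.
move=> lmu le r2 re.
apply: (@raises_ext _ _ _ _ (fun y => (mu (eta y) - m2 (eta y)) + eta (mu y - m2 y) + eta (eta y))).
  by move=> y; rewrite (linPD lmu) (linPB le) (linPD le); module_coefs K; ring.
apply: raisesD; first apply: raisesD.
- by apply: raisesW (raises_comp r2 re); lia.
- by apply: raisesW (raises_comp re r2); lia.
- by apply: raisesW (raises_comp re re); lia.
Qed.

Lemma extension_raises mn : is_extension c.+2 m mn ->
  raises c.+1 mn /\ raises 2 (fun y => m y + mn y - m2 y).
Proof.
case=> s o _; have re := symplectic_raises s o; split=> //.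
apply: (@raises_ext _ _ _ _ (fun y => (m y - m2 y) + mn y)) => [y|]; first by rewrite addrAC.
by apply: raisesD; [exact: raises_m | apply: raisesW re].
Qed.

(** [[m2, eta]] is homogeneous of order [n + 1]. Since both squares vanish modulo [(n + 2)],
    [square_diff] puts it in [(n + 2)], so it is zero. *)
Lemma extension_diff mn mn' : is_extension c.+2 m mn -> is_extension c.+2 m mn' ->
  harmonic (fun y => mn' y - mn y).
Proof.
move=> h h'; have [re r2] := extension_raises h; have [re' _] := extension_raises h'.
case: h => s o [smu _ q]; case: h' => s' o' [smu' _ q'].
have se := symplecticB s' s; have oe := endo_orderB o' o.
have le := symplectic_linear se; have lmu := symplectic_linear smu.
split=> //; apply: (pure_raises_eq0 (c := c.+2)).
- move=> k a b; rewrite !(linPD lm2, linPZ lm2, linPD le, linPZ le, lm2 _ _ _, le _ _ _).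
  by module_coefs K; ring.
- apply: endo_orderD; first by have := endo_order_comp (@fm2_order _ _ A) oe; rewrite addn1.
  by have := endo_order_comp oe (@fm2_order _ _ A); rewrite add1n.
have R := square_diff lmu le r2 (raisesB re' re).
apply: (@raises_ext _ _ _ _ (fun y => (m (m y + mn' y) + mn' (m y + mn' y))
   - (m (m y + mn y) + mn (m y + mn y)) - ((m (m y + mn y + (mn' y - mn y)) + mn (m y + mn y + (mn' y - mn y))
   + (mn' (m y + mn y + (mn' y - mn y)) - mn (m y + mn y + (mn' y - mn y)))) - (m (m y + mn y) + mn (m y + mn y))
    - (m2 (mn' y - mn y) + (mn' (m2 y) - mn (m2 y)))))).
  move=> y; have -> : m y + mn y + (mn' y - mn y) = m y + mn' y by module_coefs K; ring.
  by module_coefs K; ring.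
apply: raisesB => //.
by apply: raisesB; [exact/raisesP/q' | exact/raisesP/q].
Qed.

Lemma extension_add mn eta : is_extension c.+2 m mn -> harmonic eta ->
  is_extension c.+2 m (fun y => mn y + eta y).
Proof.
move=> h [se oe he]; have [re r2] := extension_raises h.
case: h => s o [smu _ q].
have sn := symplecticD s se; have on := endo_orderD o oe.
have lmu := symplectic_linear smu; have le := symplectic_linear se.
split=> //; split; first exact: symplecticD.
  case: ms => _ [mi [omi mi2 em]] _.
  exists (fun i => if i == c.+2 then (fun y => mn y + eta y) else mi i); split.
  - by move=> i; case: eqP => [->|].
  - by case: eqP => //; lia.
  - move=> y; rewrite big_nat_recr //= eqxx em; congr (_ + _).
    apply: eq_big_nat => i /andP[_ lt]; case: eqP => // ei.
    by rewrite ei ltnn in lt.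
apply/raisesP.
have R := square_diff lmu le r2 (symplectic_raises se oe).
apply: (@raises_ext _ _ _ _ (fun y => ((m (m y + mn y + eta y) + mn (m y + mn y + eta y)
    + eta (m y + mn y + eta y)) - (m (m y + mn y) + mn (m y + mn y))
    - (m2 (eta y) + eta (m2 y))) + (m (m y + mn y) + mn (m y + mn y)))).
  by move=> y /=; rewrite he subr0 subrK -!addrA.
by apply: raisesD => //; exact/raisesP/q.
Qed.

(** The failure of [phi] to intertwine [mu] and [mu'] is split into the obstruction [mu' - mu -
    [xi, m2]] and four errors; [conj_raises] shows that the errors lie in [(n + 1)]. *)
Lemma linear_conj (phi xi mu mu' : g -> g) y : linear xi -> linear mu' ->
  (xi (mu y - m2 y) + (phi (mu y) - mu y - xi (mu y))
     - (mu' (xi y) - m2 (xi y)) - mu' (phi y - y - xi y))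
  - ((mu' y - mu y) - (xi (m2 y) - m2 (xi y))) = phi (mu y) - mu' (phi y).
Proof.
move=> lx lmu'; rewrite (linPB lx) !(linPB lmu').
by module_coefs K; ring.
Qed.

Lemma conj_raises (phi xi mu mu' : g -> g) :
  symplectic_field G om 0 xi -> endo_order c.+1 xi -> linear mu' ->
  raises 2 (fun y => mu y - m2 y) -> raises 2 (fun y => mu' y - m2 y) ->
  raises c.+1 (fun y => phi y - y - xi y) ->
  raises c.+2 (fun y => xi (mu y - m2 y) + (phi (mu y) - mu y - xi (mu y))
     - (mu' (xi y) - m2 (xi y)) - mu' (phi y - y - xi y)).
Proof.
move=> sx ox lmu' r2 r2' rr; have rx := symplectic_raises sx ox.
have r1 (f : g -> g) : raises 2 (fun y => f y - m2 y) -> raises 1 f.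
  move=> h; apply: (@raises_ext _ _ _ _ (fun y => (f y - m2 y) + m2 y)) => [y|]; first by rewrite subrK.
  by apply: raisesD; [apply: raisesW h | exact: raises_m2].
apply: raisesB; first apply: raisesB; first apply: raisesD.
- by apply: raisesW (raises_comp rx r2); lia.
- by apply: raisesW (raises_comp rr (r1 _ r2)); lia.
- by apply: raisesW (raises_comp r2' rx); lia.
- by apply: raisesW (raises_comp (r1 _ r2') rr); lia.
Qed.

Lemma raises0_of_filtered (f : g -> g) : filtered f -> raises 0 f.
Proof. by move=> h n y /h; rewrite addn0. Qed.

(** The obstruction is homogeneous of order [n] and agrees, up to sign and modulo [(n + 1)], with
    the failure of [phi] to intertwine. So it is zero exactly when that failure lies in
    [(n + 1)]. *)
Lemma ext_equivP (mn mn' : extension c.+2 m) :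
  ext_equiv mn mn' <-> exact_field (fun y => sval mn' y - sval mn y).
Proof.
case: mn mn' => mn h [mn' h']; rewrite /ext_equiv /=.
have [re r2] := extension_raises h; have [re' r2'] := extension_raises h'.
have [s o [smu _ _]] := h; have [s' o' [smu' _ _]] := h'.
have lmu := symplectic_linear smu; have lmu' := symplectic_linear smu'.
split=> [[phi [psi [[[ephi epsi pK qK] pom] rphi rconj]]]|[xi [sx ox ex]]].
- have rp : raises c (fun y => phi y - y) by apply/raisesP.
  have [xi [sx ox rr]] := leading_symplectic oom ephi c1 rp pom.
  exists xi; split=> // y; apply/eqP; rewrite -subr_eq0; apply/eqP; move: y.
  have lx := symplectic_linear sx.
  have lmn := symplectic_linear s; have lmn' := symplectic_linear s'.
  apply: (pure_raises_eq0 (c := c.+1)).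
  + move=> k a b; rewrite !(lmn _ _ _, lmn' _ _ _, lm2 _ _ _, lx _ _ _).
    by module_coefs K; ring.
  + apply: endo_orderB; first exact: endo_orderB.
    apply: endo_orderB.
      by have := endo_order_comp ox (@fm2_order _ _ A); rewrite add1n.
    by have := endo_order_comp (@fm2_order _ _ A) ox; rewrite addn1.
  (* Precomposing the conjugation condition with [phi] removes [psi]; a filtered map costs no
     order. *)
  have rF : raises c.+2 (fun y => phi (m y + mn y) - (m (phi y) + mn' (phi y))).
    apply: (@raises_ext _ _ _ _
      (fun y => phi (m (psi (phi y)) + mn (psi (phi y))) - (m (phi y) + mn' (phi y)))).
      by move=> y; rewrite pK.
    have := raises_comp (proj2 (raisesP _ _) rconj) (raises0_of_filtered (lie_endo_filtered ephi)).
    by rewrite add0n.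
  have R := conj_raises (phi := phi) sx ox lmu' r2 r2' rr.
  apply: raises_ext (raisesB R rF) => y.
  rewrite -(linear_conj phi (fun y => m y + mn y) y lx lmu').
  by rewrite subKr; module_coefs K; ring.
- have [phi [psi [[[ephi epsi pK qK] pom] rp rr]]] := exp_symplectomorphism sx c1 ox.
  have lx := symplectic_linear sx.
  exists phi, psi; split; [by [] | exact/raisesP |].
  apply/raisesP.
  have R := conj_raises (phi := phi) sx ox lmu' r2 r2' rr.
  have rF : raises c.+2 (fun y => phi (m y + mn y) - (m (phi y) + mn' (phi y))).
    apply: raises_ext R => y; rewrite -(linear_conj phi (fun y => m y + mn y) y lx lmu').
    by rewrite -ex [X in _ = _ - X](_ : _ = 0) ?subr0 //; module_coefs K; ring.
  have := raises_comp rF (raises0_of_filtered (lie_endo_filtered epsi)); rewrite add0n.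
  by apply: raises_ext => y /=; rewrite qK.
Qed.

(** * From cyclic Harrison cocycles to fields commuting with the product *)

Local Notation x N := (dcls G N (om N)).
Local Notation vm2 := (proj1 sm2).
Local Notation Lm2 := (@lie_d K G _ (@fdeg _ _ A) _ 1 m2).
Implicit Types (a b : cocycle A c.+3 e).

Lemma lie_m2_om N : Lm2 (x N) = 0.
Proof. by have /symplecticP[_ ->] := sm2. Qed.

Lemma lie_m2_ext N (y : drq G (@fdeg _ _ A) N) : Lm2 (ext_d y) = - ext_d (Lm2 y).
Proof. by rewrite (lie_ext vm2) sgE /= scaleN1r. Qed.

Lemma con_bracket_m2 k xi N : vector_field G k xi ->
  con_d (1 + k) (bracket 1 k m2 xi) (x N) = Lm2 (con_d k xi (x N)).
Proof.
move=> vx; rewrite (con_bracket vm2 vx) lie_m2_om (linP0 (der_lin' (con_der N vx))).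
by rewrite scaler0 subr0.
Qed.

Lemma cocycle_form a : is_form G 0 (e + 1) a /\ form_order G 0 c.+3 a.
Proof. by case: (cocycle_bidegree a). Qed.

Lemma cocycle_lie a N : Lm2 (dcls G N (cocycle_val a N)) = 0.
Proof. by have /form_eqP /(_ N) := cocycle_closed a; rewrite /CC_d (dcls_form_L _ _ vm2) dcls0. Qed.

Lemma Upsilon_con a : vector_field G 1 (CC_Upsilon a) /\
  forall N, con_d 1 (CC_Upsilon a) (x N) = sg K (e + 1) *: ext_d (dcls G N (cocycle_val a N)).
Proof. exact: (Upsilon_spec som (addrC e 1) (cocycle_form a).1). Qed.

(** Contracting [om] with [[m2, Upsilon a]] gives [d (L_m2 a)] up to sign, which is zero for a
    cocycle; nondegeneracy of [om] concludes. *)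
Lemma Upsilon_harmonic a : harmonic (CC_Upsilon a).
Proof.
have [fa oa] := cocycle_form a; have [vu eu] := Upsilon_con a.
split; first exact: (Upsilon_symplectic som (addrC e 1) fa).
  exact: (Upsilon_order som oom (addrC e 1) fa oa).
have vb := bracket_vector_field vm2 vu.
have eb : bracket 1 1 m2 (CC_Upsilon a) = (fun=> 0).
  apply: (con_inj som vb (vector_field0 _ _ _)) => N.
  rewrite (con_bracket_m2 N vu) eu (linPZ (der_lin' (lie_der N vm2))) lie_m2_ext cocycle_lie.
  by rewrite (linP0 (der_lin' (ext_der _ _ _))) oppr0 scaler0 con_zero.
move=> y; have := congr1 (fun f => f y) eb; rewrite /bracket sgE /= => <-.
by rewrite scaleN1r opprK.
Qed.

(** Surjectivity on fields provides only a 0-form [al]. The hypothesis on [eta] says that [d] kills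
    [L_m2 al], and [d] is injective on 0-forms of positive order. *)
Lemma Upsilon_onto eta : harmonic eta -> exists a, CC_Upsilon a = eta.
Proof.
case=> se oe he; have [ve _] := se.
have [al [fa oa ua]] := Upsilon_surj som oom (addrC e 1) se oe.
have [vu eu] := Upsilon_spec som (addrC e 1) fa; rewrite ua in vu eu.
have cl : form_eq G (CC_d al) (form_zero _ _).
  apply: (@ext_form0_inj K G _ _ (e + 1 + 1) c.+3).
  - exact: is_form_L vm2 fa.
  - by rewrite -addn1; apply: (form_order_L vm2 (@fm2_order _ _ A)).
  move=> N; rewrite (dcls_form_L _ _ vm2); apply/eqP; rewrite -oppr_eq0 -lie_m2_ext; apply/eqP.
  have -> : ext_d (dcls G N (al N)) = sg K (e + 1) *: con_d 1 eta (x N).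
    by rewrite eu scalerA -sgD sgE oddzD addbb scale1r.
  rewrite (linPZ (der_lin' (lie_der N vm2))) -(con_bracket_m2 N ve).
  have -> : bracket 1 1 m2 eta = (fun=> 0).
    by apply/funext => y; rewrite /bracket sgE /= scaleN1r opprK he.
  by rewrite con_zero scaler0.
by exists (@Cocycle _ _ A c.+3 e al (conj fa oa) cl).
Qed.

Lemma con_commutator xi k N (be : drq G (@fdeg _ _ A) N) : symplectic_field G om 0 xi ->
  con_d 0 xi (x N) = k *: ext_d be ->
  con_d 1 (fun y => xi (m2 y) - m2 (xi y)) (x N) = k *: ext_d (Lm2 be).
Proof.
case=> vx _ ex; have vb := bracket_vector_field vm2 vx; rewrite addr0 in vb.
have -> : (fun y => xi (m2 y) - m2 (xi y)) = (fun y => -1 *: bracket 1 0 m2 xi y).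
  by apply/funext => y; rewrite /bracket sgE /= scale1r scaleN1r opprB.
rewrite (con_scale _ _ vb); last by apply/gr_opp/gr_one.
have := con_bracket_m2 N vx; rewrite addr0 => ->.
rewrite ex (linPZ (der_lin' (lie_der N vm2))) lie_m2_ext.
by module_coefs K; ring.
Qed.

Lemma commutator_field xi : symplectic_field G om 0 xi ->
  vector_field G 1 (fun y => xi (m2 y) - m2 (xi y)).
Proof.
case=> vx _; have := bracket_vector_field vx vm2; rewrite add0r.
by congr vector_field; apply/funext => y; rewrite /bracket sgE /= scale1r.
Qed.

(** A primitive has degree [e] and order [c + 2] as a 0-form, so its field has degree [0] and order
    [c + 1 = n - 1]: primitives correspond to the fields allowed in [exact_field]. *)
Lemma Upsilon_cohomologous a b :
  cohomologous a b <-> exact_field (fun y => CC_Upsilon a y - CC_Upsilon b y).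
Proof.
have [fa oa] := cocycle_form a; have [fb ob] := cocycle_form b.
have [va ea] := Upsilon_con a; have [vb eb] := Upsilon_con b.
have e0 : e = 0 + e by rewrite add0r.
have cdiff N : con_d 1 (fun y => CC_Upsilon a y - CC_Upsilon b y) (x N) =
    sg K (e + 1) *: (ext_d (dcls G N (cocycle_val a N)) - ext_d (dcls G N (cocycle_val b N))).
  have := con_lin (x N) (gr_opp (gr_one G)) vb va.
  have -> : (fun y => -1 *: CC_Upsilon b y + CC_Upsilon a y) =
      (fun y => CC_Upsilon a y - CC_Upsilon b y).
    by apply/funext => y; rewrite scaleN1r addrC.
  by move=> ->; rewrite ea eb; module_coefs K; ring.
have vd : vector_field G 1 (fun y => CC_Upsilon a y - CC_Upsilon b y).
  have := vector_field_lin (gr_opp (gr_one G)) vb va.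
  by congr vector_field; apply/funext => y; rewrite scaleN1r addrC.
split=> [[be [fbe obe] eq]|[xi [sx ox ex]]].
  rewrite /= subrK in fbe obe.
  have [vu eu] := Upsilon_spec som e0 fbe.
  have su := Upsilon_symplectic som e0 fbe.
  have ou := Upsilon_order som oom e0 fbe obe.
  have hs : gr G 0 (-1) by apply/gr_opp/gr_one.
  (* The cocycles are 0-forms of degree [e + 1] and [be] is one of degree [e], so the signs in
     [Upsilon] are opposite; the factor [-1] corrects this. *)
  exists (fun y => -1 *: Upsilon G om e e be y).
  have sxi := symplecticZ hs su.
  split=> // [|y]; first exact: endo_orderZ.
  move: y; apply: (fun E => fun y => congr1 (fun f => f y) E).
  apply: (con_inj som vd (commutator_field sxi)) => N.
  rewrite cdiff (@con_commutator _ (- sg K e) N (dcls G N (be N)) sxi); last first.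
    by rewrite (con_scale _ hs vu) eu; module_coefs K; ring.
  have /form_eqP /(_ N) := eq; rewrite dclsD (dcls_form_L _ _ vm2) => ->.
  rewrite (linPD (der_lin' (ext_der _ _ _))).
  by module_coefs K; sg_ring.
have [be [fbe obe ube]] := Upsilon_surj som oom e0 sx ox.
have [_ eu] := Upsilon_spec som e0 fbe; rewrite ube in eu.
pose be' := form_scale (-1) be.
have fbe' : is_form G 0 e be' by apply: is_form_scale => //; apply/gr_opp/gr_one.
have obe' : form_order G 0 c.+2 be' by apply: form_order_scale.
exists be'; first by split; rewrite ?subrK.
have fL : is_form G 0 (e + 1) (CC_d be') by apply: is_form_L vm2 fbe'.
have oL : form_order G 0 c.+3 (CC_d be').
  by rewrite -[c.+3]addn1; apply: (form_order_L vm2 (@fm2_order _ _ A)).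
have fd := is_form_add fa (is_form_opp (is_form_add fb fL)).
have od := form_order_add oa (form_order_scale (-1) (form_order_add ob oL)).
(* The fields determine only the differentials of the 0-forms. The difference considered here has
   positive order, where [d] is injective. *)
have /form_eqP z : form_eq G (form_add a (form_scale (-1) (form_add b (CC_d be')))) (form_zero _ _).
  apply: (ext_form0_inj fd od) => N.
  rewrite dclsD dclsZ dclsD (dcls_form_L _ _ vm2) dclsZ.
  have lext := der_lin' (ext_der G (@fdeg _ _ A) N).
  rewrite (linPD lext) (linPZ lext) (linPD lext) (linPZ (der_lin' (lie_der N vm2))) (linPZ lext).
  have := cdiff N; rewrite (_ : (fun y => CC_Upsilon a y - CC_Upsilon b y) =
    (fun y => xi (m2 y) - m2 (xi y))); last exact/funext.
  rewrite (con_commutator sx (eu N)) => E.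
  have {}E := congr1 (fun t => sg K (e + 1) *: t) E.
  rewrite !scalerA -!sgD in E.
  move: E; set u := ext_d (Lm2 _); set p := ext_d (dcls G N (cocycle_val a N)); set q := ext_d _ => E.
  transitivity ((p - q) + u); first by module_coefs K; ring.
  have -> : p - q = sg K (e + 1 + (e + 1)) *: (p - q) by rewrite sgE oddzD addbb scale1r.
  by rewrite -E; module_coefs K; sg_ring.
apply/form_eqP => N; have := z N; rewrite dclsD dclsZ scaleN1r dcls0.
by move/eqP; rewrite subr_eq0 => /eqP.
Qed.

(** * The action on classes of extensions *)

Lemma exact_field_lin k zeta eta : gr G 0 k -> exact_field zeta -> exact_field eta ->
  exact_field (fun y => k *: zeta y + eta y).
Proof.
move=> hk [xi [sx ox ex]] [xi' [sx' ox' ex']]; exists (fun y => k *: xi y + xi' y).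
split=> [||y]; [exact: symplectic_lin | by apply: endo_orderD => //; apply: endo_orderZ |].
by rewrite ex ex' (linPD lm2) (linPZ lm2); module_coefs K; ring.
Qed.

Lemma exact_field0 : exact_field (fun=> 0).
Proof.
have s0 : symplectic_field G om 0 (fun=> 0 : g).
  apply/symplecticP; split=> [|N]; first exact: vector_field0.
  rewrite (cartan (vector_field0 _ _ _)) !con_zero.
  by rewrite (linP0 (der_lin' (ext_der _ _ _))) scaler0 addr0.
exists (fun=> 0); split=> [//||y]; last by rewrite (linP0 lm2) subrr.
by move=> n y hy w ne.
Qed.

Lemma exact_field_ext zeta eta : zeta =1 eta -> exact_field zeta -> exact_field eta.
Proof. by move=> h [xi [sx ox ex]]; exists xi; split=> // y; rewrite -h. Qed.

Lemma ext_equiv_refl (mn : extension c.+2 m) : ext_equiv mn mn.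
Proof. by apply/ext_equivP; apply: exact_field_ext exact_field0 => y; rewrite subrr. Qed.

Lemma ext_equiv_sym (mn mn' : extension c.+2 m) : ext_equiv mn mn' -> ext_equiv mn' mn.
Proof.
move/ext_equivP => h; apply/ext_equivP.
apply: exact_field_ext (exact_field_lin (gr_opp (gr_one G)) h exact_field0) => y.
by rewrite addr0 scaleN1r opprB.
Qed.

Lemma ext_equiv_trans (m1 m2' m3 : extension c.+2 m) :
  ext_equiv m1 m2' -> ext_equiv m2' m3 -> ext_equiv m1 m3.
Proof.
move=> /ext_equivP h /ext_equivP h'; apply/ext_equivP.
apply: exact_field_ext (exact_field_lin (gr_one G) h h') => y.
by rewrite scale1r addrC addrA subrK.
Qed.

Definition ext_shift a (mn : extension c.+2 m) : extension c.+2 m :=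
  exist _ _ (extension_add (svalP mn) (Upsilon_harmonic a)).

Lemma ext_shift_equiv a b (mn mn' : extension c.+2 m) :
  cohomologous a b -> ext_equiv mn mn' -> ext_equiv (ext_shift a mn) (ext_shift b mn').
Proof.
move=> /cohomologous_sym/Upsilon_cohomologous h /ext_equivP h'; apply/ext_equivP.
apply: exact_field_ext (exact_field_lin (gr_one G) h h') => y /=.
by module_coefs K; ring.
Qed.

(** [Phi_inv] is a choice and not visibly linear; additivity comes from the injectivity of [Phi]. *)
Lemma Upsilon_add a b y : CC_Upsilon (cocycle_add a b) y = CC_Upsilon a y + CC_Upsilon b y.
Proof.
have [va ea] := Upsilon_con a; have [vb eb] := Upsilon_con b.
have [vu eu] := Upsilon_con (cocycle_add a b).
have vl := vector_field_lin (gr_one G) va vb.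
rewrite -[CC_Upsilon a y]scale1r; move: y; apply: (fun E => fun y => congr1 (fun f => f y) E).
apply: (con_inj som vu vl) => N.
rewrite (con_lin _ (gr_one G) va vb) ea eb eu dclsD (linPD (der_lin' (ext_der _ _ _))).
by module_coefs K; ring.
Qed.

Lemma Upsilon_zero y : CC_Upsilon (cocycle_zero A c.+3 e) y = 0.
Proof.
have [vu eu] := Upsilon_con (cocycle_zero A c.+3 e).
move: y; apply: (fun E => fun y => congr1 (fun f => f y) E).
apply: (con_inj som vu (vector_field0 _ _ _)) => N.
by rewrite eu dcls0 (linP0 (der_lin' (ext_der _ _ _))) scaler0 con_zero.
Qed.

Local Notation ecl := (class_of (@ext_equiv K G A c.+2 m)).
Local Notation ccl := (class_of (@cohomologous K G A c.+3 e)).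

(** Representatives are picked by classical choice; [ext_actE] shows that the result does not depend
    on them. *)
Definition ext_act (h : HC A c.+3 e) (z : SE c.+2 m) : SE c.+2 m :=
  ecl (ext_shift (class_repr h) (class_repr z)).

Lemma eq_ext_class (mn mn' : extension c.+2 m) : ecl mn = ecl mn' <-> ext_equiv mn mn'.
Proof.
split=> [h|]; last exact: (eq_class ext_equiv_sym ext_equiv_trans).
apply: ext_equiv_trans (class_repr_of ext_equiv_refl ext_equiv_sym mn) _.
by rewrite h; apply/ext_equiv_sym/(class_repr_of ext_equiv_refl ext_equiv_sym).
Qed.

Lemma ext_actE a (mn : extension c.+2 m) : ext_act (ccl a) (ecl mn) = ecl (ext_shift a mn).
Proof.
apply/eq_ext_class; apply: ext_shift_equiv.
  apply: cohomologous_sym; apply: class_repr_of;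
    [exact: cohomologous_refl | exact: cohomologous_sym].
by apply: ext_equiv_sym; apply: (class_repr_of ext_equiv_refl ext_equiv_sym).
Qed.

Lemma ext_act_is_action : is_add_action ext_act.
Proof.
split=> [z|h h' z]; rewrite -(class_reprK z).
  rewrite [0]/(ccl (cocycle_zero A c.+3 e)) ext_actE; apply/eq_ext_class/ext_equivP.
  by apply: exact_field_ext exact_field0 => y /=; rewrite Upsilon_zero addr0 subrr.
rewrite -(class_reprK h) -(class_reprK h') [X in ext_act X]class_addE; last first.
- exact: cohomologous_add.
- exact: cohomologous_trans.
- exact: cohomologous_sym.
- exact: cohomologous_refl.
rewrite !ext_actE; apply/eq_ext_class/ext_equivP.
apply: exact_field_ext exact_field0 => y /=.
by rewrite Upsilon_add; module_coefs K; ring.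
Qed.

Lemma ext_act_free : free_action ext_act.
Proof.
move=> h z; rewrite -(class_reprK z) -(class_reprK h) ext_actE => /eq_ext_class.
move/ext_equiv_sym/ext_equivP => E.
rewrite [0]/(ccl (cocycle_zero A c.+3 e)).
apply: (eq_class (@cohomologous_sym _ _ A _ _) (@cohomologous_trans _ _ A _ _)).
apply/Upsilon_cohomologous; apply: exact_field_ext E => y /=.
by rewrite Upsilon_zero subr0 addrAC subrr add0r.
Qed.

Lemma ext_act_transitive : transitive_action ext_act.
Proof.
move=> z z'; rewrite -(class_reprK z) -(class_reprK z').
set mn := class_repr z; set mn' := class_repr z'.
have [a ea] := Upsilon_onto (extension_diff (svalP mn) (svalP mn')).
exists (ccl a); rewrite ext_actE; apply/eq_ext_class/ext_equivP.
apply: exact_field_ext exact_field0 => y /=.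
by rewrite ea; module_coefs K; ring.
Qed.
End Extensions.

Theorem theorem12p8 (K : comAlgType rat) (G : even_grading K)
  (A : frobenius G) (n : nat) (n_ge3 : (3 <= n)%N)
  (m : free_lie K (@fdeg K G A) -> free_lie K (@fdeg K G A))
  (m_struct : SC_structure n m) (m_ext : extendable n m) :
  exists act : HC A n.+1 (@fom_deg K G A) -> SE n m -> SE n m,
    [/\ is_add_action act,
        free_action act,
        transitive_action act &
        forall (al : cocycle A n.+1 (@fom_deg K G A)) (mn : extension n m),
          exists2 mn' : extension n m,
            forall y, sval mn' y = sval mn y + CC_Upsilon al y &
            act (class_of (@cohomologous K G A n.+1 (@fom_deg K G A)) al)
                (class_of (@ext_equiv K G A n m) mn) =
            class_of (@ext_equiv K G A n m) mn'].
Proof.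
(* With [n = c + 3], the excess [n - 2] used above is [c.+1], and [n >= 3] is what makes it
   positive. *)
case: n n_ge3 m_struct m_ext => [|[|[|c]]] // _ ms _.
have c1 : (0 < c.+1)%N by [].
exists (ext_act c1 ms); split.
- exact: ext_act_is_action.
- exact: ext_act_free.
- exact: ext_act_transitive.
- by move=> al mn; exists (ext_shift c1 ms al mn) => //; apply: ext_actE.
Qed.
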